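(* Let $\phi,\psi:[0,1]\to\mathbb{R}$ be quadratic, with $\phi$ concave, $\phi(0)=\phi(1)=0$, $-1<\phi'(1)<0$, and $\psi$ convex, $\psi(1)=0$, $\psi'(1)<0$, $\psi''(1)-\phi''(1)>0$. Let $w(x,t)$, with associated function $\kappa(\cdot)$, be the solution of $$\frac{\partial w}{\partial t}+[\phi(x)-\kappa(t)\psi(x)]\frac{\partial w}{\partial x}=w,\qquad \int_0^1 w(x,t)\,dx=1,\qquad 0\le x<1,\ t\ge 0,$$ with initial data $w(\cdot,0)=w_0$ whose beta function satisfies $\lim_{x\to1}\beta(x,0)=\beta_0>0$ (necessarily $\beta_0\le 1$). Set $\kappa=[1/\beta_0-\phi'(1)-1]/|\psi'(1)|$ and $\kappa_0=\phi'(1)/\psi'(1)$. If $\beta_0<1$, then $$\lim_{t\to\infty}\kappa(t)=\kappa,\qquad \lim_{t\to\infty}\sup_{0\le x<1}|\beta(x,t)-\beta_\kappa(x)|=0,$$ where $\beta_\kappa$ is the beta function of the time independent solution $w_\kappa$. If $\beta_0=1$, then for every $\varepsilon$ with $0<\varepsilon<1$, $$\lim_{t\to\infty}\kappa(t)=\kappa_0,\qquad \lim_{t\to\infty}\ \sup_{0\le x\le 1-\varepsilon}|\beta(x,t)-\beta_{\kappa_0}(x)|=0.$$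
   Context: Quadratic coefficients: $\phi(x)=\phi'(1)x(x-1)$ and $\psi(x)=\psi'(1)(x-1)+\tfrac12\psi''(1)(x-1)^2$ (with $\psi''(1)\ge 0$). Initial data: $w_0(x)=\int_x^1 c_0(x')\,dx'$, $0\le x<1$, where $c_0\ge 0$ is an integrable function on $[0,1)$, $w_0(x)>0$ for all $0\le x<1$, and $\int_0^1 w_0(x)\,dx=1$. Solution: $\kappa:[0,\infty)\to(0,\infty)$ is the continuous function uniquely determined by the requirement that the solution $w$ of the PDE satisfies $\int_0^1 w(x,t)\,dx=1$ for all $t\ge0$. The solution is $w(x,t)=e^t w_0(F(x,t))$, where $F(x,t)=x(0)$ and $x(s)$, $0\le s\le t$, solves $\frac{dx(s)}{ds}=\phi(x(s))-\kappa(s)\psi(x(s))$, $x(t)=x$. Beta function: $c(x,t)=-\partial w(x,t)/\partial x=e^tc_0(F(x,t))\,\partial F(x,t)/\partial x$, $h(x,t)=\int_x^1 w(x',t)\,dx'$, $\beta(x,t)=c(x,t)h(x,t)/w(x,t)^2$, $0\le x<1$. Time independent solutions: for each constant $\kappa\ge\kappa_0$, $w_\kappa$ is the function on $[0,1)$ with $[\phi(x)-\kappa\psi(x)]w_\kappa'(x)=w_\kappa(x)$ and $\int_0^1 w_\kappa\,dx=1$; its beta function is $\beta_\kappa(x)=-w_\kappa'(x)\int_x^1 w_\kappa(x')\,dx'/w_\kappa(x)^2$. *)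

(* Defs.v *)
From HB Require Import structures.
From mathcomp Require Import all_boot all_order all_algebra.
From mathcomp Require Import all_classical all_reals all_analysis.

Set Implicit Arguments.
Unset Strict Implicit.
Unset Printing Implicit Defensive.

Import Order.TTheory GRing.Theory Num.Theory.
Import numFieldNormedType.Exports.

Local Open Scope classical_set_scope.
Local Open Scope ring_scope.

(* Derivative at x of a function whose domain is D: only difference quotients
   with y in D are used, so it is one-sided at an endpoint of an interval D
   and does not depend on the values of f outside D. *)
Definition is_deriv_in (R : realType) (D : set R) (f : R -> R) (x l : R) : Prop :=
  (f y - f x) / (y - x) @[y --> within D x^'] --> l.

Definition deriv_in (R : realType) (D : set R) (f : R -> R) (x : R) : R :=
  lim ((f y - f x) / (y - x) @[y --> within D x^']).

Definition w_init (R : realType) (c0 : R -> R) (x : R) : R :=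
  \int[@lebesgue_measure R]_(y in `[x, 1[) c0 y.

Definition initial_data (R : realType) (c0 : R -> R) : Prop :=
  [/\ (@lebesgue_measure R).-integrable `[0, 1[ (EFin \o c0),
      forall x : R, x \in `[0, 1[ -> 0 <= c0 x,
      forall x : R, x \in `[0, 1[ -> 0 < w_init c0 x &
      \int[@lebesgue_measure R]_(x in `[0, 1[) w_init c0 x = 1].

(* xi is the characteristic through (x, t), followed on the time interval
   [0, t]; phi and psi are functions on [0, 1], hence the range condition. *)
Definition characteristic (R : realType) (phi psi : {poly R}) (kappa : R -> R)
    (x t : R) (xi : R -> R) : Prop :=
  [/\ forall s : R, s \in `[0, t] -> xi s \in `[0, 1],
      forall s : R, s \in `[0, t] ->
        is_deriv_in `[0, t] xi s (phi.[xi s] - kappa s * psi.[xi s]) &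
      xi t = x].

Definition flow_map (R : realType) (phi psi : {poly R}) (kappa : R -> R)
    (F : R -> R -> R) : Prop :=
  forall x t : R, x \in `[0, 1[ -> 0 <= t ->
    exists2 xi : R -> R, characteristic phi psi kappa x t xi & F x t = xi 0.

Definition w_sol (R : realType) (c0 : R -> R) (F : R -> R -> R) (x t : R) : R :=
  expR t * w_init c0 (F x t).

(* The solution of the evolution equation with initial data w_init c0, given by
   the function kappa which enforces the conservation law and by the flow map F
   of the characteristics; the solution itself is then w_sol c0 F. *)
Definition solution (R : realType) (phi psi : {poly R}) (c0 kappa : R -> R)
    (F : R -> R -> R) : Prop :=
  [/\ {within `[0, +oo[, continuous kappa},
      forall t : R, 0 <= t -> 0 < kappa t,
      flow_map phi psi kappa F &
      forall t : R, 0 <= t ->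
        \int[@lebesgue_measure R]_(x in `[0, 1[) w_sol c0 F x t = 1].

(* c = - dw/dx; since c0 is only integrable, this is given pointwise by the
   chain rule formula rather than by differentiating w. *)
Definition c_sol (R : realType) (c0 : R -> R) (F : R -> R -> R) (x t : R) : R :=
  expR t * c0 (F x t) * deriv_in `[0, 1[ (fun y => F y t) x.

Definition h_sol (R : realType) (c0 : R -> R) (F : R -> R -> R) (x t : R) : R :=
  \int[@lebesgue_measure R]_(y in `[x, 1[) w_sol c0 F y t.

Definition beta (R : realType) (c0 : R -> R) (F : R -> R -> R) (x t : R) : R :=
  c_sol c0 F x t * h_sol c0 F x t / w_sol c0 F x t ^+ 2.

Definition time_independent (R : realType) (phi psi : {poly R}) (kappa : R)
    (w : R -> R) : Prop :=
  (forall x : R, x \in `[0, 1[ ->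
     exists2 l : R, is_deriv_in `[0, 1[ w x l &
       (phi.[x] - kappa * psi.[x]) * l = w x)
  /\ \int[@lebesgue_measure R]_(x in `[0, 1[) w x = 1.

Definition beta_ti (R : realType) (w : R -> R) (x : R) : R :=
  - deriv_in `[0, 1[ w x * (\int[@lebesgue_measure R]_(y in `[x, 1[) w y)
    / w x ^+ 2.

(* Supremum in the extended reals: the real-valued sup of an unbounded set
   would be 0. *)
Definition sup_dist (R : realType) (A : set R) (f g : R -> R) : \bar R :=
  ereal_sup [set (`|f x - g x|)%:E | x in A].

(* Main.v *)
Require Import Defs.
From HB Require Import structures.
From mathcomp Require Import all_boot all_order all_algebra.
From mathcomp Require Import all_classical all_reals all_analysis.
From mathcomp Require Import ring lra.

Import Order.TTheory GRing.Theory Num.Theory.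
Import numFieldNormedType.Exports.

Local Open Scope classical_set_scope.
Local Open Scope ring_scope.

(** In the variable z = 1 - x the characteristics solve the Bernoulli equation
    z' = lam z + mu z^2, with lam and mu affine in kappa.  Hence the flow is the
    Moebius map z |-> z / (E + B z) with E' = lam E and B' = mu E, and
    w(x, t) = e^t W (z / (E + B z)) with W v = w_0 (1 - v).  If H is the primitive
    of W, then beta (., 0) -> beta0 at 1 says that G = H / W has slope close to
    ga = 1 - beta0 near 0, and for large t only small arguments of W matter.

    The long time behaviour is governed by the number
    X = G (delta) (E + B)^2 / E, with delta = 1 / (E + B).  Put a1 = w (1) - 1 and
    a2 = w (1) - 2 int z w (profiles in z).  Differentiating the conservation law
    gives lam a1 + mu a2 = 1, an integration by parts gives
    X a2 + ga (a1 - a2) = beta0 + o(1), and X' = ga (lam + mu) - lam X + o(lam + mu).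
    If mu = m0 + mu1 lam and N = a1 + mu1 a2, these combine to N X' = Xl - X + o(1)
    for a constant Xl, so X converges, and with it lam and kappa.

    Finally beta (x, t) = beta (1 - z / (E + B z), 0) xi / S, where S z^-1 tends to
    beta0 (lam + mu z) and xi = (int_0^z w) / w solves xi' = 1 - (1 - G') xi / S,
    to be compared with xi' = 1 - xi / (lam z + mu z^2) for the stationary profile.

    Since c0 is merely integrable, W need not be differentiable: the derivatives
    of G, X and xi are replaced by differentiable functions that touch them from
    one side. *)

(** If [G] were linear with slope [ga > 0], the shape of the profile would depend on [B / E] alone
    and [X] would be [ga (1 + B / E)]. For [ga = 0] the ratio [B / E] blows up while [X] keeps a
    positive limit, so [X] is the quantity that treats both cases at once; the absolute estimates
    below therefore have error coefficients bounded uniformly in [E] and [B].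

    The number [N] appears because [mu = m0 + mu1 lam] turns the conservation law into
    [lam N = 1 - m0 a2] and [N (lam + mu) = 1 + mu1 + m0 (a1 - a2)]. The relaxation [N X' = Xl - X]
    could still stall if [N] were unbounded; a positive lower bound on [X] excludes this.

    The two conclusions differ because the stationary velocity is [V z = lam z + mu z^2] with
    [lam = 1 / beta0 - 1]. For [beta0 < 1] it is of order [z] near [z = 0] and relative errors can
    be controlled up to [x = 1]. For [beta0 = 1] it vanishes to second order, only absolute errors
    are small, and [z] has to stay away from 0. *)

(** * Derivatives in epsilon form and monotonicity from one-sided tangents *)

Section Calculus.
Context {R : realType}.
Implicit Types (f g : R -> R) (x y a b l : R).

Lemma cvg_epsP f x l :
  f y @[y --> x] --> l <->
  forall e, 0 < e -> exists2 d, 0 < d & forall y, `|y - x| < d -> `|f y - l| < e.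
Proof.
split=> [h e e0|h].
  move/cvgrPdist_lt: h => /(_ e e0) h.
  have [d /= d0 H] := (nbhs_ballP _ _).1 h; exists d => // y yd.
  by rewrite distrC; apply: H; rewrite /ball /= distrC.
apply/cvgrPdist_lt => e e0; have [d d0 H] := h e e0.
apply: (nbhs_ballP x (fun y => `|l - f y| < e)).2.
exists d => //= y; rewrite /ball /= => yd.
by rewrite distrC; apply: H; rewrite distrC.
Qed.

Lemma is_derive_epsP f x l :
  is_derive x (1 : R) f l <->
  forall e, 0 < e -> exists2 d, 0 < d &
    forall y, `|y - x| < d -> `|f y - f x - l * (y - x)| <= e * `|y - x|.
Proof.
split=> [h e e0|h].
  have /= dl := @derive_val _ _ _ _ _ _ _ h.
  have [h1 _] := h.
  have h2 : (fun y : R => y^-1 *: ((f \o shift x) (y *: (1 : R)) - f x)) @ 0^' --> l.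
    by rewrite -dl; exact: h1.
  move/cvgrPdist_lt: h2 => /(_ e e0) h2.
  have [d /= d0 H] := (nbhs_ballP _ _).1 h2; exists d => // y yd.
  have [->|yx] := eqVneq y x; first by rewrite !subrr mulr0 subr0 normr0 mulr0.
  have yx0 : y - x != 0 by rewrite subr_eq0.
  have := H (y - x); rewrite /ball /= sub0r normrN => /(_ yd yx0).
  rewrite /GRing.scale /= mulr1 subrK => {}H.
  have -> : f y - f x - l * (y - x) = - ((l - (y - x)^-1 * (f y - f x)) * (y - x)).
    by field.
  by rewrite normrN normrM ler_wpM2r// ltW.
have cv : (fun y : R => y^-1 *: ((f \o shift x) (y *: (1 : R)) - f x)) @ 0^' --> l.
  apply/cvgrPdist_le => e e0; have [d d0 H] := h e e0.
  apply: (nbhs_ballP 0 (fun y : R => y != 0 ->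
    `|l - y^-1 *: ((f \o shift x) (y *: (1 : R)) - f x)| <= e)).2.
  exists d => //= y; rewrite /ball /= sub0r normrN => yd y0.
  rewrite /GRing.scale /= mulr1.
  have := H (y + x); rewrite addrK => /(_ yd) {}H.
  have -> : l - y^-1 * (f (y + x) - f x) = - (f (y + x) - f x - l * y) / y.
    by field.
  by rewrite normrM normrN normfV ler_pdivrMr ?normr_gt0.
apply: DeriveDef; last by apply: cvg_lim => //.
by apply/cvg_ex; exists l.
Qed.

Lemma is_derive_continuous {f x l} : is_derive x 1 f l -> {for x, continuous f}.
Proof.
by move=> h; apply/differentiable_continuous/derivable1_diffP/ex_derive.
Qed.

Lemma is_derive_lamD {f g x a b} : is_derive x 1 f a -> is_derive x 1 g b ->
  is_derive x 1 (fun y => f y + g y) (a + b).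
Proof. exact: is_deriveD. Qed.

Lemma is_derive_lamN {f x a} : is_derive x 1 f a ->
  is_derive x 1 (fun y => - f y) (- a).
Proof. exact: is_deriveN. Qed.

Lemma is_derive_lamM {f g x a b} : is_derive x 1 f a -> is_derive x 1 g b ->
  is_derive x 1 (fun y => f y * g y) (a * g x + f x * b).
Proof.
move=> h1 h2; apply: is_derive_eq (is_deriveM h1 h2) _.
by rewrite /GRing.scale /= addrC [g x * a]mulrC.
Qed.

Lemma is_derive_lamV {f x a} : f x != 0 -> is_derive x 1 f a ->
  is_derive x 1 (fun y => (f y)^-1) (- a / f x ^+ 2).
Proof.
move=> f0 h; apply: is_derive_eq (is_deriveV f0 h) _.
by rewrite /GRing.scale /=; field.
Qed.

Lemma is_derive_lamX {f x a} : is_derive x 1 f a ->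
  is_derive x 1 (fun y => f y ^+ 2) (2 * f x * a).
Proof.
move=> h; apply: is_derive_eq (is_derive_lamM h h) _; ring.
Qed.

Lemma is_derive_lam_comp {f g x a b} : is_derive (g x) 1 f a -> is_derive x 1 g b ->
  is_derive x 1 (fun y => f (g y)) (a * b).
Proof. exact: is_derive1_comp. Qed.

Lemma is_derive_lam_id x : is_derive x 1 (fun y : R => y) 1.
Proof. exact: is_derive_id. Qed.

Lemma is_derive_lam_cst (c : R) x : is_derive x 1 (fun=> c) 0.
Proof. exact: is_derive_cst. Qed.

Lemma is_derive_near f g x l d : 0 < d -> (forall y, `|y - x| < d -> f y = g y) ->
  is_derive x 1 f l -> is_derive x 1 g l.
Proof.
move=> d0 fg; apply: near_eq_is_derive.
apply: (nbhs_ballP x (fun y => f y = g y)).2.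
exists d => //= y; rewrite /ball /= => yd.
by apply: fg; rewrite distrC.
Qed.

(* A bound by l of the upper right Dini derivative of f at x, by a tangent from above. *)
Definition upper_slope f x l := exists psi : R -> R, [/\ psi x = f x,
  is_derive x 1 psi l & exists2 d, 0 < d & forall y, x < y < x + d -> f y <= psi y].

Lemma upper_slopeD f g x a l : upper_slope f x a -> is_derive x 1 g l ->
  upper_slope (fun y => f y + g y) x (a + l).
Proof.
move=> [psi [p1 p2 [d d0 p3]]] dg; exists (fun y => psi y + g y); split.
- by rewrite p1.
- exact: is_derive_lamD.
- by exists d => // y yd; rewrite lerD2r p3.
Qed.

Lemma is_derive_upper_slope f x l : is_derive x 1 f l -> upper_slope f x l.
Proof. by move=> df; exists f; split => //; exists 1. Qed.

Let upper_slope_lt0_nonincr f a b :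
  (forall x, a <= x <= b -> {for x, continuous f}) ->
  (forall x, a < x < b -> exists2 l, upper_slope f x l & l < 0) ->
  a <= b -> f b <= f a.
Proof.
move=> cf sf; rewrite le_eqVlt => /predU1P[->//|ab].
(* Slopes are given on the open interval only; continuity at [a] allows the comparison to start at
   an interior point. *)
suff H a' : a < a' < b -> f b <= f a'.
  rewrite leNgt; apply/negP => fafb.
  have aab : a <= a <= b by rewrite lexx ltW.
  have /cvg_epsP /(_ (f b - f a)) := cf a aab.
  rewrite subr_gt0 => /(_ fafb) [d d0 Hd].
  pose a' := a + Num.min d (b - a) / 2.
  have m0 : 0 < Num.min d (b - a) by rewrite lt_min d0 subr_gt0.
  have md : Num.min d (b - a) <= d by rewrite ge_min lexx.
  have mb : Num.min d (b - a) <= b - a by rewrite ge_min lexx orbT.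
  have /H fa' : a < a' < b by rewrite /a'; apply/andP; split; lra.
  have := Hd a'; rewrite /a' addrAC subrr add0r gtr0_norm ?divr_gt0//.
  rewrite -/a' => /(_ ltac:(lra)); move: fa'; rewrite ltr_norml => ? /andP[]; lra.
move=> /andP[aa' a'b]; rewrite leNgt; apply/negP => fab.
(* By continuity [S] contains its supremum [s]. If [s < b], the tangent of negative slope at [s]
   produces a later point of [S]. *)
pose S := [set y | a' <= y <= b /\ f y <= f a'].
have S0 : S a' by split; rewrite // lexx ltW.
have supS : has_sup S.
  by split; [exists a'|exists b => y [/andP[]]].
set s := sup S.
have a's : a' <= s by apply: ub_le_sup => //; exact: supS.2.
have sb : s <= b by apply: ge_sup; [exists a'|move=> y [/andP[]]].
have fs : f s <= f a'.
  rewrite leNgt; apply/negP => fas.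
  have asb : a <= s <= b by rewrite sb andbT (le_trans _ a's)// ltW.
  have /cvg_epsP /(_ (f s - f a')) := cf s asb.
  rewrite subr_gt0 => /(_ fas) [d d0 Hd].
  have [y [/andP[y1 y2] y3] ys] := sup_adherent d0 supS.
  have ys' : y <= s by apply: ub_le_sup; [exact: supS.2|split; rewrite ?y1].
  have := Hd y; rewrite ler0_norm ?subr_le0// -/s opprB.
  move: ys; rewrite -/s => ys /(_ ltac:(lra)); rewrite ltr_norml => /andP[]; lra.
have sltb : s < b.
  by rewrite lt_neqAle sb andbT; apply/eqP => sb'; move: fs; rewrite sb' leNgt fab.
have [l [psi [p1 p2 [d d0 p3]]] l0] : exists2 l, upper_slope f s l & l < 0.
  by apply: sf; rewrite sltb andbT (lt_le_trans aa').
have /is_derive_epsP /(_ (- l / 2)) := p2.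
case=> [|e e0 He]; first lra.
pose m := Num.min (Num.min d e) (b - s).
have m0 : 0 < m by rewrite !lt_min d0 e0 subr_gt0.
have md : m <= d by rewrite !ge_min lexx.
have me : m <= e by rewrite !ge_min lexx orbT.
have mb : m <= b - s by rewrite !ge_min lexx !orbT.
pose y := s + m / 2.
have ys : y - s = m / 2 by rewrite /y addrAC subrr add0r.
have := He y; rewrite ys gtr0_norm ?divr_gt0// => /(_ ltac:(lra)).
rewrite ler_norml => /andP[_ Hy].
have py : psi y <= psi s by nra.
have fy : f y <= psi y by apply: p3; rewrite /y; apply/andP; split; lra.
have : y <= s.
  apply: ub_le_sup; first exact: supS.2.
  split; first by rewrite /y; apply/andP; split; lra.
  by rewrite (le_trans fy)// (le_trans py)// p1.
by rewrite /y; lra.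
Qed.

(** Subtracting [e * x] makes the slopes strictly negative; then [e] tends to 0. *)
Lemma upper_slope_nonincr {f a b} :
  (forall x, a <= x <= b -> {for x, continuous f}) ->
  (forall x, a < x < b -> exists2 l, upper_slope f x l & l <= 0) ->
  a <= b -> f b <= f a.
Proof.
move=> cf sf ab.
suff H e : 0 < e -> f b + - (e * b) <= f a + - (e * a).
  rewrite leNgt; apply/negP => fab.
  have e0 : 0 < (f b - f a) / (b - a + 1) / 2.
    by rewrite divr_gt0// divr_gt0 ?subr_gt0//; lra.
  have ne : b - a + 1 != 0 by lra.
  have E : (f b - f a) = 2 * ((f b - f a) / (b - a + 1) / 2) * (b - a + 1) by field.
  have := H _ e0; move: e0 E; set e := (f b - f a) / _ / _; nra.
move=> e0; apply: (@upper_slope_lt0_nonincr (fun y => f y + - (e * y))) => // x xab.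
  apply: cvgD; first exact: cf.
  by apply: cvgN; apply: cvgM; [exact: cvg_cst|exact: cvg_id].
have [l hl l0] := sf x xab.
exists (l - e); last lra.
apply: upper_slopeD => //.
apply: is_derive_eq (is_derive_lamN (is_derive_lamM (is_derive_lam_cst e x) (is_derive_lam_id x))) _.
by rewrite mul0r mulr1 add0r.
Qed.

Lemma is_derive_nonincr {f df a b} :
  (forall x, a <= x <= b -> {for x, continuous f}) ->
  (forall x, a < x < b -> is_derive x 1 f (df x)) ->
  (forall x, a < x < b -> df x <= 0) -> a <= b -> f b <= f a.
Proof.
move=> cf hf df0; apply: upper_slope_nonincr => // x xab.
by exists (df x); [exact/is_derive_upper_slope/hf|exact: df0].
Qed.

Lemma is_derive_nondecr {f df a b} :
  (forall x, a <= x <= b -> {for x, continuous f}) ->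
  (forall x, a < x < b -> is_derive x 1 f (df x)) ->
  (forall x, a < x < b -> 0 <= df x) -> a <= b -> f a <= f b.
Proof.
move=> cf hf df0 ab; rewrite -lerN2.
apply: (@is_derive_nonincr (fun x => - f x) (fun x => - df x) a b _ _ _ ab) => x xab.
- by apply: cvgN; exact: cf.
- exact/is_derive_lamN/hf.
- by rewrite oppr_le0 df0.
Qed.

Lemma is_derive_le0 {f df a b} :
  (forall x, a <= x <= b -> is_derive x 1 f (df x)) ->
  (forall x, a < x < b -> df x <= 0) -> a <= b -> f b <= f a.
Proof.
move=> hf; apply: is_derive_nonincr => x xab.
  exact/is_derive_continuous/hf.
by apply: hf; case/andP: xab => /ltW -> /ltW ->.
Qed.

Lemma is_derive_ge0 {f df a b} :
  (forall x, a <= x <= b -> is_derive x 1 f (df x)) ->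
  (forall x, a < x < b -> 0 <= df x) -> a <= b -> f a <= f b.
Proof.
move=> hf; apply: is_derive_nondecr => x xab.
  exact/is_derive_continuous/hf.
by apply: hf; case/andP: xab => /ltW -> /ltW ->.
Qed.

Lemma ler_small {d A B C : R} : 0 < d -> (forall u, 0 < u < d -> A <= B + C * u) -> A <= B.
Proof.
move=> d0 h; rewrite leNgt; apply/negP => BA.
have C1 : 0 < `|C| + 1 by rewrite ltr_wpDl.
have m0 : 0 < Num.min d ((A - B) / (`|C| + 1)).
  by rewrite lt_min d0 divr_gt0// subr_gt0.
pose u := Num.min d ((A - B) / (`|C| + 1)) / 2.
have u0 : 0 < u by rewrite divr_gt0.
have ud : u < d.
  have : Num.min d ((A - B) / (`|C| + 1)) <= d by rewrite ge_min lexx.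
  by rewrite /u; lra.
have uC : u * (`|C| + 1) < A - B.
  have : Num.min d ((A - B) / (`|C| + 1)) <= (A - B) / (`|C| + 1) by rewrite ge_min lexx orbT.
  rewrite ler_pdivlMr// => ?; rewrite /u; move: m0 C1; nra.
have := h u; rewrite u0 ud => /(_ isT).
have := ler_norm C; nra.
Qed.

(** After the last point where [f <= K] the function stays above [K], hence is nonincreasing there
    and cannot rise above its value at that point. *)
Lemma upper_slope_barrier {f a b K} :
  (forall x, a <= x <= b -> {for x, continuous f}) ->
  (forall x, a < x < b -> K < f x -> exists2 l, upper_slope f x l & l <= 0) ->
  a <= b -> f a <= K -> f b <= K.
Proof.
move=> cf sf ab fa; rewrite leNgt; apply/negP => fK.
pose S := [set y | a <= y <= b /\ f y <= K].
have S0 : S a by split; rewrite // lexx.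
have supS : has_sup S by split; [exists a|exists b => y [/andP[]]].
set s := sup S.
have t1s : a <= s by apply: ub_le_sup => //; exact: supS.2.
have st : s <= b by apply: ge_sup; [exists a|move=> y [/andP[]]].
have fs : f s <= K.
  rewrite leNgt; apply/negP => fas.
  have /cvg_epsP /(_ (f s - K)) := cf s ltac:(by rewrite t1s).
  rewrite subr_gt0 => /(_ fas) [d d0 Hd].
  have [y [/andP[y1 y2] y3] ys] := sup_adherent d0 supS.
  have ys' : y <= s by apply: ub_le_sup; [exact: supS.2|split; rewrite ?y1].
  have := Hd y; rewrite ler0_norm ?subr_le0// -/s opprB.
  move: ys; rewrite -/s => ys /(_ ltac:(lra)); rewrite ltr_norml => /andP[]; lra.
have sK y : s < y < b -> K < f y.
  move=> /andP[sy yt]; rewrite ltNge; apply/negP => fy.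
  have : y <= s by apply: ub_le_sup; [exact: supS.2|split => //; rewrite (le_trans t1s) ltW].
  by rewrite leNgt sy.
have : f b <= f s.
  apply: upper_slope_nonincr => // x /andP[sx xb].
    by apply: cf; rewrite xb (le_trans t1s).
  by apply: sf; rewrite ?sK ?sx// xb (le_lt_trans t1s).
lra.
Qed.

(** Above [K] the function loses at least [c] per unit of time, so it reaches [K] no later than
    [T + (f T - K) / c]; the barrier then keeps it below. *)
Lemma upper_slope_eventually_le f T K c : 0 < c ->
  (forall t, T <= t -> {for t, continuous f}) ->
  (forall t, T <= t -> K < f t -> exists2 l, upper_slope f t l & l <= - c) ->
  exists2 T', T <= T' & forall t, T' <= t -> f t <= K.
Proof.
move=> c0 cf sf.
have dec a b : T <= a -> a <= b -> (forall y, a < y < b -> K < f y) ->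
    f b + c * b <= f a + c * a.
  move=> Ta ab fK.
  apply: (@upper_slope_nonincr (fun y => f y + c * y)) => // x /andP[ax xb].
    apply: cvgD; first exact/cf/(le_trans Ta).
    by apply: cvgM; [exact: cvg_cst|exact: cvg_id].
  have fKx : K < f x by rewrite fK// ax.
  have [l hl lc] := sf x (ltW (le_lt_trans Ta ax)) fKx.
  exists (l + (0 * x + c * 1)); last lra.
  by apply: upper_slopeD => //; exact: is_derive_lamM (is_derive_lam_cst _ _) (is_derive_lam_id _).
have [t1 Tt1 ft1] : exists2 t1, T <= t1 & f t1 <= K.
  apply: contrapT => H.
  have {}H t : T <= t -> K < f t.
    by move=> Tt; rewrite ltNge; apply/negP => ftK; apply: H; exists t.
  have fT := H T (lexx _).
  have d0 : 0 <= (f T - K) / c by rewrite divr_ge0 ?subr_ge0// ltW.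
  have := @dec T (T + (f T - K) / c) (lexx _) ltac:(lra)
    (fun y yT => H y (ltW (andP yT).1)).
  have := H (T + (f T - K) / c) ltac:(lra).
  have : c * ((f T - K) / c) = f T - K by field; rewrite gt_eqF.
  nra.
exists t1 => // t t1t; apply: (@upper_slope_barrier _ t1 t) => // x /andP[t1x _].
  exact/cf/(le_trans Tt1).
move=> fx; have [l hl lc] := sf x (le_trans Tt1 (ltW t1x)) fx.
by exists l => //; lra.
Qed.

End Calculus.

Ltac derive_rec :=
  first [ eassumption
        | exact: is_derive_lam_cst | exact: is_derive_lam_id
        | eapply is_derive_lamX; derive_rec
        | eapply is_derive_lamV; [ | derive_rec ]
        | eapply is_derive_lamN; derive_rec
        | eapply is_derive_lamM; [ derive_rec | derive_rec ]
        | eapply is_derive_lamD; [ derive_rec | derive_rec ]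
        | idtac ].
Ltac derive := eapply is_derive_eq; [ derive_rec | ]; cbv beta.

(** * Primitives of locally integrable functions *)

Section Primitive.
Context {R : realType}.
Notation mu := (@lebesgue_measure R).
Implicit Types (f g : R -> R) (x y a b l : R).

Definition loc_integrable f := forall u, mu.-integrable `[-1, u] (EFin \o f).

(** The integral starts at -1 so that 0 is an interior point and derivatives at 0 are two-sided; the
    subtracted constant puts the zero of the primitive at 0. *)
Definition prim f x : R :=
  \int[mu]_(y in `[-1, x]) f y - \int[mu]_(y in `[-1, 0]) f y.

Lemma prim0 f : prim f 0 = 0.
Proof. by rewrite /prim subrr. Qed.

Lemma continuous_loc_integrable f : continuous f -> loc_integrable f.
Proof.
move=> cf u; apply: continuous_compact_integrable; first exact: segment_compact.
exact: continuous_subspaceT.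
Qed.

Lemma prim_is_derive {f x} : loc_integrable f -> -1 < x -> {for x, continuous f} ->
  is_derive x 1 (prim f) (f x).
Proof.
move=> fi x1 fx.
have xx : x < x + 1 by rewrite ltrDl.
have [||h1 h2] := @continuous_FTC1 R f (BLeft (-1)) x (x + 1) xx (fi (x + 1)).
- by rewrite lte_fin.
- exact: fx.
have h : is_derive x 1 (fun x : R => \int[mu]_(y in `[-1, x]) f y) (f x).
  by apply: DeriveDef; [exact: h1|rewrite -derive1E].
apply: is_derive_eq (is_derive_lamD h (is_derive_lam_cst (- \int[mu]_(y in `[-1, 0]) f y) x)) _.
by rewrite addr0.
Qed.

Lemma loc_integrable_sub {f a} b : -1 <= a -> loc_integrable f ->
  mu.-integrable `[a, b] (EFin \o f).
Proof.
move=> a1 fi; apply: (integrableS _ _ _ (fi b)) => //.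
by apply: subset_itvr; rewrite bnd_simp.
Qed.

Lemma loc_integrable_subo {f a} b : -1 <= a -> loc_integrable f ->
  mu.-integrable `[a, b[ (EFin \o f).
Proof.
move=> a1 fi; apply: (integrableS _ _ _ (loc_integrable_sub b a1 fi)) => //.
by apply: subset_itvl; rewrite bnd_simp.
Qed.

Lemma integral_itv_prim {f x y} : loc_integrable f -> -1 <= x -> x <= y ->
  \int[mu]_(z in `[x, y[) f z = prim f y - prim f x.
Proof.
move=> fi x1 xy.
have ixy := loc_integrable_sub y x1 fi.
rewrite /prim opprB subrKA.
rewrite (@Rintegral_itvB _ f (BLeft (-1)) (BRight y) x (fi y)) ?bnd_simp//.
rewrite Rintegral_itv_obnd_cbnd; last first.
  by apply: (integrableS _ _ _ ixy) => //; apply: subset_itvr; rewrite bnd_simp.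
rewrite Rintegral_itv_bndo_bndc//.
exact: loc_integrable_subo.
Qed.

Lemma prim_continuous {f x} : loc_integrable f -> -1 < x -> {for x, continuous (prim f)}.
Proof.
move=> fi x1.
have xu : -1 <= x + 1 by lra.
have := parameterized_integral_continuous xu (fi (x + 1)).
move=> /continuous_within_itvP => /(_ ltac:(lra)) [+ _ _].
move=> /(_ x); rewrite in_itv /= x1 ltrDl ltr01 => /(_ isT) h.
by apply: cvgD; [exact: h|exact: cvg_cst].
Qed.

End Primitive.

(** * The ratio [G = H / W] near 0 *)

Section Profile.
Context {R : realType} (W : R -> R).
Implicit Types u v x y z ga eps : R.
Hypothesis W_cont : continuous W.
Hypothesis W_mono : forall u v, u <= v -> W u <= W v.
Hypothesis W_le0 : forall v, v <= 0 -> W v = 0.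
Hypothesis W_gt0 : forall v, 0 < v -> 0 < W v.

Local Notation H := (prim W).

Definition hratio (v : R) : R := H v / W v.
Local Notation G := hratio.

Lemma W_ge0 v : 0 <= W v.
Proof. by have [/W_le0->//|/W_gt0/ltW] := leP v 0. Qed.

Lemma H_is_derive v : -1 < v -> is_derive v 1 H (W v).
Proof.
by move=> v1; apply: prim_is_derive => //; [exact: continuous_loc_integrable|exact: W_cont].
Qed.

Lemma H_ge0 v : 0 <= v -> 0 <= H v.
Proof.
move=> v0; rewrite -(prim0 W); apply: (@is_derive_ge0 _ H W) => // x xv.
  by apply: H_is_derive; move/andP: xv; lra.
exact: W_ge0.
Qed.

Lemma H_gt0 v : 0 < v -> 0 < H v.
Proof.
move=> v0.
have h : H (v / 2) - W (v / 2) * (v / 2) <= H v - W (v / 2) * v.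
  apply: (@is_derive_ge0 _ (fun x => H x - W (v / 2) * x) (fun x => W x - W (v / 2))) => [x xv|x xv|]; last lra.
    have dH : is_derive x 1 H (W x) by apply: H_is_derive; move/andP: xv; lra.
    by derive; ring.
  by rewrite subr_ge0 W_mono//; move/andP: xv; lra.
have := H_ge0 (v / 2) ltac:(lra); have := W_gt0 (v / 2) ltac:(lra).
nra.
Qed.

Lemma H_le v : 0 <= v -> H v <= v * W v.
Proof.
move=> v0.
have : H v - W v * v <= H 0 - W v * 0.
  apply: (@is_derive_le0 _ (fun x => H x - W v * x) (fun x => W x - W v)) => [x xv|x xv|//].
    have dH : is_derive x 1 H (W x) by apply: H_is_derive; move/andP: xv; lra.
    by derive; ring.
  by rewrite subr_le0 W_mono//; move/andP: xv; lra.
by rewrite prim0; lra.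
Qed.

Lemma G_gt0 v : 0 < v -> 0 < G v.
Proof. by move=> v0; rewrite divr_gt0// ?H_gt0 ?W_gt0. Qed.

Lemma G_le v : 0 < v -> G v <= v.
Proof. by move=> v0; rewrite ler_pdivrMr ?W_gt0// H_le// ltW. Qed.

Lemma GW v : 0 < v -> G v * W v = H v.
Proof. by move=> v0; rewrite /hratio mulfVK// gt_eqF// W_gt0. Qed.

Lemma G_cont v : 0 < v -> {for v, continuous G}.
Proof.
move=> v0; apply: cvgM; first exact/is_derive_continuous/H_is_derive/(lt_trans _ v0).
by apply: cvgV; [rewrite gt_eqF// W_gt0|exact: W_cont].
Qed.

(** Integrated form of [|G' - ga| <= eps] on []0, v0]]. Formally [G' = 1 - H W' / W^2], which is 1
    minus the initial beta function. *)
Definition G_slope (ga eps v0 : R) := forall u v, 0 < u -> u <= v -> v <= v0 ->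
  `|G v - G u - ga * (v - u)| <= eps * (v - u).

(** Let [u] tend to 0 in the slope bound: [0 < G u <= u] makes the boundary term vanish. *)
Lemma G_slope_lim {ga eps v0 : R} v : G_slope ga eps v0 -> 0 < v -> v <= v0 ->
  `|G v - ga * v| <= eps * v.
Proof.
move=> sl v_gt0 vv0.
apply: (@ler_small _ v _ _ (- eps + 1 + `|ga|)) => // u /andP[u0 uv].
have h := sl u v u0 (ltW uv) vv0.
have -> : G v - ga * v = (G v - G u - ga * (v - u)) + (G u - ga * u) by ring.
apply: le_trans (ler_normD _ _) _.
have : `|G u - ga * u| <= u + `|ga| * u.
  apply: le_trans (ler_normB _ _) _.
  by rewrite (gtr0_norm (G_gt0 u u0)) (normrM ga) (gtr0_norm u0) lerD2r G_le.
lra.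
Qed.

(** A negative slope at 0 would force [G] to be negative. This is the source of [beta0 <= 1]. *)
Lemma G_slope_ge0 ga :
  (forall eps, 0 < eps -> exists2 v1, 0 < v1 & G_slope ga eps v1) -> 0 <= ga.
Proof.
move=> h; rewrite leNgt; apply/negP => ga0.
have [v1 v10 sl] := h (- ga / 2) ltac:(lra).
have := G_slope_lim v1 sl v10 (lexx _).
have := G_gt0 v1 v10.
by rewrite ler_norml => ? /andP[]; nra.
Qed.

End Profile.

(** * The profile at a fixed time and its moments *)

Section Slice.
Context {R : realType} (W : R -> R).
Implicit Types u v x y z ga eps : R.
Hypothesis W_cont : continuous W.
Hypothesis W_mono : forall u v, u <= v -> W u <= W v.
Hypothesis W_le0 : forall v, v <= 0 -> W v = 0.
Hypothesis W_gt0 : forall v, 0 < v -> 0 < W v.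

Local Notation H := (prim W).
Local Notation G := (hratio W).

Context (c E B : R).
Hypothesis c_gt0 : 0 < c.
Hypothesis E_gt0 : 0 < E.
Hypothesis B_ge0 : 0 <= B.

Definition moebius (z : R) : R := z / (E + B * z).
Local Notation vm := moebius.

(** For [c = e^t] this is [w (1 - z, t)]. The truncation at 0 gives continuity on the whole line,
    since [E + B * z] may vanish at negative [z]. *)
Definition slice (z : R) : R := c * W (vm (Num.max z 0)).
Definition mass (z : R) : R := prim slice z.
Definition mass2 (z : R) : R := prim (fun y => mass (Num.max y 0)) z.

Lemma den_gt0 z : 0 <= z -> 0 < E + B * z.
Proof. by move=> z0; rewrite ltr_wpDr// mulr_ge0. Qed.

Lemma moebius_is_derive z : 0 <= z -> is_derive z 1 vm (E / (E + B * z) ^+ 2).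
Proof.
move=> z0; have d0 := den_gt0 z z0; rewrite /moebius.
derive; first by rewrite gt_eqF.
by field; rewrite gt_eqF.
Qed.

Lemma moebius_gt0 z : 0 < z -> 0 < vm z.
Proof. by move=> z0; rewrite divr_gt0// den_gt0// ltW. Qed.

Lemma moebius_mono y z : 0 <= y -> y <= z -> vm y <= vm z.
Proof.
move=> y0 yz; have z0 := le_trans y0 yz.
have dy := den_gt0 y y0; have dz := den_gt0 z z0.
rewrite /moebius ler_pdivrMr// mulrAC ler_pdivlMr//.
have : E * y <= E * z by rewrite ler_pM2l.
lra.
Qed.

Lemma continuous_max0 (f : R -> R) : (forall x, 0 <= x -> {for x, continuous f}) ->
  continuous (fun z => f (Num.max z 0)).
Proof.
move=> cf z; apply: (@continuous_comp _ _ _ (fun z => Num.max z 0) f).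
  by apply: continuous_max; [exact: cvg_id|exact: cvg_cst].
by apply: cf; rewrite le_max lexx orbT.
Qed.

Lemma slice_cont : continuous slice.
Proof.
apply: (continuous_max0 (fun z => c * W (vm z))) => z z0.
apply: cvgM; first exact: cvg_cst.
apply: (continuous_comp (is_derive_continuous (moebius_is_derive z z0))).
exact: W_cont.
Qed.

Lemma slice_ge0 z : 0 <= slice z.
Proof. exact: mulr_ge0 (ltW c_gt0) (W_ge0 W W_le0 W_gt0 _). Qed.

Lemma sliceE z : 0 <= z -> slice z = c * W (vm z).
Proof. by move=> z0; rewrite /slice max_l. Qed.

Lemma slice_gt0 z : 0 < z -> 0 < slice z.
Proof. by move=> z0; rewrite (sliceE z (ltW z0)) mulr_gt0// W_gt0// moebius_gt0. Qed.

Lemma slice_mono y z : 0 <= y -> y <= z -> slice y <= slice z.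
Proof.
move=> y0 yz; rewrite !sliceE// ?(le_trans y0)// ler_pM2l// W_mono//.
exact: moebius_mono.
Qed.

Lemma mass_is_derive z : -1 < z -> is_derive z 1 mass (slice z).
Proof.
by move=> z1; apply: prim_is_derive => //; [exact/continuous_loc_integrable/slice_cont|exact: slice_cont].
Qed.

Lemma mass0 : mass 0 = 0. Proof. exact: prim0. Qed.

Lemma mass_mono y z : 0 <= y -> y <= z -> mass y <= mass z.
Proof.
move=> y0; apply: (@is_derive_ge0 _ _ slice) => x xyz; last exact: slice_ge0.
by apply: mass_is_derive; move/andP: xyz; lra.
Qed.

Lemma mass_ge0 z : 0 <= z -> 0 <= mass z.
Proof. by move=> z0; rewrite -mass0 mass_mono. Qed.

Lemma mass_le z : 0 <= z -> mass z <= z * slice z.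
Proof.
move=> z0.
have : mass z - slice z * z <= mass 0 - slice z * 0.
  apply: (@is_derive_le0 _ (fun x => mass x - slice z * x) (fun x => slice x - slice z)) => [x xv|x xv|//].
    have dH : is_derive x 1 mass (slice x) by apply: mass_is_derive; move/andP: xv; lra.
    by derive; ring.
  by rewrite subr_le0 slice_mono//; move/andP: xv; lra.
by rewrite mass0; lra.
Qed.

Lemma mass2_is_derive z : 0 <= z -> is_derive z 1 mass2 (mass z).
Proof.
have cm : continuous (fun y => mass (Num.max y 0)).
  apply: continuous_max0 => x x0; apply: is_derive_continuous (mass_is_derive x _); lra.
move=> z0; have -> : mass z = mass (Num.max z 0) by rewrite max_l.
apply: prim_is_derive; [exact: continuous_loc_integrable|lra|exact: cm].
Qed.

Lemma mass20 : mass2 0 = 0. Proof. exact: prim0. Qed.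

Hypothesis mass1 : mass 1 = 1.

(* Since int_0^1 z w = 1 - mass2 1, a2 is w (1) - 2 int_0^1 z w. *)
Definition a1 : R := slice 1 - 1.
Definition a2 : R := slice 1 - 2 + 2 * mass2 1.

(** The slice is nondecreasing, so [mass] lies above the line of slope [slice 1] through the point
    [(1, 1)]; integrating gives [1 - slice 1 / 2 <= mass2 1]. *)
Lemma a2_ge0 : 0 <= a2.
Proof.
have h z : 0 <= z -> z <= 1 -> 1 - slice 1 * (1 - z) <= mass z.
  move=> z0 z1.
  have : mass 1 - slice 1 * 1 <= mass z - slice 1 * z.
    apply: (@is_derive_le0 _ (fun x => mass x - slice 1 * x) (fun x => slice x - slice 1)) => [x xv|x xv|//].
      have dH : is_derive x 1 mass (slice x) by apply: mass_is_derive; move/andP: xv; lra.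
      by derive; ring.
    by rewrite subr_le0 slice_mono//; move/andP: xv; lra.
  by rewrite mass1; lra.
have : mass2 0 - (0 - slice 1 * (0 - 0 ^+ 2 / 2)) <= mass2 1 - (1 - slice 1 * (1 - 1 ^+ 2 / 2)).
  apply: (@is_derive_ge0 _ (fun x => mass2 x - (x - slice 1 * (x - x ^+ 2 / 2)))
    (fun x => mass x - (1 - slice 1 * (1 - x)))) => [x xv|x xv|//].
    have dH : is_derive x 1 mass2 (mass x) by apply: mass2_is_derive; move/andP: xv; lra.
    by derive; field.
  by rewrite subr_ge0 h//; move/andP: xv; lra.
rewrite mass20 /a2; lra.
Qed.

Lemma mass_chord z : 0 <= z -> z <= 1 -> mass z <= z.
Proof.
rewrite le_eqVlt => /predU1P[<-|z0] z1; first by rewrite mass0.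
have : mass z / z <= mass 1 / 1.
  apply: (@is_derive_ge0 _ (fun x => mass x / x)
    (fun x => (slice x * x - mass x) / x ^+ 2)) => [x xv|x xv|//].
    have dH : is_derive x 1 mass (slice x) by apply: mass_is_derive; move/andP: xv; lra.
    have x0 : x != 0 by rewrite gt_eqF//; move/andP: xv; lra.
    by derive => //; field.
  by rewrite divr_ge0 ?sqr_ge0// subr_ge0 mulrC mass_le//; move/andP: xv; lra.
by rewrite mass1 divr1 ler_pdivrMr// mul1r.
Qed.

(** Here [a1 - a2 = 1 - 2 * mass2 1], and integrating [mass z <= z] gives [mass2 1 <= 1 / 2]. *)
Lemma a12_ge0 : 0 <= a1 - a2.
Proof.
have : mass2 1 - 1 ^+ 2 / 2 <= mass2 0 - 0 ^+ 2 / 2.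
  apply: (@is_derive_le0 _ (fun x => mass2 x - x ^+ 2 / 2) (fun x => mass x - x)) => [x xv|x xv|//].
    have dH : is_derive x 1 mass2 (mass x) by apply: mass2_is_derive; move/andP: xv; lra.
    by derive; field.
  by rewrite subr_le0 mass_chord//; move/andP: xv; lra.
rewrite mass20 /a1 /a2; lra.
Qed.

Lemma a12_le1 : a1 - a2 <= 1.
Proof.
have : mass2 0 <= mass2 1.
  apply: (@is_derive_ge0 _ mass2 mass) => [x xv|x xv|//].
    by apply: mass2_is_derive; move/andP: xv; lra.
  by apply: mass_ge0; move/andP: xv; lra.
rewrite mass20 /a1 /a2; lra.
Qed.

End Slice.

(** * Estimates of the stretch, uniform in the Moebius coefficients *)

Section SliceEstimates.
Context {R : realType} (W : R -> R).
Implicit Types u v x y z : R.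
Hypothesis W_cont : continuous W.
Hypothesis W_mono : forall u v, u <= v -> W u <= W v.
Hypothesis W_le0 : forall v, v <= 0 -> W v = 0.
Hypothesis W_gt0 : forall v, 0 < v -> 0 < W v.

Local Notation H := (prim W).
Local Notation G := (hratio W).

Context (c E B : R).
Hypothesis c_gt0 : 0 < c.
Hypothesis E_gt0 : 0 < E.
Hypothesis B_ge0 : 0 <= B.
Local Notation vm := (moebius E B).
Local Notation w := (slice W c E B).
Local Notation Q := (mass W c E B).
Local Notation Q2 := (mass2 W c E B).

(* stretch z is beta w / w_z, with beta the initial beta function at moebius z. *)
Definition stretch z : R := G (vm z) * (E + B * z) ^+ 2 / E.
Local Notation S := stretch.

Lemma stretch_gt0 z : 0 < z -> 0 < S z.
Proof.
move=> z0; rewrite divr_gt0// mulr_gt0//.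
  exact/(G_gt0 W W_cont W_mono W_le0 W_gt0)/moebius_gt0.
by rewrite exprn_gt0// den_gt0// ltW.
Qed.

Context (ga eps v0 : R).
Hypothesis eps_ge0 : 0 <= eps.
Hypothesis slope : G_slope W ga eps v0.
Hypothesis le_v0 : vm 1 <= v0.

Lemma ler_norm_mul1 (q A e : R) : `|q| <= e -> `|A| <= 1 -> `|q * A| <= e.
Proof. by move=> qe A1; rewrite normrM; apply: le_trans qe; rewrite ler_piMr. Qed.

Lemma den_ratio_le1 z : 0 < z -> z <= 1 -> `|(E + B * z) / (E + B)| <= 1.
Proof.
move=> z0 z1.
have d1 : 0 < E + B by rewrite ltr_wpDr.
have dz : 0 < E + B * z by rewrite ltr_wpDr// mulr_ge0// ltW.
rewrite gtr0_norm ?divr_gt0// ler_pdivrMr// mul1r lerD2l ler_piMr//.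
Qed.

(** Errors are measured on their natural scales: [q] is the error of [G] at [vm 1] relative to
    [vm 1], and [r] is the error of the increment from [vm z] to [vm 1] divided by
    [(vm 1 - vm z) / (1 - z)]. The coefficients that multiply [q] and [r] later are then at most 1,
    whatever [E] and [B] are. *)
Lemma hratio_expansion z : 0 < z -> z <= 1 -> exists q r,
  [/\ `|q| <= eps, `|r| <= eps * (1 - z),
      G (vm 1) = (ga + q) / (E + B) &
      G (vm z) = ga * vm z + q / (E + B) - r * (E / ((E + B) * (E + B * z)))].
Proof.
move=> z0 z1.
have d1 : 0 < E + B by rewrite ltr_wpDr.
have dz : 0 < E + B * z by rewrite ltr_wpDr// mulr_ge0// ltW.
have dv : vm 1 - vm z = (1 - z) * (E / ((E + B) * (E + B * z))).
  by rewrite /moebius mulr1; field; rewrite !gt_eqF.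
have k0 : 0 < E / ((E + B) * (E + B * z)) by rewrite divr_gt0// mulr_gt0.
have vz0 : 0 < vm z by exact: moebius_gt0.
have v10 : 0 < vm 1 by exact: moebius_gt0.
have vz1 : vm z <= vm 1 by apply: moebius_mono => //; exact: ltW.
have := slope _ _ vz0 vz1 le_v0; rewrite dv; set k := E / _ in k0 *.
have := G_slope_lim W W_cont W_mono W_le0 W_gt0 _ slope v10 le_v0.
set x := G (vm 1); set y := G (vm z) => h1 h2.
have v1E : vm 1 = (E + B)^-1 by rewrite /moebius mulr1 mul1r.
exists (x * (E + B) - ga), ((x - y - ga * ((1 - z) * k)) / k); split.
- have -> : x * (E + B) - ga = (x - ga * vm 1) * (E + B).
    by rewrite v1E mulrBl mulfVK// gt_eqF.
  rewrite normrM (gtr0_norm d1) -ler_pdivlMr//; by rewrite v1E in h1 *.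
- by rewrite normrM normfV (gtr0_norm k0) ler_pdivrMr// -mulrA.
- by rewrite addrC subrK mulfK// gt_eqF.
- have -> : ga * vm z = ga * vm 1 - ga * ((1 - z) * k) by rewrite -dv; ring.
  by rewrite v1E mulfVK ?gt_eqF//; field; rewrite gt_eqF.
Qed.

(** For a linear [G] of slope [ga] both terms equal [ga z + ga (B / E) z^2]; what remains is linear
    in [q] and [r]. *)
Lemma stretch_approx z : 0 < z -> z <= 1 ->
  `|S z - (S 1 * z ^+ 2 + ga * z * (1 - z))| <= 2 * eps.
Proof.
move=> z0 z1; have [q [r [hq hr G1 Gz]]] := hratio_expansion z z0 z1.
have d1 : 0 < E + B by rewrite ltr_wpDr.
have dz : 0 < E + B * z by rewrite ltr_wpDr// mulr_ge0// ltW.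
rewrite /stretch Gz G1 mulr1.
set X := (X in `|X|).
have -> : X = q * ((1 - z) * (E + 2 * B * z + E * z) / (E + B)) - r * ((E + B * z) / (E + B)).
  by rewrite /X /moebius; field; rewrite !gt_eqF.
have h1 : `|q * ((1 - z) * (E + 2 * B * z + E * z) / (E + B))| <= eps.
  apply: ler_norm_mul1 => //; rewrite ger0_norm; last first.
    rewrite divr_ge0 ?(ltW d1)// mulr_ge0 ?subr_ge0//.
    have p1 := mulr_ge0 B_ge0 (ltW z0); have p2 := mulr_gt0 E_gt0 z0; lra.
  rewrite ler_pdivrMr// mul1r.
  (* [E + B] exceeds the numerator by [E z^2 + B (z^2 + (1 - z)^2)]. *)
  have p1 := mulr_ge0 (ltW E_gt0) (sqr_ge0 z).
  have p2 := mulr_ge0 B_ge0 (sqr_ge0 z).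
  have p3 := mulr_ge0 B_ge0 (sqr_ge0 (1 - z)).
  lra.
have h2 : `|r * ((E + B * z) / (E + B))| <= eps.
  apply: ler_norm_mul1; last exact: den_ratio_le1.
  by apply: le_trans hr _; rewrite ler_piMr//; lra.
by apply: le_trans (ler_normB _ _) _; lra.
Qed.

(** An error proportional to [z] is what uniformity up to [x = 1] requires. The price is a factor
    [(E + B) / E], equal to [S 1 / (ga + q)] and so at most [S 1 / (ga - eps)]. *)
Lemma stretch_approx_rel z : eps < ga -> 0 < z -> z <= 1 ->
  `|S z - (S 1 * z ^+ 2 + ga * z * (1 - z))| <= 2 * eps * S 1 / (ga - eps) * z.
Proof.
move=> ega z0 z1; have [q [r [hq hr G1 _]]] := hratio_expansion z z0 z1.
have d1 : 0 < E + B by rewrite ltr_wpDr.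
have dz : 0 < E + B * z by rewrite ltr_wpDr// mulr_ge0// ltW.
have vz0 : 0 < vm z by exact: moebius_gt0.
have vz1 : vm z <= v0 by apply: le_trans le_v0; apply: moebius_mono => //; exact: ltW.
have := G_slope_lim W W_cont W_mono W_le0 W_gt0 _ slope vz0 vz1.
set p := G (vm z) - ga * vm z => hp.
have Gz : G (vm z) = (ga + p / vm z) * vm z.
  by rewrite mulrDl mulfVK ?gt_eqF// /p addrC subrK.
have {hp} : `|p / vm z| <= eps by rewrite normrM normfV (gtr0_norm vz0) ler_pdivrMr.
move: Gz; set p' := p / vm z => Gz hp.
rewrite /stretch Gz G1 mulr1.
set X := (X in `|X|).
have -> : X = (p' * ((E + B * z) / (E + B)) - q * z) * ((E + B) / E * z).
  by rewrite /X /moebius; field; rewrite !gt_eqF.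
have kz : 0 <= (E + B) / E * z by rewrite mulr_ge0 ?ltW// divr_gt0.
have h1 : `|p' * ((E + B * z) / (E + B)) - q * z| <= 2 * eps.
  have h1 : `|p' * ((E + B * z) / (E + B))| <= eps.
    by apply: ler_norm_mul1 => //; exact: den_ratio_le1.
  have h2 : `|q * z| <= eps by apply: ler_norm_mul1 => //; rewrite gtr0_norm.
  by apply: le_trans (ler_normB _ _) _; lra.
rewrite normrM (ger0_norm kz); apply: le_trans (ler_wpM2r kz h1) _.
rewrite [leLHS]mulrA ler_wpM2r ?(ltW z0)//.
have -> : 2 * eps * ((ga + q) / (E + B) * (E + B) ^+ 2 / E) / (ga - eps)
    = 2 * eps * ((E + B) / E) * ((ga + q) / (ga - eps)).
  by field; rewrite !gt_eqF// subr_gt0.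
apply: ler_peMr; first by apply: mulr_ge0; [apply: mulr_ge0|apply: divr_ge0; apply: ltW].
rewrite ler_pdivlMr ?subr_gt0// mul1r.
by move: hq; rewrite ler_norml; lra.
Qed.

Hypothesis mass1 : Q 1 = 1.

(** The function [U = w S] equals [c H (E + B z)^2 / E], so it is differentiable although [w] need
    not be, and [U' = w (1 + 2 k)] with [k] close to [(S 1 - ga) z]. Integration over [[0, 1]], with
    [int z w = 1 - Q2 1], gives the claim. *)
Lemma stretch_balance :
  `|S 1 * a2 W c E B + ga * (a1 W c E B - a2 W c E B) - (1 - ga)| <= 4 * eps.
Proof.
pose U z := c * H (vm z) * (E + B * z) ^+ 2 / E.
pose k z := G (vm z) * B * (E + B * z) / E.
have v_gt z : 0 <= z -> -1 < vm z.
  by move=> z0; apply: (@lt_le_trans _ _ 0) => //; rewrite divr_ge0// ltW// den_gt0.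
have dU z : 0 <= z -> is_derive z 1 U (c * W (vm z) + 2 * (c * H (vm z) * B * (E + B * z) / E)).
  move=> z0; have dz := den_gt0 E B E_gt0 B_ge0 z z0.
  have dv := moebius_is_derive E B E_gt0 B_ge0 z z0.
  have dH := is_derive_lam_comp (H_is_derive W W_cont (vm z) (v_gt z z0)) dv.
  rewrite /U; derive; by field; rewrite !gt_eqF.
have kE z : 0 < z -> c * H (vm z) * B * (E + B * z) / E = w z * k z.
  move=> z0; rewrite sliceE ?ltW// /k -(GW W W_gt0 _ (moebius_gt0 E B E_gt0 B_ge0 z z0)).
  by ring.
have hk z : 0 < z -> z <= 1 -> `|k z - (S 1 - ga) * z| <= 2 * eps.
  move=> z0 z1; have [q [r [hq hr G1 Gz]]] := hratio_expansion z z0 z1.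
  have d1 : 0 < E + B by rewrite ltr_wpDr.
  have dz : 0 < E + B * z by rewrite ltr_wpDr// mulr_ge0// ltW.
  rewrite /k /stretch Gz G1 mulr1.
  set X := (X in `|X|).
  have -> : X = q * ((B - E * z - 2 * B * z) / (E + B)) - r * (B / (E + B)).
    by rewrite /X /moebius; field; rewrite !gt_eqF.
  have h1 : `|q * ((B - E * z - 2 * B * z) / (E + B))| <= eps.
    apply: ler_norm_mul1 => //.
    rewrite normrM normfV (gtr0_norm d1) ler_pdivrMr// mul1r ler_norml.
    have p1 := mulr_gt0 E_gt0 z0; have p2 := mulr_ge0 B_ge0 (ltW z0).
    have p3 : E * z <= E by rewrite ler_piMr// ltW.
    have p4 : B * z <= B by rewrite ler_piMr.
    by apply/andP; split; lra.
  have h2 : `|r * (B / (E + B))| <= eps.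
    apply: ler_norm_mul1; first by apply: le_trans hr _; rewrite ler_piMr//; lra.
    rewrite ger0_norm; last exact/divr_ge0/ltW.
    by rewrite ler_pdivrMr// mul1r lerDr ltW.
  by apply: le_trans (ler_normB _ _) _; lra.
(* [T 0] integrates [2 w (k - (S 1 - ga) z)], at most [4 * eps * w] in absolute value. Adding
   [s * Q] with [s = 4 * eps] or [s = - (4 * eps)] makes [T s] monotone, and [Q 1 = 1] turns this
   into the bound. *)
pose T s z := U z - Q z - 2 * (S 1 - ga) * (z * Q z - Q2 z) + s * Q z.
have dT s z : 0 <= z -> is_derive z 1 (T s)
    (c * W (vm z) + 2 * (c * H (vm z) * B * (E + B * z) / E) - w z - 2 * (S 1 - ga) * (z * w z) + s * w z).
  move=> z0.
  have d1 := dU z z0.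
  have d2 : is_derive z 1 Q (w z) by apply: mass_is_derive => //; lra.
  have d3 : is_derive z 1 Q2 (Q z) by exact: mass2_is_derive.
  by rewrite /T; derive; ring.
have w_ge z : 0 <= w z by exact: slice_ge0.
have T0 s : T s 0 = 0.
  rewrite /T /U /moebius mass0 /mass2 prim0 mul0r prim0; ring.
have T1 s : T s 1 = w 1 * S 1 - 1 - 2 * (S 1 - ga) * (1 - Q2 1) + s.
  rewrite /T /U mass1 sliceE// /stretch -(GW W W_gt0 _ (moebius_gt0 E B E_gt0 B_ge0 1 ltr01)).
  by ring.
have up : T (- (4 * eps)) 1 <= T (- (4 * eps)) 0.
  apply: (is_derive_le0 (fun z zz => dT (- (4 * eps)) z (andP zz).1) _ ler01) => z /andP[z0 z1].
  cbv beta; rewrite (kE z z0) -(sliceE W c E B z (ltW z0)).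
  have := hk z z0 (ltW z1); rewrite ler_norml => /andP[_ h].
  have h' : 0 <= 2 * eps - (k z - (S 1 - ga) * z) by lra.
  have := mulr_ge0 (w_ge z) h'; lra.
have lo : T (4 * eps) 0 <= T (4 * eps) 1.
  apply: (is_derive_ge0 (fun z zz => dT (4 * eps) z (andP zz).1) _ ler01) => z /andP[z0 z1].
  cbv beta; rewrite (kE z z0) -(sliceE W c E B z (ltW z0)).
  have := hk z z0 (ltW z1); rewrite ler_norml => /andP[h _].
  have h' : 0 <= 2 * eps + (k z - (S 1 - ga) * z) by lra.
  have := mulr_ge0 (w_ge z) h'; lra.
move: up lo; rewrite !T0 !T1 /a1 /a2 ler_norml; lra.
Qed.

End SliceEstimates.

(** * The differential inequalities for the ratio of mass to slice *)

Section SliceRatio.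
Context {R : realType} (W : R -> R).
Implicit Types u v x y z e : R.
Hypothesis W_cont : continuous W.
Hypothesis W_mono : forall u v, u <= v -> W u <= W v.
Hypothesis W_le0 : forall v, v <= 0 -> W v = 0.
Hypothesis W_gt0 : forall v, 0 < v -> 0 < W v.

Local Notation H := (prim W).
Local Notation G := (hratio W).

Context (c E B : R).
Hypothesis c_gt0 : 0 < c.
Hypothesis E_gt0 : 0 < E.
Hypothesis B_ge0 : 0 <= B.
Local Notation vm := (moebius E B).
Local Notation w := (slice W c E B).
Local Notation Q := (mass W c E B).
Local Notation S := (stretch W E B).

Definition mass_ratio z : R := Q z / w z.

Lemma mass_ratio_ge0 z : 0 <= z -> 0 <= mass_ratio z.
Proof.
by move=> z0; apply: divr_ge0; [exact: mass_ge0|exact: slice_ge0].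
Qed.

Lemma mass_ratio_le z : 0 < z -> mass_ratio z <= z.
Proof.
move=> z0; rewrite ler_pdivrMr; last exact: slice_gt0.
by apply: mass_le => //; exact: ltW.
Qed.

Lemma mass_ratio_cont z : 0 < z -> {for z, continuous mass_ratio}.
Proof.
move=> z0; apply: cvgM.
  by apply: is_derive_continuous (mass_is_derive _ _ _ _ _ _ _ z _) => //; lra.
apply: cvgV; last exact: slice_cont.
by rewrite gt_eqF// slice_gt0.
Qed.

(** The ratio equals [Q G / (c H)] along [vm]. Only [G] may fail to be differentiable, so it is
    replaced by the affine function of slope [e] that agrees with it at [vm z]. *)
Let tangent e z y := Q y * (G (vm z) + e * (vm y - vm z)) / (c * H (vm y)).

Let tangent_is_derive e z : 0 < z ->
  is_derive z 1 (tangent e z) (1 - (1 - e) * mass_ratio z / S z).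
Proof.
move=> z0; have vz0 : 0 < vm z by exact: moebius_gt0.
have G0 : 0 < G (vm z) by exact: G_gt0.
have W0 : 0 < W (vm z) by exact: W_gt0.
have HGW := GW W W_gt0 _ vz0.
have dz := den_gt0 E B E_gt0 B_ge0 z (ltW z0).
have dv := moebius_is_derive E B E_gt0 B_ge0 z (ltW z0).
have dH := is_derive_lam_comp (H_is_derive W W_cont (vm z) ltac:(lra)) dv.
have dQ : is_derive z 1 Q (w z) by apply: mass_is_derive => //; lra.
have H0 : 0 < H (vm z) by exact: H_gt0.
rewrite /tangent; derive; first by rewrite gt_eqF// mulr_gt0.
rewrite /mass_ratio /stretch sliceE ?(ltW z0)// -HGW.
by field; rewrite !gt_eqF.
Qed.

Let tangentE e z : 0 < z -> tangent e z z = mass_ratio z.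
Proof.
move=> z0; have vz0 : 0 < vm z by exact: moebius_gt0.
have G0 : 0 < G (vm z) by exact: G_gt0.
have W0 : 0 < W (vm z) by exact: W_gt0.
rewrite /tangent /mass_ratio sliceE ?(ltW z0)// -(GW W W_gt0 _ vz0).
by field; rewrite !gt_eqF.
Qed.

Context (ga eps v0 : R).
Hypothesis slope : G_slope W ga eps v0.
Hypothesis le_v0 : vm 1 <= v0.

Let mass_ratio_tangent z y : 0 < z -> z <= y -> y <= 1 ->
  tangent (ga - eps) z y <= mass_ratio y <= tangent (ga + eps) z y.
Proof.
move=> z0 zy y1; have y0 := lt_le_trans z0 zy.
have vz0 : 0 < vm z by exact: moebius_gt0.
have vy0 : 0 < vm y by exact: moebius_gt0.
have H0 : 0 < H (vm y) by exact: H_gt0.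
have Gy : 0 < G (vm y) by exact: G_gt0.
have Wy : 0 < W (vm y) by exact: W_gt0.
have vzy : vm z <= vm y by apply: moebius_mono => //; exact: ltW.
have vy1 : vm y <= v0 by apply: le_trans le_v0; apply: moebius_mono => //; exact: ltW.
have := slope _ _ vz0 vzy vy1; rewrite ler_norml => /andP[s1 s2].
have -> : mass_ratio y = Q y * G (vm y) / (c * H (vm y)).
  rewrite /mass_ratio sliceE ?(ltW y0)// -(GW W W_gt0 _ vy0).
  by field; rewrite !gt_eqF.
have k0 : 0 <= (c * H (vm y))^-1 by rewrite invr_ge0 mulr_ge0// ltW.
have Q0 : 0 <= Q y by apply: mass_ge0 => //; exact: ltW.
by apply/andP; split; rewrite /tangent ler_wpM2r// ler_wpM2l//; lra.
Qed.

Lemma mass_ratio_upper_slope z : 0 < z -> z < 1 ->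
  upper_slope mass_ratio z (1 - (1 - (ga + eps)) * mass_ratio z / S z).
Proof.
move=> z0 z1; exists (tangent (ga + eps) z); split; first exact: tangentE.
  exact: tangent_is_derive.
exists (1 - z); first by rewrite subr_gt0.
move=> y /andP[zy y1]; apply: (andP (mass_ratio_tangent z y z0 (ltW zy) _)).2; lra.
Qed.

Lemma mass_ratio_lower_slope z : 0 < z -> z < 1 ->
  upper_slope (fun y => - mass_ratio y) z (- (1 - (1 - (ga - eps)) * mass_ratio z / S z)).
Proof.
move=> z0 z1; exists (fun y => - tangent (ga - eps) z y); split.
- by rewrite tangentE.
- exact/is_derive_lamN/tangent_is_derive.
exists (1 - z); first by rewrite subr_gt0.
move=> y /andP[zy y1]; rewrite lerN2.
apply: (andP (mass_ratio_tangent z y z0 (ltW zy) _)).1; lra.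
Qed.

End SliceRatio.

(** * Stability of the stationary ratio equation under perturbation *)

Section Comparison.
Context {R : realType}.
Implicit Types x y z : R.
Context (xi S xik : R -> R) (be eps lam mu : R).
Hypothesis be_gt0 : 0 < be.
Hypothesis eps_ge0 : 0 <= eps.
Local Notation V z := (lam * z + mu * z ^+ 2).
Hypothesis xi_ge0 : forall z, 0 < z -> z <= 1 -> 0 <= xi z.
Hypothesis xi_le : forall z, 0 < z -> z <= 1 -> xi z <= z.
Hypothesis xi_cont : forall z, 0 < z -> z <= 1 -> {for z, continuous xi}.
Hypothesis xi_upper : forall z, 0 < z -> z < 1 ->
  upper_slope xi z (1 - (be - eps) * xi z / S z).
Hypothesis xi_lower : forall z, 0 < z -> z < 1 ->
  upper_slope (fun y => - xi y) z (- (1 - (be + eps) * xi z / S z)).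
Hypothesis xik_ge0 : forall z, 0 < z -> z <= 1 -> 0 <= xik z.
Hypothesis xik_le : forall z, 0 < z -> z <= 1 -> xik z <= z.
Hypothesis xik_cont : forall z, 0 < z -> z <= 1 -> {for z, continuous xik}.
Hypothesis xik_is_derive : forall z, 0 < z -> z < 1 ->
  is_derive z 1 xik (1 - xik z / V z).

Context (z0 eta vmin : R).
Hypothesis z0_gt0 : 0 < z0.
Hypothesis eta_ge0 : 0 <= eta.
Hypothesis vmin_gt0 : 0 < vmin.
Hypothesis eta_le : eta <= be * vmin / 2.
Hypothesis V_ge : forall z, z0 <= z -> z <= 1 -> vmin * z <= V z.
Hypothesis SV : forall z, z0 <= z -> z <= 1 -> `|S z - be * V z| <= eta * z.

(** Size of the forcing relative to [z]: the first term comes from the error [eta] of [S], the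
    second from the error [eps] of the beta value; the factors 2 come from [S >= be * V / 2]. *)
Let theta := 2 * eta / (be * vmin) + 2 * eps / be.

Let theta_ge0 : 0 <= theta.
Proof.
by rewrite addr_ge0// divr_ge0 ?mulr_ge0// ltW.
Qed.

Let V_gt0 z : z0 <= z -> z <= 1 -> 0 < V z.
Proof.
move=> zz z1; apply: lt_le_trans (V_ge z zz z1).
by rewrite mulr_gt0// (lt_le_trans z0_gt0).
Qed.

Let S_ge z : z0 <= z -> z <= 1 -> be * V z / 2 <= S z.
Proof.
move=> zz z1; have := SV z zz z1; rewrite ler_norml => /andP[+ _].
have h := V_ge z zz z1.
have h1 : eta * z <= be * vmin / 2 * z by rewrite ler_pM2r// (lt_le_trans z0_gt0).
have h2 : be * (vmin * z) <= be * V z by rewrite ler_pM2l.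
lra.
Qed.

Let S_gt0 z : z0 <= z -> z <= 1 -> 0 < S z.
Proof.
move=> zz z1; apply: lt_le_trans (S_ge z zz z1).
by rewrite divr_gt0// mulr_gt0// V_gt0.
Qed.

Let error_le z : z0 <= z -> z <= 1 -> xi z * (eta * z + eps * V z) / S z <= theta * z.
Proof.
move=> zz z1; have z_gt0 := lt_le_trans z0_gt0 zz.
have S0 := S_gt0 z zz z1; have V0 := V_gt0 z zz z1.
rewrite ler_pdivrMr// mulrAC mulrC.
apply: ler_pM; [|exact: xi_ge0| |exact: xi_le].
  by rewrite addr_ge0// mulr_ge0// ltW.
apply: (@le_trans _ _ (theta * (be * V z / 2))); last by rewrite ler_wpM2l// S_ge.
have -> : theta * (be * V z / 2) = eta / vmin * V z + eps * V z.
  by rewrite /theta; field; rewrite !gt_eqF.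
rewrite lerD2r mulrAC ler_pdivlMr// -mulrA ler_wpM2l// mulrC.
exact: V_ge.
Qed.

(** At [z0] both functions lie in [[0, z0]]. Beyond [z0], once the difference exceeds [theta * z],
    the damping [(xi - xik) / V] outweighs the forcing, which is at most [theta * z / V]; the
    barrier argument applies to each sign of the difference. *)
Lemma comparison_diff z : z0 <= z -> z <= 1 -> `|xi z - xik z| <= z0 + theta * z.
Proof.
move=> zz z1.
have start : `|xi z0 - xik z0| <= z0.
  have z01 := le_trans zz z1.
  rewrite ler_norml; move: (xi_ge0 z0 z0_gt0 z01) (xi_le z0 z0_gt0 z01).
  by move: (xik_ge0 z0 z0_gt0 z01) (xik_le z0 z0_gt0 z01); lra.
have dth x : is_derive x 1 (fun y => - (theta * y)) (- theta) by derive; ring.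
have cth x : {for x, continuous (fun y => - (theta * y))}.
  exact: is_derive_continuous (dth x).
have tz0 : 0 <= theta * z0 by rewrite mulr_ge0// ltW.
move: start; rewrite !ler_norml => start; apply/andP; split.
  pose f y := - xi y + xik y + - (theta * y).
  suff : f z <= z0 by rewrite /f; lra.
  apply: (@upper_slope_barrier _ f z0 z) => // [x /andP[x0 xz]|x /andP[x0 xz] h|]; rewrite /f; last lra.
    have x_gt0 := lt_le_trans z0_gt0 x0; have x1 := le_trans xz z1.
    by apply: cvgD; [apply: cvgD; [apply: cvgN; exact: xi_cont|exact: xik_cont]|exact: cth].
  have x_gt0 := lt_trans z0_gt0 x0; have x1 := lt_le_trans xz z1.
  exists (- (1 - (be + eps) * xi x / S x) + (1 - xik x / V x) + - theta).
    by apply: upper_slopeD => //; apply: upper_slopeD; [exact: xi_lower|exact: xik_is_derive].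
  have S0 := S_gt0 x (ltW x0) (ltW x1); have V0 := V_gt0 x (ltW x0) (ltW x1).
  have e := error_le x (ltW x0) (ltW x1).
  have e2 : xi x * ((be + eps) * V x - S x) / S x <= theta * x.
    apply: le_trans e; rewrite ler_pM2r ?invr_gt0// ler_wpM2l ?xi_ge0 ?(ltW x1)//.
    by have := SV x (ltW x0) (ltW x1); rewrite ler_norml => /andP[+ _]; lra.
  have -> : - (1 - (be + eps) * xi x / S x) + (1 - xik x / V x) + - theta =
    (xi x * ((be + eps) * V x - S x) / S x + (xi x - xik x)) / V x - theta.
    by field; rewrite !gt_eqF.
  rewrite subr_le0; apply: le_trans theta_ge0.
  rewrite pmulr_lle0 ?invr_gt0//.
  by move: h; rewrite /f; lra.
pose f y := xi y + - xik y + - (theta * y).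
suff : f z <= z0 by rewrite /f; lra.
apply: (@upper_slope_barrier _ f z0 z) => // [x /andP[x0 xz]|x /andP[x0 xz] h|]; rewrite /f; last lra.
  have x_gt0 := lt_le_trans z0_gt0 x0; have x1 := le_trans xz z1.
  by apply: cvgD; [apply: cvgD; [exact: xi_cont|apply: cvgN; exact: xik_cont]|exact: cth].
have x_gt0 := lt_trans z0_gt0 x0; have x1 := lt_le_trans xz z1.
exists ((1 - (be - eps) * xi x / S x) + - (1 - xik x / V x) + - theta).
  by apply: upper_slopeD => //; apply: upper_slopeD; [exact: xi_upper|exact/is_derive_lamN/xik_is_derive].
have S0 := S_gt0 x (ltW x0) (ltW x1); have V0 := V_gt0 x (ltW x0) (ltW x1).
have e := error_le x (ltW x0) (ltW x1).
have e2 : xi x * (S x - (be - eps) * V x) / S x <= theta * x.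
  apply: le_trans e; rewrite ler_pM2r ?invr_gt0// ler_wpM2l ?xi_ge0 ?(ltW x1)//.
  by have := SV x (ltW x0) (ltW x1); rewrite ler_norml => /andP[_]; lra.
have -> : (1 - (be - eps) * xi x / S x) + - (1 - xik x / V x) + - theta =
  (xi x * (S x - (be - eps) * V x) / S x - (xi x - xik x)) / V x - theta.
  by field; rewrite !gt_eqF.
rewrite subr_le0; apply: le_trans theta_ge0.
rewrite pmulr_lle0 ?invr_gt0//.
by move: h; rewrite /f; lra.
Qed.

Lemma comparison_ratio b z : z0 <= z -> z <= 1 -> `|b - be| <= eps ->
  `|b * xi z / S z - xik z / V z| <= (2 * theta * z + z0) / V z.
Proof.
move=> zz z1 hb; have z_gt0 := lt_le_trans z0_gt0 zz.
have S0 := S_gt0 z zz z1; have V0 := V_gt0 z zz z1.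
have -> : b * xi z / S z - xik z / V z =
  (xi z * (b * V z - S z) / S z + (xi z - xik z)) / V z.
  by field; rewrite !gt_eqF.
rewrite normrM normfV (gtr0_norm V0) ler_pM2r ?invr_gt0//.
apply: le_trans (ler_normD _ _) _.
have h1 := comparison_diff z zz z1.
suff h2 : `|xi z * (b * V z - S z) / S z| <= theta * z by lra.
apply: le_trans (error_le z zz z1).
rewrite normrM normfV (gtr0_norm S0) ler_pM2r ?invr_gt0// normrM.
rewrite ger0_norm ?xi_ge0// ler_wpM2l ?xi_ge0//.
have -> : b * V z - S z = - (S z - be * V z) + (b - be) * V z by ring.
apply: le_trans (ler_normD _ _) _; rewrite normrN lerD ?SV//.
by rewrite normrM (gtr0_norm V0) ler_pM2r.
Qed.

End Comparison.

(** * Evolution in time of the Moebius coefficients *)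

Section TimeEvolution.
Context {R : realType} (W : R -> R).
Implicit Types s t u v x y z : R.
Hypothesis W_cont : continuous W.
Hypothesis W_mono : forall u v, u <= v -> W u <= W v.
Hypothesis W_le0 : forall v, v <= 0 -> W v = 0.
Hypothesis W_gt0 : forall v, 0 < v -> 0 < W v.

Local Notation H := (prim W).
Local Notation G := (hratio W).

Context (E B lam mu : R -> R).
Hypothesis E_gt0 : forall t, 0 < E t.
Hypothesis B_ge0 : forall t, 0 <= t -> 0 <= B t.
Hypothesis E_is_derive : forall t, 0 <= t -> is_derive t 1 E (lam t * E t).
Hypothesis B_is_derive : forall t, 0 <= t -> is_derive t 1 B (mu t * E t).
Hypothesis mu_gt0 : forall t, 0 <= t -> 0 < mu t.
Hypothesis Y_gt0 : forall t, 0 <= t -> 0 < lam t + mu t.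
Hypothesis mass1 : forall t, 0 <= t -> mass W (expR t) (E t) (B t) 1 = 1.

(** The argument of [W] at [x = 0], which is the largest one met at time [t]. *)
Definition delta t : R := moebius (E t) (B t) 1.
Definition width t : R := stretch W (E t) (B t) 1.
Local Notation A1 t := (a1 W (expR t) (E t) (B t)).
Local Notation A2 t := (a2 W (expR t) (E t) (B t)).

Lemma EB_gt0 t : 0 <= t -> 0 < E t + B t.
Proof. by move=> t0; rewrite ltr_wpDr ?B_ge0. Qed.

Lemma deltaE t : delta t = (E t + B t)^-1.
Proof. by rewrite /delta /moebius mulr1 mul1r. Qed.

Lemma delta_gt0 t : 0 <= t -> 0 < delta t.
Proof. by move=> t0; rewrite deltaE invr_gt0 EB_gt0. Qed.

Lemma B_mono s t : 0 <= s -> s <= t -> B s <= B t.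
Proof.
move=> s0; apply: is_derive_ge0 => [x /andP[sx _]|x /andP[sx _]].
  by apply: B_is_derive; exact: le_trans sx.
by apply: mulr_ge0; apply: ltW => //; apply: mu_gt0; rewrite (le_trans s0) ?ltW.
Qed.

Lemma EB_is_derive t : 0 <= t ->
  is_derive t 1 (fun t => E t + B t) ((lam t + mu t) * E t).
Proof.
move=> t0; have d1 := E_is_derive t t0; have d2 := B_is_derive t t0.
by derive; ring.
Qed.

Lemma EB_mono s t : 0 <= s -> s <= t -> E s + B s <= E t + B t.
Proof.
move=> s0; apply: (is_derive_ge0 (f := fun t => E t + B t)) => [x /andP[sx _]|x /andP[sx _]].
  by apply: EB_is_derive; exact: le_trans sx.
by apply: mulr_ge0; apply: ltW => //; apply: Y_gt0; rewrite (le_trans s0) ?ltW.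
Qed.

Lemma delta_mono s t : 0 <= s -> s <= t -> delta t <= delta s.
Proof.
move=> s0 st; rewrite !deltaE lef_pV2 ?posrE ?EB_gt0// ?(le_trans s0 st)//.
exact: EB_mono.
Qed.

Lemma is_derive_right_le0 (g : R -> R) (l d : R) t : is_derive t 1 g l -> g t = 0 -> 0 < d ->
  (forall s, t < s -> s < t + d -> g s <= 0) -> l <= 0.
Proof.
move=> dg gt d0 h; rewrite leNgt; apply/negP => l0.
have /is_derive_epsP /(_ (l / 2) ltac:(lra)) [d' d'0 hd] := dg.
pose m := Num.min d d'.
have m0 : 0 < m by rewrite lt_min d0 d'0.
have md : m <= d by rewrite ge_min lexx.
have md' : m <= d' by rewrite ge_min lexx orbT.
have := h (t + m / 2) ltac:(lra) ltac:(lra).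
have := hd (t + m / 2); rewrite addrAC subrr add0r gtr0_norm ?divr_gt0//.
rewrite gt subr0 => /(_ ltac:(lra)); rewrite ler_norml => /andP[]; nra.
Qed.

(** * The differentiated conservation law *)

Section Balance.
Context (t0 : R).
Hypothesis t0_ge0 : 0 <= t0.
Local Notation q := (slice W (expR t0) (E t0) (B t0)).
Local Notation Q := (mass W (expR t0) (E t0) (B t0)).
Local Notation Q2 := (mass2 W (expR t0) (E t0) (B t0)).
Let B0 : 0 <= B t0. Proof. exact: B_ge0. Qed.
Let expt0 : 0 < expR t0. Proof. exact: expR_gt0. Qed.
(** [moebius (e t) (b t)] is the flow between [t] and [t0]: the slice at time [t] is [e^(t - t0)]
    times the slice at time [t0] composed with it. *)
Let e t := E t / E t0.
Let b t := (B t - B t0) / E t0.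

Let Q_lip x y : 0 <= x -> x <= y -> y <= 2 -> `|Q y - Q x| <= q 2 * (y - x).
Proof.
move=> x0 xy y2; rewrite ger0_norm ?subr_ge0; last exact: mass_mono.
have : Q y - q 2 * y <= Q x - q 2 * x.
  apply: (is_derive_le0 (f := fun z => Q z - q 2 * z) (df := fun z => q z - q 2)) => // z /andP[xz zy].
    have dQ : is_derive z 1 Q (q z) by apply: mass_is_derive => //; lra.
    by derive; ring.
  by rewrite subr_le0; apply: slice_mono => //; lra.
lra.
Qed.

(** Used with [D = e + b z]. As [D >= 1 / 2], the point [z / D] stays in [[0, 2]], where [Q] has
    Lipschitz constant [q 2]. *)
Let Q_stretch (D nu : R) z : 0 <= z -> z <= 1 -> `|D - 1| <= nu -> nu <= 1 / 2 ->
  `|Q (z / D) * D - Q z| <= (Q 2 + 2 * q 2) * nu.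
Proof.
move=> z0 z1 hD hnu; have nu0 : 0 <= nu by apply: le_trans hD.
have /andP[D1 D2] : 1 - nu <= D <= 1 + nu by move: hD; rewrite ler_norml; lra.
have D0 : 0 < D by lra.
have zD0 : 0 <= z / D by rewrite divr_ge0// ltW.
have zD2 : z / D <= 2 by rewrite ler_pdivrMr//; lra.
have q0 : 0 <= q 2 by exact: slice_ge0.
have -> : Q (z / D) * D - Q z = Q (z / D) * (D - 1) + (Q (z / D) - Q z) by ring.
have h1 : `|Q (z / D) * (D - 1)| <= Q 2 * nu.
  rewrite normrM; apply: ler_pM => //; rewrite ger0_norm; last by apply: mass_ge0.
  by apply: mass_mono.
have diff : `|z / D - z| <= 2 * nu.
  have -> : z / D - z = z / D * (1 - D) by field; rewrite gt_eqF.
  by rewrite normrM; apply: ler_pM => //; [rewrite ger0_norm|rewrite distrC].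
have q2nu : 2 * q 2 * nu = q 2 * (2 * nu) by ring.
have h2 : `|Q (z / D) - Q z| <= 2 * q 2 * nu.
  have [zz|/ltW zz] := leP z (z / D).
    apply: le_trans (Q_lip _ _ z0 zz zD2) _.
    rewrite q2nu ler_wpM2l//; apply: le_trans diff; exact: ler_norm.
  rewrite distrC; apply: le_trans (Q_lip _ _ zD0 zz _) _; first lra.
  rewrite q2nu ler_wpM2l//; apply: le_trans diff.
  by rewrite distrC; exact: ler_norm.
by apply: le_trans (ler_normD _ _) _; lra.
Qed.

(* With s = 0 and Q2 replaced by the primitive of Q (z / (e + b z)) (e + b z), this
   is e^(t0 - t) (1 - mass at time t) after an integration by parts, hence 0; the
   parameter s absorbs the error of the replacement, which is o(1) as t -> t0. *)
Let g s t := expR (- (t - t0)) - Q ((e t + b t)^-1) * (e t + b t) ^+ 2 / e t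
   + 2 * (b t / e t) * (Q2 1 + s).

Let e_at : e t0 = 1. Proof. by rewrite /e divff// gt_eqF. Qed.
Let b_at : b t0 = 0. Proof. by rewrite /b subrr mul0r. Qed.

Let e_is_derive t : 0 <= t -> is_derive t 1 e (lam t * e t).
Proof. by move=> tt; have d := E_is_derive t tt; rewrite /e; derive; ring. Qed.

Let b_is_derive t : 0 <= t -> is_derive t 1 b (mu t * e t).
Proof.
move=> tt; have d := B_is_derive t tt; rewrite /b /e; derive.
by field; rewrite gt_eqF.
Qed.

Let g_at s : g s t0 = 0.
Proof.
rewrite /g e_at b_at addr0 invr1 subrr oppr0 expR0 mass1//; ring.
Qed.

Let g_is_derive s : is_derive t0 1 (g s)
  (lam t0 * A1 t0 + mu t0 * A2 t0 - 1 + 2 * mu t0 * s).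
Proof.
have de := e_is_derive t0 t0_ge0; have db := b_is_derive t0 t0_ge0.
have d1 : is_derive t0 1 (fun t => (e t + b t)^-1) (- (lam t0 + mu t0)).
  by derive; rewrite ?e_at ?b_at ?addr0 ?oner_eq0// expr1n ?divr1; ring.
have dQ : is_derive ((e t0 + b t0)^-1) 1 Q (q 1).
  by rewrite e_at b_at addr0 invr1; apply: mass_is_derive => //; lra.
have dQ' := is_derive_lam_comp (f := Q) (g := fun t => (e t + b t)^-1) dQ d1.
have dx0 : is_derive t0 1 (fun t => - (t - t0)) (-1) by derive; ring.
have dx := is_derive_lam_comp (g := fun t => - (t - t0)) (is_derive_expR (- (t0 - t0))) dx0.
rewrite /g; derive; rewrite ?e_at ?oner_eq0//.
rewrite b_at addr0 invr1 mass1// subrr oppr0 expR0 /a1 /a2 !expr1n ?divr1; ring.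
Qed.

(** For [t] close to [t0] the replacement error is below [eta], so the shift by [eta] fixes a sign.
    Times after [t0] suffice, and for them [b t >= 0]. *)
Let g_sign (eta : R) : 0 < eta -> exists2 d, 0 < d &
  forall t, t0 < t -> t < t0 + d -> g (- eta) t <= 0 <= g eta t.
Proof.
move=> eta0.
pose K := Q 2 + 2 * q 2 + 1.
have K0 : 0 < K.
  have : 0 <= Q 2 by exact: mass_ge0.
  have : 0 <= q 2 by exact: slice_ge0.
  by rewrite /K; lra.
pose nu := Num.min (1 / 2) (eta / K) / 2.
have m0 : 0 < Num.min (1 / 2) (eta / K) :> R by rewrite lt_min divr_gt0// divr_gt0.
have nu0 : 0 < nu by rewrite divr_gt0.
have nu2 : 2 * nu <= 1 / 2.
  have : Num.min (1 / 2) (eta / K) <= 1 / 2 by rewrite ge_min lexx.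
  by rewrite /nu; lra.
have nuK : K * (2 * nu) <= eta.
  have : Num.min (1 / 2) (eta / K) <= eta / K by rewrite ge_min lexx orbT.
  rewrite ler_pdivlMr// /nu; lra.
have /cvg_epsP /(_ nu nu0) [d1 d10 h1] := is_derive_continuous (e_is_derive t0 t0_ge0).
have /cvg_epsP /(_ nu nu0) [d2 d20 h2] := is_derive_continuous (b_is_derive t0 t0_ge0).
exists (Num.min d1 d2); first by rewrite lt_min d10.
move=> t tt0 td.
have {}h1 : `|e t - 1| < nu.
  rewrite -e_at; apply: h1; rewrite gtr0_norm ?subr_gt0//.
  have : Num.min d1 d2 <= d1 by rewrite ge_min lexx.
  lra.
have {}h2 : `|b t| < nu.
  rewrite -[b t]subr0 -b_at; apply: h2; rewrite gtr0_norm ?subr_gt0//.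
  have : Num.min d1 d2 <= d2 by rewrite ge_min lexx orbT.
  lra.
have t_ge0 : 0 <= t by apply: le_trans (ltW tt0).
have expt : 0 < expR t by exact: expR_gt0.
have et0 : 0 < e t by rewrite divr_gt0.
have bt0 : 0 <= b t.
  rewrite /b; apply: divr_ge0; last exact: ltW.
  by rewrite subr_ge0; apply: B_mono => //; exact: ltW.
have hD z : 0 <= z -> z <= 1 -> `|e t + b t * z - 1| <= 2 * nu.
  move=> z0 z1; have -> : e t + b t * z - 1 = (e t - 1) + b t * z by ring.
  apply: le_trans (ler_normD _ _) _.
  have : `|b t * z| <= `|b t| by rewrite normrM ler_piMr// ger0_norm.
  lra.
pose x := expR (t - t0).
have x0 : 0 < x by exact: expR_gt0.
pose U z := Q (moebius (e t) (b t) z) * (e t + b t * z) ^+ 2 / e t.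
have sE z : 0 <= z -> slice W (expR t) (E t) (B t) z = x * q (moebius (e t) (b t) z).
  move=> z0; have dz := den_gt0 (e t) (b t) et0 bt0 z z0.
  rewrite !sliceE//; last by rewrite /moebius divr_ge0// ltW.
  rewrite mulrA -expRD subrK; congr (_ * W _).
  have dE := den_gt0 (E t) (B t) (E_gt0 t) (B_ge0 t t_ge0) z z0.
  have E00 := E_gt0 t0.
  rewrite /moebius; set D := e t + b t * z in dz *.
  have ED : E t + B t * z = E t0 * D + B t0 * z by rewrite /D /e /b; field; rewrite gt_eqF.
  rewrite ED in dE *.
  by field; rewrite !gt_eqF.
(* [T s] vanishes at 0 and equals [x * g s t] at 1, because both masses are 1; its derivative in [z]
   is a nonnegative factor times [s] plus the replacement error. *)
pose T s z := mass W (expR t) (E t) (B t) z - x * (U z - 2 * (b t / e t) * (Q2 z + s * z)).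
have dT s z : 0 <= z -> is_derive z 1 (T s)
    (x * (2 * (b t / e t)) * (Q z - Q (moebius (e t) (b t) z) * (e t + b t * z) + s)).
  move=> z0; have dz := den_gt0 (e t) (b t) et0 bt0 z z0.
  have d_1 : is_derive z 1 (mass W (expR t) (E t) (B t)) (x * q (moebius (e t) (b t) z)).
    rewrite -sE//; apply: mass_is_derive => //; [exact: B_ge0|lra].
  have m_ge0 : 0 <= moebius (e t) (b t) z by rewrite divr_ge0// ltW.
  have dm := moebius_is_derive (e t) (b t) et0 bt0 z z0.
  have dQ : is_derive (moebius (e t) (b t) z) 1 Q (q (moebius (e t) (b t) z)).
    by apply: mass_is_derive => //; lra.
  have dQm := is_derive_lam_comp dQ dm.
  have dQ2 : is_derive z 1 Q2 (Q z) by apply: mass2_is_derive.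
  by rewrite /T /U; derive; field; rewrite !gt_eqF.
have T0 s : T s 0 = 0.
  by rewrite /T /U /moebius mass0 mul0r mass0 /mass2 prim0; ring.
have T1 s : T s 1 = x * g s t.
  rewrite /T /U /moebius mass1// /g mulr1 mul1r.
  have -> : expR (- (t - t0)) = x^-1 by rewrite expRN.
  by field; rewrite !gt_eqF.
have k0 : 0 <= x * (2 * (b t / e t)).
  by rewrite mulr_ge0 ?(ltW x0)// mulr_ge0// divr_ge0// ltW.
have hQ z : 0 < z -> z < 1 -> `|Q z - Q (moebius (e t) (b t) z) * (e t + b t * z)| <= eta.
  move=> z0 z1; rewrite distrC.
  apply: le_trans (Q_stretch _ _ _ (ltW z0) (ltW z1) (hD z (ltW z0) (ltW z1)) nu2) _.
  by move: nuK; rewrite /K; lra.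
apply/andP; split.
  have : T (- eta) 1 <= T (- eta) 0.
    apply: (is_derive_le0 (fun z zz => dT (- eta) z (andP zz).1) _ ler01) => z /andP[z0 z1].
    cbv beta; rewrite mulr_ge0_le0//.
    by have := hQ z z0 z1; rewrite ler_norml => /andP[_]; lra.
  by rewrite T0 T1 pmulr_rle0.
have : T eta 0 <= T eta 1.
  apply: (is_derive_ge0 (fun z zz => dT eta z (andP zz).1) _ ler01) => z /andP[z0 z1].
  cbv beta; rewrite mulr_ge0//.
  by have := hQ z z0 z1; rewrite ler_norml => /andP[+ _]; lra.
by rewrite T0 T1 pmulr_rge0.
Qed.

(** [g (- eta)] and [g eta] vanish at [t0] and have a sign just after it, hence so do their
    derivatives at [t0]; then [eta] tends to 0. *)
Lemma conservation_law : lam t0 * A1 t0 + mu t0 * A2 t0 = 1.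
Proof.
have mu0 := mu_gt0 t0 t0_ge0.
apply/eqP; rewrite -subr_eq0 eq_le; apply/andP; split.
  apply: (@ler_small R 1 _ _ (2 * mu t0)) => // eta /andP[eta0 _].
  have [d d0 h] := g_sign eta eta0.
  have := is_derive_right_le0 _ _ _ _ (g_is_derive (- eta)) (g_at _) d0
    (fun s h1 h2 => (andP (h s h1 h2)).1).
  lra.
apply: (@ler_small R 1 _ _ (2 * mu t0)) => // eta /andP[eta0 _].
have [d d0 h] := g_sign eta eta0.
have := is_derive_right_le0 (fun t => - g eta t) _ _ _ (is_derive_lamN (g_is_derive eta)) _ d0.
rewrite g_at oppr0 => /(_ erefl) h'.
have : - (lam t0 * A1 t0 + mu t0 * A2 t0 - 1 + 2 * mu t0 * eta) <= 0.
  by apply: h' => s h1 h2; rewrite oppr_le0 (andP (h s h1 h2)).2.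
lra.
Qed.

End Balance.

End TimeEvolution.

(** * Convergence of [X] and of [lam] *)

Section WidthDynamics.
Context {R : realType} (W : R -> R).
Implicit Types s t u v x y z : R.
Hypothesis W_cont : continuous W.
Hypothesis W_mono : forall u v, u <= v -> W u <= W v.
Hypothesis W_le0 : forall v, v <= 0 -> W v = 0.
Hypothesis W_gt0 : forall v, 0 < v -> 0 < W v.

Local Notation G := (hratio W).

Context (E B lam mu : R -> R).
Hypothesis E_gt0 : forall t, 0 < E t.
Hypothesis B_ge0 : forall t, 0 <= t -> 0 <= B t.
Hypothesis E_is_derive : forall t, 0 <= t -> is_derive t 1 E (lam t * E t).
Hypothesis B_is_derive : forall t, 0 <= t -> is_derive t 1 B (mu t * E t).
Hypothesis mu_gt0 : forall t, 0 <= t -> 0 < mu t.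
Hypothesis Y_gt0 : forall t, 0 <= t -> 0 < lam t + mu t.
Hypothesis mass1 : forall t, 0 <= t -> mass W (expR t) (E t) (B t) 1 = 1.

Local Notation delta := (delta E B).
Local Notation X := (width W E B).
Local Notation A1 t := (a1 W (expR t) (E t) (B t)).
Local Notation A2 t := (a2 W (expR t) (E t) (B t)).

(** If [delta t > v0], then [vm (1 / 2) >= delta t / 2] makes the slice at least [e^t W (v0 / 2)] on
    [[1 / 2, 1]]; for [t >= 2 / W (v0 / 2)] the mass there exceeds 1. *)
Lemma delta_small (v0 : R) : 0 < v0 -> exists2 T, 0 <= T & forall t, T <= t -> delta t <= v0.
Proof.
move=> v00; have W0 : 0 < W (v0 / 2) by apply: W_gt0; rewrite divr_gt0.
exists (2 / W (v0 / 2)) => [|t Tt]; first by rewrite divr_ge0// ltW.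
have t0 : 0 <= t by apply: le_trans Tt; rewrite divr_ge0// ltW.
rewrite leNgt; apply/negP => dv.
have Et := E_gt0 t; have Bt := B_ge0 t t0; have et := expR_gt0 t.
have wc : W (v0 / 2) * expR t <= slice W (expR t) (E t) (B t) (1 / 2).
  rewrite sliceE// mulrC ler_pM2l// W_mono//.
  apply: (@le_trans _ _ (delta t / 2)); first lra.
  rewrite deltaE /moebius mulrC mul1r ler_pM2l// lef_pV2 ?posrE ?EB_gt0//; last first.
    by rewrite ltr_wpDr// mulr_ge0.
  lra.
have h : mass W (expR t) (E t) (B t) (1 / 2) + slice W (expR t) (E t) (B t) (1 / 2) * (1 / 2) <= 1.
  have : mass W (expR t) (E t) (B t) (1 / 2) - slice W (expR t) (E t) (B t) (1 / 2) * (1 / 2)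
    <= mass W (expR t) (E t) (B t) 1 - slice W (expR t) (E t) (B t) (1 / 2) * 1.
    apply: (is_derive_ge0
      (f := fun z => mass W (expR t) (E t) (B t) z - slice W (expR t) (E t) (B t) (1 / 2) * z)
      (df := fun z => slice W (expR t) (E t) (B t) z - slice W (expR t) (E t) (B t) (1 / 2)))
      => [z /andP[z1 z2]|z /andP[z1 z2]|]; last lra.
      have dQ : is_derive z 1 (mass W (expR t) (E t) (B t)) (slice W (expR t) (E t) (B t) z).
        by apply: mass_is_derive => //; lra.
      by derive; ring.
    by rewrite subr_ge0; apply: slice_mono => //; lra.
  by rewrite mass1//; lra.
have m0 : 0 <= mass W (expR t) (E t) (B t) (1 / 2) by apply: mass_ge0.
have := expR_ge1Dx t.
move: Tt; rewrite ler_pdivrMr// => Tt h1.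
have : W (v0 / 2) * (1 + t) <= W (v0 / 2) * expR t by rewrite ler_pM2l.
lra.
Qed.

Lemma delta_is_derive t : 0 <= t ->
  is_derive t 1 delta (- ((lam t + mu t) * E t) / (E t + B t) ^+ 2).
Proof.
move=> t0; rewrite (_ : delta = fun t => (E t + B t)^-1); last by apply/funext => s; rewrite deltaE.
apply: is_derive_lamV; first by rewrite gt_eqF// EB_gt0.
exact: EB_is_derive.
Qed.

Lemma width_gt0 t : 0 <= t -> 0 < X t.
Proof. by move=> t0; apply: stretch_gt0 => //; exact: B_ge0. Qed.

(** [X] with [G] replaced by an affine function of slope [e] through its value at [delta t], so that
    the time derivative exists. *)
Let tangent e t s := (G (delta t) + e * (delta s - delta t)) * (E s + B s) ^+ 2 / E s.

Let widthE t : X t = G (delta t) * (E t + B t) ^+ 2 / E t.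
Proof. by rewrite /width /stretch mulr1. Qed.

Let tangent_is_derive e t : 0 <= t -> is_derive t 1 (tangent e t)
  (2 * (lam t + mu t) * (G (delta t) * (E t + B t)) - e * (lam t + mu t) - lam t * X t).
Proof.
move=> t0; have d1 := EB_is_derive _ _ _ _ E_is_derive B_is_derive t t0.
have d2 := delta_is_derive t t0; have d3 := E_is_derive t t0.
rewrite /tangent widthE; derive; first by rewrite gt_eqF.
by field; rewrite !gt_eqF//= EB_gt0.
Qed.

Lemma width_cont t : 0 <= t -> {for t, continuous X}.
Proof.
move=> t0.
rewrite (_ : X = fun t => G (delta t) * (E t + B t) ^+ 2 / E t); last by apply/funext => s; rewrite widthE.
have c1 := is_derive_continuous (EB_is_derive _ _ _ _ E_is_derive B_is_derive t t0).
have c2 := is_derive_continuous (E_is_derive t t0).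
have c3 := is_derive_continuous (delta_is_derive t t0).
apply: cvgM; last by apply: cvgV; [rewrite gt_eqF|exact: c2].
apply: cvgM; last by apply: cvgM; exact: c1.
apply: (continuous_comp c3); apply: G_cont => //.
by apply: delta_gt0.
Qed.

Section Slopes.
Context (ga eps v0 t : R).
Hypothesis t_ge0 : 0 <= t.
Hypothesis slope : G_slope W ga eps v0.
Hypothesis delta_le : delta t <= v0.

(** [delta] decreases in time, so the larger slope yields the lower bound. *)
Let tangent_bounds s : t < s -> tangent (ga + eps) t s <= X s <= tangent (ga - eps) t s.
Proof.
move=> ts; have s0 : 0 <= s by apply: le_trans (ltW ts).
have ds : delta s <= delta t by apply: delta_mono t_ge0 (ltW ts).
have d0 : 0 < delta s by apply: delta_gt0.
have := slope _ _ d0 ds delta_le; rewrite ler_norml => /andP[h1 h2].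
have k0 : 0 <= (E s + B s) ^+ 2 / E s by rewrite divr_ge0 ?sqr_ge0// ltW.
have le_k p r : p <= r -> p * (E s + B s) ^+ 2 / E s <= r * (E s + B s) ^+ 2 / E s.
  by move=> pr; rewrite -mulrA -[leRHS]mulrA ler_wpM2r.
by rewrite widthE /tangent; apply/andP; split; apply: le_k; lra.
Qed.

Let GEB : ga - eps <= G (delta t) * (E t + B t) <= ga + eps.
Proof.
have d0 : 0 < delta t by apply: delta_gt0.
have EB0 : 0 < E t + B t by apply: EB_gt0.
have := G_slope_lim W W_cont W_mono W_le0 W_gt0 _ slope d0 delta_le.
rewrite {2 3}deltaE ler_distl -mulrBl -mulrDl.
by rewrite ler_pdivrMr// ler_pdivlMr.
Qed.

(** Of the [3 * eps], two come from [2 * G (delta t) * (E t + B t)], whose last two factors have a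
    product within [eps] of [ga], and one from the slope of the tangent. *)
Lemma width_upper_slope : exists2 l, upper_slope X t l &
  l <= (ga + 3 * eps) * (lam t + mu t) - lam t * X t.
Proof.
exists (2 * (lam t + mu t) * (G (delta t) * (E t + B t)) - (ga - eps) * (lam t + mu t) - lam t * X t).
  exists (tangent (ga - eps) t); split; last by exists 1 => // s /andP[ts _]; case/andP: (tangent_bounds s ts).
    by rewrite /tangent subrr mulr0 addr0 widthE.
  exact: tangent_is_derive.
have Y0 := Y_gt0 t t_ge0; case/andP: GEB => _ h.
have := ler_wpM2l (ltW Y0) h; lra.
Qed.

Lemma width_lower_slope : exists2 l, upper_slope (fun s => - X s) t l &
  l <= lam t * X t - (ga - 3 * eps) * (lam t + mu t).
Proof.
exists (- (2 * (lam t + mu t) * (G (delta t) * (E t + B t)) - (ga + eps) * (lam t + mu t) - lam t * X t)).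
  exists (fun s => - tangent (ga + eps) t s); split; last first.
    by exists 1 => // s /andP[ts _]; rewrite lerN2; case/andP: (tangent_bounds s ts).
    exact/is_derive_lamN/tangent_is_derive.
  by rewrite /tangent subrr mulr0 addr0 widthE.
have Y0 := Y_gt0 t t_ge0; case/andP: GEB => h _.
have := ler_wpM2l (ltW Y0) h; lra.
Qed.

End Slopes.

Context (ga m0 mu1 : R).
Hypothesis m0_gt0 : 0 < m0.
Hypothesis mu1_ge0 : 0 <= mu1.
Hypothesis mu_affine : forall t, mu t = m0 + mu1 * lam t.
Hypothesis ga_ge0 : 0 <= ga.
Hypothesis ga_lt1 : ga < 1.
Hypothesis slope : forall eps : R, 0 < eps -> exists2 v0, 0 < v0 & G_slope W ga eps v0.

(** In [N X' = ga N (lam + mu) - lam N X], insert the expressions of [lam N] and [N (lam + mu)]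
    through [a1] and [a2], then replace [X a2 + ga (a1 - a2)] by [1 - ga]: the right side becomes
    [width_lim - X]. *)
Definition width_lim : R := ga * (1 + mu1) + m0 * (1 - ga).
Local Notation Xl := width_lim.

Lemma width_lim_gt0 : 0 < Xl.
Proof.
rewrite /width_lim; have h1 : 0 <= ga * (1 + mu1) by rewrite mulr_ge0 ?addr_ge0.
have h2 : 0 < m0 * (1 - ga) by rewrite mulr_gt0 ?subr_gt0.
lra.
Qed.

Let N t := A1 t + mu1 * A2 t.

Let a2_ge t : 0 <= t -> 0 <= A2 t.
Proof. by move=> t0; apply: a2_ge0 => //; [exact: expR_gt0|exact: B_ge0|exact: mass1]. Qed.

Let a12_ge t : 0 <= t -> 0 <= A1 t - A2 t.
Proof. by move=> t0; apply: a12_ge0 => //; [exact: expR_gt0|exact: B_ge0|exact: mass1]. Qed.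

Let a12_le t : 0 <= t -> A1 t - A2 t <= 1.
Proof. by move=> t0; apply: a12_le1 => //; first [exact: expR_gt0|exact: B_ge0]. Qed.

Let balance t : 0 <= t -> lam t * N t = 1 - m0 * A2 t.
Proof.
move=> t0; have := conservation_law W W_cont W_mono W_le0 W_gt0 E B lam mu
  E_gt0 B_ge0 E_is_derive B_is_derive mu_gt0 mass1 t t0.
by rewrite mu_affine /N; lra.
Qed.

Let NY t : 0 <= t -> N t * (lam t + mu t) = m0 * (A1 t - A2 t) + 1 + mu1.
Proof.
move=> t0.
have -> : N t * (lam t + mu t) = (1 + mu1) * (lam t * N t) + m0 * N t.
  by rewrite mu_affine; ring.
by rewrite balance// /N; ring.
Qed.

Let N_gt0 t : 0 <= t -> 0 < N t.
Proof.
move=> t0; have Y0 := Y_gt0 t t0; rewrite -(pmulr_lgt0 _ Y0) NY//.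
have h : 0 <= m0 * (A1 t - A2 t) by rewrite mulr_ge0 ?a12_ge// ltW.
have h' := mu1_ge0; lra.
Qed.

Ltac slra := move: ga_ge0 mu1_ge0 m0_gt0 ga_lt1; lra.

(* The error constant in N X' = Xl - X + O(C eps), for G of slope ga up to eps. *)
Let C := 7 * m0 + 3 + 3 * mu1.

Let C_gt0 : 0 < C. Proof. by rewrite /C; slra. Qed.

Section Regime.
Context (eps v0 t : R).
Hypothesis t_ge0 : 0 <= t.
Hypothesis eps_gt0 : 0 < eps.
Hypothesis slope0 : G_slope W ga eps v0.
Hypothesis delta_le : delta t <= v0.

Let bal : `|X t * A2 t + ga * (A1 t - A2 t) - (1 - ga)| <= 4 * eps.
Proof.
apply: (@stretch_balance R W W_cont W_mono W_le0 W_gt0 (expR t) (E t) (B t) _ _ _ ga eps v0) => //.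
- exact: expR_gt0.
- exact: B_ge0.
- exact: ltW.
- exact: mass1.
Qed.

Let upper : exists2 l, upper_slope X t l & N t * l <= - (X t - Xl) + C * eps.
Proof.
have [l hl ll] := width_upper_slope ga eps v0 t t_ge0 slope0 delta_le.
exists l => //; apply: le_trans (ler_wpM2l (ltW (N_gt0 t t_ge0)) ll) _.
have -> : N t * ((ga + 3 * eps) * (lam t + mu t) - lam t * X t) =
  (ga + 3 * eps) * (N t * (lam t + mu t)) - (lam t * N t) * X t by ring.
rewrite NY// balance//; move: bal; rewrite ler_norml /Xl /C => /andP[_ h].
have := ler_wpM2l (ltW m0_gt0) h.
have := ler_wpM2l (mulr_ge0 (ltW eps_gt0) (ltW m0_gt0)) (a12_le t t_ge0).
slra.
Qed.

Let lower : exists2 l, upper_slope (fun s => - X s) t l & N t * l <= X t - Xl + C * eps.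
Proof.
have [l hl ll] := width_lower_slope ga eps v0 t t_ge0 slope0 delta_le.
exists l => //; apply: le_trans (ler_wpM2l (ltW (N_gt0 t t_ge0)) ll) _.
have -> : N t * (lam t * X t - (ga - 3 * eps) * (lam t + mu t)) =
  - (ga - 3 * eps) * (N t * (lam t + mu t)) + (lam t * N t) * X t by ring.
rewrite NY// balance//; move: bal; rewrite ler_norml /Xl /C => /andP[h _].
have := ler_wpM2l (ltW m0_gt0) h.
have := ler_wpM2l (mulr_ge0 (ltW eps_gt0) (ltW m0_gt0)) (a12_le t t_ge0).
slra.
Qed.

(** An upper bound on [N] is a lower bound on the speed of relaxation. The balance gives
    [X a2 <= 1 - ga + 4 * eps <= 5], and [a1 <= a2 + 1]. *)
Let N_le x0 : eps <= 1 -> 0 < x0 -> x0 <= X t -> N t <= (1 + mu1) * (1 + 5 / x0).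
Proof.
move=> e1 x00 xX; have h2 := a2_ge t t_ge0; have h3 := a12_ge t t_ge0; have h4 := a12_le t t_ge0.
have : A2 t <= 5 / x0.
  rewrite ler_pdivlMr//; move: bal; rewrite ler_norml => /andP[_ h].
  have := mulr_ge0 ga_ge0 h3; have := ler_wpM2l h2 xX; slra.
move: h2 h3 h4; rewrite /N => h2 h3 h4 h5.
have := ler_wpM2l mu1_ge0 h5; slra.
Qed.

Let rate x0 e l : eps <= 1 -> 0 < x0 -> x0 <= X t -> 0 < e -> N t * l <= - e ->
  l <= - (e / ((1 + mu1) * (1 + 5 / x0))).
Proof.
move=> e1 x00 xX e0 hl; have N0 := N_gt0 t t_ge0; have NM := N_le x0 e1 x00 xX.
have M0 := lt_le_trans N0 NM; set M := _ * _ in NM M0 *.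
rewrite lerNr ler_pdivrMr//.
have : l <= 0 by rewrite -(pmulr_rle0 _ N0); slra.
nra.
Qed.

Lemma width_slope_above e x0 : eps <= 1 -> 0 < x0 -> x0 <= X t -> 0 < e ->
  C * eps <= e / 2 -> Xl + e < X t ->
  exists2 l, upper_slope X t l & l <= - (e / 2 / ((1 + mu1) * (1 + 5 / x0))).
Proof.
move=> e1 x00 xX e0 Ce Xe; have [l hl Nl] := upper; exists l => //.
by apply: rate => //; slra.
Qed.

Lemma width_slope_below e x0 : eps <= 1 -> 0 < x0 -> x0 <= X t -> 0 < e ->
  C * eps <= e / 2 -> X t < Xl - e ->
  exists2 l, upper_slope (fun s => - X s) t l & l <= - (e / 2 / ((1 + mu1) * (1 + 5 / x0))).
Proof.
move=> e1 x00 xX e0 Ce Xe; have [l hl Nl] := lower; exists l => //.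
by apply: rate => //; slra.
Qed.

Lemma width_slope_low : C * eps <= Xl / 2 -> X t < Xl / 2 ->
  exists2 l, upper_slope (fun s => - X s) t l & l <= 0.
Proof.
move=> Ce Xe; have [l hl Nl] := lower; exists l => //.
rewrite -(pmulr_rle0 _ (N_gt0 t t_ge0)); slra.
Qed.

(** Eliminating between [lam N = 1 - m0 a2] and the balance writes [(1 - ga) N] times the difference
    as [(X - Xl) a2] minus the balance error; [a2 <= N] and [nu <= N] allow division by [N]. *)
Lemma lam_diff_le nu : 4 * eps <= (1 - ga) / 2 -> 0 < nu -> nu * (X t + ga) <= (1 - ga) / 2 ->
  `|lam t - ga / (1 - ga)| <= (`|X t - Xl| + 4 * eps / nu) / (1 - ga).
Proof.
move=> e8 nu0 hnu.
have be0 : 0 < 1 - ga by slra.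
have h2 := a2_ge t t_ge0; have h3 := a12_ge t t_ge0; have N0 := N_gt0 t t_ge0.
have X0 := width_gt0 t t_ge0.
have NA1 : A1 t <= N t by rewrite /N lerDl mulr_ge0.
have NA2 : A2 t <= N t by slra.
(* [(X + ga) a1] dominates [X a2 + ga (a1 - a2)], which is at least [(1 - ga) / 2] by the
   balance. *)
have nuN : nu <= N t.
  apply: le_trans NA1.
  have XG : 0 < X t + ga by slra.
  rewrite -(ler_pM2r XG); apply: le_trans hnu _.
  move: bal; rewrite ler_norml => /andP[h _].
  have := mulr_ge0 ga_ge0 h2; have := mulr_ge0 (ltW X0) h3; slra.
have BN : 0 < (1 - ga) * N t by rewrite mulr_gt0.
have -> : lam t - ga / (1 - ga) =
    ((X t - Xl) * A2 t - (X t * A2 t + ga * (A1 t - A2 t) - (1 - ga))) / ((1 - ga) * N t).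
  have -> : (X t - Xl) * A2 t - (X t * A2 t + ga * (A1 t - A2 t) - (1 - ga))
      = (1 - ga) * (lam t * N t) - ga * N t.
    by rewrite balance// /N /Xl; ring.
  by field; rewrite !gt_eqF.
rewrite normrM normfV (gtr0_norm BN) ler_pdivrMr//.
have -> : (`|X t - Xl| + 4 * eps / nu) / (1 - ga) * ((1 - ga) * N t) = (`|X t - Xl| + 4 * eps / nu) * N t.
  by field; rewrite !gt_eqF.
apply: le_trans (ler_normB _ _) _; rewrite [leRHS]mulrDl lerD//.
  by rewrite normrM (ger0_norm h2) ler_wpM2l.
apply: le_trans bal _.
have -> : 4 * eps / nu * N t = 4 * eps * (N t / nu) by ring.
apply: ler_peMr; first by rewrite mulr_ge0// ltW.
by rewrite ler_pdivlMr// mul1r.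
Qed.

End Regime.

Lemma width_cvg e : 0 < e -> exists2 T, 0 <= T & forall t, T <= t -> `|X t - Xl| <= e.
Proof.
move=> e0; have Xl0 := width_lim_gt0.
pose eps := Num.min 1 (Num.min e Xl / (2 * C)).
have C2 : 0 < 2 * C by rewrite mulr_gt0.
have eps0 : 0 < eps by rewrite lt_min ltr01 divr_gt0// lt_min e0.
have eps1 : eps <= 1 by rewrite ge_min lexx.
have epsm : C * eps <= Num.min e Xl / 2.
  have : eps <= Num.min e Xl / (2 * C) by rewrite ge_min lexx orbT.
  by rewrite ler_pdivlMr//; slra.
have Ce : C * eps <= e / 2.
  have : Num.min e Xl <= e by rewrite ge_min lexx.
  slra.
have Cx : C * eps <= Xl / 2.
  have : Num.min e Xl <= Xl by rewrite ge_min lexx orbT.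
  slra.
have [v0 v00 sl] := slope eps eps0.
have [T T0 hT] := delta_small v0 v00.
(* Below [Xl / 2] the function [X] cannot decrease, so [x0] is a lower bound from time [T] on. *)
pose x0 := Num.min (X T) (Xl / 2).
have x00 : 0 < x0 by rewrite lt_min width_gt0//= divr_gt0.
have Xx0 t : T <= t -> x0 <= X t.
  move=> Tt; rewrite -lerN2.
  apply: (upper_slope_barrier (f := fun s => - X s) (a := T)) => // [s /andP[Ts _]|s /andP[Ts _] h|].
  - by apply: cvgN; apply: width_cont; exact: le_trans Ts.
  - apply: (width_slope_low eps v0) => //; [exact: le_trans (ltW Ts)|exact/hT/ltW|].
    move: h; rewrite ltrN2 => /lt_le_trans; apply; by rewrite ge_min lexx orbT.
  - by rewrite lerN2 ge_min lexx.
have M0 : 0 < e / 2 / ((1 + mu1) * (1 + 5 / x0)).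
  have h5 : 0 < 5 / x0 by exact: divr_gt0.
  by rewrite divr_gt0 ?divr_gt0// mulr_gt0//; slra.
have [T1 TT1 h1] : exists2 T1, T <= T1 & forall t, T1 <= t -> X t <= Xl + e.
  apply: (upper_slope_eventually_le X T _ _ M0) => [t Tt|t Tt Xt].
    by apply: width_cont; exact: le_trans Tt.
  apply: (width_slope_above eps v0) => //; [exact: le_trans Tt|exact: hT|exact: Xx0].
have [T2 TT2 h2] : exists2 T2, T <= T2 & forall t, T2 <= t -> - X t <= - (Xl - e).
  apply: (upper_slope_eventually_le (fun s => - X s) T _ _ M0) => [t Tt|t Tt].
    by apply: cvgN; apply: width_cont; exact: le_trans Tt.
  rewrite ltrN2 => Xt.
  apply: (width_slope_below eps v0) => //; [exact: le_trans Tt|exact: hT|exact: Xx0].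
exists (Num.max T1 T2); first by rewrite le_max (le_trans T0).
move=> t; rewrite ge_max => /andP[/h1 u1 /h2 u2].
rewrite ler_norml; apply/andP; split; slra.
Qed.

Lemma lam_cvg e : 0 < e ->
  exists2 T, 0 <= T & forall t, T <= t -> `|lam t - ga / (1 - ga)| <= e.
Proof.
move=> e0; have Xl0 := width_lim_gt0.
have be0 : 0 < 1 - ga by slra.
(* Admissible in [lam_diff_le] as soon as [X <= Xl + 1]. *)
pose nu := (1 - ga) / 2 / (Xl + 1 + ga).
have D0 : 0 < Xl + 1 + ga by slra.
have nu0 : 0 < nu by rewrite divr_gt0// divr_gt0.
pose eps := Num.min ((1 - ga) / 8) (e * (1 - ga) / 2 * nu / 4).
have eps0 : 0 < eps.
  rewrite lt_min; apply/andP; split; first exact: divr_gt0.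
  by apply: divr_gt0 => //; apply: mulr_gt0 => //; apply: divr_gt0 => //; exact: mulr_gt0.
have eps1 : 4 * eps <= (1 - ga) / 2.
  have : eps <= (1 - ga) / 8 by rewrite ge_min lexx.
  slra.
have eps2 : 4 * eps / nu <= e * (1 - ga) / 2.
  have : eps <= e * (1 - ga) / 2 * nu / 4 by rewrite ge_min lexx orbT.
  rewrite ler_pdivrMr//; slra.
have [v0 v00 sl] := slope eps eps0.
have [T T0 hT] := delta_small v0 v00.
have d0 : 0 < Num.min 1 (e * (1 - ga) / 2) by rewrite lt_min ltr01 divr_gt0// mulr_gt0.
have [T1 T10 hT1] := width_cvg _ d0.
exists (Num.max T T1); first by rewrite le_max T0.
move=> t; rewrite ge_max => /andP[Tt /hT1]; rewrite le_min => /andP[w1 w2].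
have nuE : nu * (Xl + 1 + ga) = (1 - ga) / 2 by rewrite /nu divfK// gt_eqF.
have t0 := le_trans T0 Tt.
apply: le_trans (lam_diff_le eps v0 t t0 eps0 sl (hT t Tt) nu eps1 nu0 _) _.
  by rewrite -nuE ler_pM2l//; move: w1; rewrite ler_norml; slra.
by rewrite ler_pdivrMr//; slra.
Qed.

End WidthDynamics.

(** * Uniform convergence of the beta ratio to the stationary one *)

Section ProfileConvergence.
Context {R : realType} (W : R -> R).
Implicit Types s t u v x y z : R.
Hypothesis W_cont : continuous W.
Hypothesis W_mono : forall u v, u <= v -> W u <= W v.
Hypothesis W_le0 : forall v, v <= 0 -> W v = 0.
Hypothesis W_gt0 : forall v, 0 < v -> 0 < W v.

Context (E B lam mu : R -> R).
Hypothesis E_gt0 : forall t, 0 < E t.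
Hypothesis B_ge0 : forall t, 0 <= t -> 0 <= B t.
Hypothesis E_is_derive : forall t, 0 <= t -> is_derive t 1 E (lam t * E t).
Hypothesis B_is_derive : forall t, 0 <= t -> is_derive t 1 B (mu t * E t).
Hypothesis mu_gt0 : forall t, 0 <= t -> 0 < mu t.
Hypothesis Y_gt0 : forall t, 0 <= t -> 0 < lam t + mu t.
Hypothesis mass1 : forall t, 0 <= t -> mass W (expR t) (E t) (B t) 1 = 1.

Context (ga m0 mu1 : R).
Hypothesis m0_gt0 : 0 < m0.
Hypothesis mu1_ge0 : 0 <= mu1.
Hypothesis mu_affine : forall t, mu t = m0 + mu1 * lam t.
Hypothesis ga_ge0 : 0 <= ga.
Hypothesis ga_lt1 : ga < 1.
Hypothesis slope : forall eps : R, 0 < eps -> exists2 v0, 0 < v0 & G_slope W ga eps v0.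

Local Notation be := (1 - ga).
Local Notation lamL := (ga / (1 - ga)).
Local Notation muL := (m0 + mu1 * (ga / (1 - ga))).
Local Notation V z := (lamL * z + muL * z ^+ 2).
Local Notation X := (width W E B).
Local Notation Xl := (width_lim ga m0 mu1).
Local Notation xi t := (mass_ratio W (expR t) (E t) (B t)).
Local Notation S t := (stretch W (E t) (B t)).

Context (xik : R -> R).
Hypothesis xik_ge0 : forall z, 0 < z -> z <= 1 -> 0 <= xik z.
Hypothesis xik_le : forall z, 0 < z -> z <= 1 -> xik z <= z.
Hypothesis xik_cont : forall z, 0 < z -> z <= 1 -> {for z, continuous xik}.
Hypothesis xik_is_derive : forall z, 0 < z -> z < 1 ->
  is_derive z 1 xik (1 - xik z / V z).

Let be_gt0 : 0 < be. Proof. by rewrite subr_gt0. Qed.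
Let lamL_ge0 : 0 <= lamL. Proof. by rewrite divr_ge0// ltW. Qed.
Let muL_gt0 : 0 < muL.
Proof. by have := mulr_ge0 mu1_ge0 lamL_ge0; move: m0_gt0; lra. Qed.

(** The approximation of [S] by a quadratic in [z] becomes exactly [be * V z] when [X] is replaced
    by [Xl]. *)
Let stretch_limit t z : S t z - be * V z =
  (S t z - (X t * z ^+ 2 + ga * z * (1 - z))) + (X t - Xl) * z ^+ 2.
Proof. by rewrite /width_lim; field; rewrite gt_eqF. Qed.

Let ratio_diff t eps v0 z0 eta vmin b z : 0 <= t -> 0 < eps -> G_slope W ga eps v0 ->
  delta E B t <= v0 -> 0 < z0 -> 0 <= eta -> 0 < vmin -> eta <= be * vmin / 2 ->
  (forall y, z0 <= y -> y <= 1 -> vmin * y <= V y) ->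
  (forall y, z0 <= y -> y <= 1 -> `|S t y - be * V y| <= eta * y) ->
  z0 <= z -> z <= 1 -> `|b - be| <= eps ->
  `|b * xi t z / S t z - xik z / V z| <=
    (2 * (2 * eta / (be * vmin) + 2 * eps / be) * z + z0) / V z.
Proof.
move=> t0 eps0 sl dv z00 eta0 vm0 he hV hS zz z1 hb.
have Et := E_gt0 t; have Bt := B_ge0 t t0; have xt := expR_gt0 t.
apply: (comparison_ratio (xi t) (S t) xik be eps lamL muL) => //.
- exact: ltW.
- by move=> y y0 _; apply: mass_ratio_ge0 => //; exact: ltW.
- by move=> y y0 _; exact: mass_ratio_le.
- by move=> y y0 _; exact: mass_ratio_cont.
- move=> y y0 y1; rewrite (_ : be - eps = 1 - (ga + eps)); last ring.
  exact: (mass_ratio_upper_slope _ _ _ _ _ _ _ _ _ _ _ ga eps v0).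
- move=> y y0 y1; rewrite (_ : be + eps = 1 - (ga - eps)); last ring.
  exact: (mass_ratio_lower_slope _ _ _ _ _ _ _ _ _ _ _ ga eps v0).
Qed.

Let eventually_regime eps d : 0 < eps -> 0 < d -> exists v0 T,
  [/\ 0 <= T, G_slope W ga eps v0 & forall t, T <= t -> delta E B t <= v0 /\ `|X t - Xl| <= d].
Proof.
move=> eps0 d0; have [v0 v00 sl] := slope eps eps0.
have [T1 T10 h1] := delta_small W W_cont W_mono W_le0 W_gt0 E B E_gt0 B_ge0 mass1 v0 v00.
have [T2 T20 h2] := width_cvg W W_cont W_mono W_le0 W_gt0 E B lam mu E_gt0 B_ge0
  E_is_derive B_is_derive mu_gt0 Y_gt0 mass1 ga m0 mu1 m0_gt0 mu1_ge0 mu_affine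
  ga_ge0 ga_lt1 slope d d0.
exists v0, (Num.max T1 T2); split => //; first by rewrite le_max T10.
by move=> t; rewrite ge_max => /andP[/h1 ? /h2 ?].
Qed.

Lemma ratio_cvg_away z1 (e : R) : 0 < z1 -> 0 < e -> exists2 eps : R, 0 < eps &
  exists2 T, 0 <= T & forall t z b, T <= t -> z1 <= z -> z <= 1 -> `|b - be| <= eps ->
    `|b * xi t z / S t z - xik z / V z| <= e.
Proof.
move=> z10 e0.
(* A lower bound of [e * V z] for [z >= z1]. Half of it pays for [z0], the other half for
   [2 * theta * z]. *)
pose k := e * muL * z1 ^+ 2.
have k0 : 0 < k by rewrite mulr_gt0 ?mulr_gt0// exprn_gt0.
pose z0 := Num.min z1 (k / 2).
have z00 : 0 < z0 by rewrite lt_min z10 divr_gt0.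
have z0z1 : z0 <= z1 by rewrite ge_min lexx.
have z0k : z0 <= k / 2 by rewrite ge_min lexx orbT.
pose vmin := muL * z0.
have vm0 : 0 < vmin by rewrite mulr_gt0.
have bv0 : 0 < be * vmin by rewrite mulr_gt0.
pose eta := be * vmin * Num.min (1 / 2) (k / 16).
have m0' : 0 < Num.min (1 / 2) (k / 16) :> R by rewrite lt_min !divr_gt0.
have eta0 : 0 < eta by rewrite mulr_gt0.
have eta1 : eta <= be * vmin / 2.
  by rewrite /eta -mulrA -[leRHS]mulrA ler_pM2l// ler_pM2l// ge_min div1r lexx.
have eta2 : 2 * eta / (be * vmin) <= k / 8.
  rewrite ler_pdivrMr// /eta mulrCA mulrC ler_pM2r//.
  have : Num.min (1 / 2) (k / 16) <= k / 16 by rewrite ge_min lexx orbT.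
  lra.
pose eps := Num.min (be * k / 16) (eta * z0 / 4).
have eps0 : 0 < eps by rewrite lt_min !divr_gt0// !mulr_gt0.
have eps1 : 2 * eps / be <= k / 8.
  have : eps <= be * k / 16 by rewrite ge_min lexx.
  by rewrite ler_pdivrMr//; lra.
have eps2 : 2 * eps <= eta * z0 / 2.
  have : eps <= eta * z0 / 4 by rewrite ge_min lexx orbT.
  lra.
have d0 : 0 < eta * z0 / 2 by rewrite divr_gt0// mulr_gt0.
have [v0 [T [T0 sl hT]]] := eventually_regime eps (eta * z0 / 2) eps0 d0.
exists eps => //; exists T => // t z b Tt z1z zle1 hb.
have t0 := le_trans T0 Tt; have [dv dX] := hT t Tt.
have zz : z0 <= z by apply: le_trans z1z.
have z_gt0 := lt_le_trans z00 zz.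
have hV y : z0 <= y -> y <= 1 -> vmin * y <= V y.
  move=> y0 y1; have yp := lt_le_trans z00 y0.
  have h1 : 0 <= lamL * y by rewrite mulr_ge0// ltW.
  have h2 : muL * y * z0 <= muL * y * y by rewrite ler_pM2l// mulr_gt0.
  by rewrite /vmin expr2; lra.
have hS y : z0 <= y -> y <= 1 -> `|S t y - be * V y| <= eta * y.
  move=> y0 y1; have yp := lt_le_trans z00 y0.
  rewrite stretch_limit; apply: le_trans (ler_normD _ _) _.
  have h1 : `|S t y - (X t * y ^+ 2 + ga * y * (1 - y))| <= 2 * eps.
    by apply: (stretch_approx _ _ _ _ _ _ _ _ _ ga eps v0) => //; [exact: B_ge0|exact: ltW].
  have h2 : `|(X t - Xl) * y ^+ 2| <= `|X t - Xl|.
    rewrite normrM ler_piMr// ger0_norm ?sqr_ge0// expr_le1// ltW//.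
  have h3 : eta * z0 <= eta * y by rewrite ler_pM2l.
  lra.
apply: le_trans (ratio_diff t eps v0 z0 eta vmin b z t0 eps0 sl dv z00 (ltW eta0) vm0 eta1 hV hS zz zle1 hb) _.
have V0 : muL * z1 ^+ 2 <= V z.
  have h1 : 0 <= lamL * z by rewrite mulr_ge0// ltW.
  have h2 : muL * z1 ^+ 2 <= muL * z ^+ 2 by rewrite ler_pM2l// lerXn2r// nnegrE ltW.
  lra.
have V00 : 0 < V z by apply: lt_le_trans V0; rewrite mulr_gt0// exprn_gt0.
rewrite ler_pdivrMr//.
have ke : k <= e * V z by rewrite /k -mulrA ler_pM2l.
have hth : 2 * eta / (be * vmin) + 2 * eps / be <= k / 4 by lra.
have : (2 * eta / (be * vmin) + 2 * eps / be) * z <= k / 4 * 1.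
  apply: ler_pM => //; last exact: ltW.
  by rewrite addr_ge0// divr_ge0 ?mulr_ge0// ltW.
lra.
Qed.

(** For [ga > 0] both [V z >= lamL z] and the relative error of the stretch hold down to 0. Hence
    [eps] and [T] do not depend on the starting point [z0] of the comparison, which is sent to 0 at
    the end. *)
Lemma ratio_cvg (e : R) : 0 < ga -> 0 < e -> exists2 eps : R, 0 < eps &
  exists2 T, 0 <= T & forall t z b, T <= t -> 0 < z -> z <= 1 -> `|b - be| <= eps ->
    `|b * xi t z / S t z - xik z / V z| <= e.
Proof.
move=> ga0 e0.
have lamL0 : 0 < lamL by rewrite divr_gt0.
pose k := e * lamL.
have k0 : 0 < k by rewrite mulr_gt0.
have bv0 : 0 < be * lamL by rewrite mulr_gt0.
have Xl0 : 0 < Xl by exact: width_lim_gt0.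
pose eta := be * lamL * Num.min (1 / 2) (k / 16).
have m0' : 0 < Num.min (1 / 2) (k / 16) :> R by rewrite lt_min !divr_gt0.
have eta0 : 0 < eta by rewrite mulr_gt0.
have eta1 : eta <= be * lamL / 2.
  by rewrite /eta -mulrA -[leRHS]mulrA ler_pM2l// ler_pM2l// ge_min div1r lexx.
have eta2 : 2 * eta / (be * lamL) <= k / 8.
  rewrite ler_pdivrMr// /eta mulrCA mulrC ler_pM2r//.
  have : Num.min (1 / 2) (k / 16) <= k / 16 by rewrite ge_min lexx orbT.
  lra.
pose eps := Num.min (ga / 2) (Num.min (be * k / 16) (eta * ga / (8 * (Xl + 1)))).
have X1 : 0 < 8 * (Xl + 1) by lra.
have eps0 : 0 < eps.
  rewrite !lt_min; apply/and3P; split; [exact: divr_gt0| |].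
    by apply: divr_gt0 => //; exact: mulr_gt0.
  by apply: divr_gt0 => //; exact: mulr_gt0.
have eps1 : 2 * eps / be <= k / 8.
  have : eps <= be * k / 16 by rewrite !ge_min lexx !orbT.
  by rewrite ler_pdivrMr//; lra.
have eps2 : eps * (8 * (Xl + 1)) <= eta * ga.
  have : eps <= eta * ga / (8 * (Xl + 1)) by rewrite !ge_min lexx !orbT.
  by rewrite ler_pdivlMr.
have eps3 : eps <= ga / 2 by rewrite ge_min lexx.
have d0 : 0 < Num.min 1 (eta / 2) by rewrite lt_min ltr01 divr_gt0.
have [v0 [T [T0 sl hT]]] := eventually_regime eps (Num.min 1 (eta / 2)) eps0 d0.
exists eps => //; exists T => // t z b Tt z_gt0 zle1 hb.
have t0 := le_trans T0 Tt; have [dv] := hT t Tt; rewrite le_min => /andP[dX1 dX2].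
have hV y : 0 < y -> y <= 1 -> lamL * y <= V y.
  by move=> yp y1; rewrite lerDl mulr_ge0// ?sqr_ge0// ltW.
have hS y : 0 < y -> y <= 1 -> `|S t y - be * V y| <= eta * y.
  move=> yp y1.
  rewrite stretch_limit; apply: le_trans (ler_normD _ _) _.
  have h1 : `|S t y - (X t * y ^+ 2 + ga * y * (1 - y))| <= 2 * eps * X t / (ga - eps) * y.
    by apply: (stretch_approx_rel _ _ _ _ _ _ _ _ _ ga eps v0) => //; [exact: B_ge0|exact: ltW|lra].
  have h1' : 2 * eps * X t / (ga - eps) <= eta / 2.
    rewrite ler_pdivrMr; last lra.
    have : eps * X t <= eps * (Xl + 1) by rewrite ler_pM2l//; move: dX1; rewrite ler_norml; lra.
    have : eta * (ga / 2) <= eta * (ga - eps) by rewrite ler_pM2l//; lra.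
    lra.
  have h2 : `|(X t - Xl) * y ^+ 2| <= eta / 2 * y.
    rewrite normrM ler_pM// ger0_norm ?sqr_ge0// expr2 ler_piMr// ltW//.
  have := ler_wpM2r (ltW yp) h1'.
  lra.
have V00 : 0 < V z by apply: lt_le_trans (hV z z_gt0 zle1); rewrite mulr_gt0.
apply: (@ler_small _ z _ _ (V z)^-1) => // z0 /andP[z00 zz].
have hV0 y : z0 <= y -> y <= 1 -> lamL * y <= V y by move=> yz; apply: hV; exact: lt_le_trans yz.
have hS0 y : z0 <= y -> y <= 1 -> `|S t y - be * V y| <= eta * y.
  by move=> yz; apply: hS; exact: lt_le_trans yz.
apply: le_trans (ratio_diff t eps v0 z0 eta lamL b z t0 eps0 sl dv z00 (ltW eta0) lamL0 eta1 hV0 hS0 (ltW zz) zle1 hb) _.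
rewrite mulrDl lerD//; last by rewrite mulrC.
rewrite ler_pdivrMr//.
have ke : k * z <= e * V z by rewrite /k -mulrA ler_pM2l// hV.
have hth : 2 * eta / (be * lamL) + 2 * eps / be <= k / 4 by lra.
have := ler_wpM2r (ltW z_gt0) hth.
have := mulr_gt0 k0 z_gt0.
lra.
Qed.

End ProfileConvergence.

(** * The initial profile and the slope of its ratio [G] *)

Lemma density_bounds {R : realType} (c h k r be eps eta : R) : 0 < h -> 0 < k ->
  `|c * h / k ^+ 2 - be| <= eps ->
  `|(be - eps) * (k ^+ 2 / h) - (be - eps) * r| < eta ->
  `|(be + eps) * (k ^+ 2 / h) - (be + eps) * r| < eta ->
  (be - eps) * r - eta <= c <= (be + eps) * r + eta.
Proof.
move=> h0 k0; have q0 : 0 < k ^+ 2 / h by rewrite divr_gt0// exprn_gt0.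
have cE : c = c * h / k ^+ 2 * (k ^+ 2 / h) by field; rewrite !gt_eqF.
rewrite !ltr_norml ler_norml => /andP[b1 b2] /andP[k1 _] /andP[_ k2].
have c1 : (be - eps) * (k ^+ 2 / h) <= c by rewrite cE ler_pM2r//; lra.
have c2 : c <= (be + eps) * (k ^+ 2 / h) by rewrite [leLHS]cE ler_pM2r//; lra.
by apply/andP; split; lra.
Qed.

Section InitialProfile.
Context {R : realType}.
Notation mu := (@lebesgue_measure R).
Implicit Types (f g : R -> R) (s t u v x y z a b : R).

Lemma Rintegral_itv_cst a b (K : R) : a <= b -> \int[mu]_(s in `[a, b[) K = K * (b - a).
Proof.
move=> ab; rewrite Rintegral_cst//= lebesgue_measure_itv/= lte_fin.
by case: ltP => [//|ba]; rewrite (le_anti (introT andP (conj ab ba))) subrr.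
Qed.

Lemma integrable_itv_cst a b (K : R) : -1 <= a ->
  mu.-integrable `[a, b[ (EFin \o (fun=> K)).
Proof.
move=> a1; apply: loc_integrable_subo => //.
by apply: continuous_loc_integrable => x; exact: cvg_cst.
Qed.

Lemma Rintegral_itv_le f a b (K : R) : loc_integrable f -> -1 <= a -> a <= b ->
  (forall s, a <= s -> s < b -> f s <= K) -> \int[mu]_(s in `[a, b[) f s <= K * (b - a).
Proof.
move=> fi a1 ab fK; rewrite -(Rintegral_itv_cst a b K ab); apply: le_Rintegral => //.
- exact: loc_integrable_subo.
- exact: integrable_itv_cst.
- by move=> s /=; rewrite in_itv /= => /andP[? ?]; exact: fK.
Qed.

Lemma Rintegral_itv_ge f a b (K : R) : loc_integrable f -> -1 <= a -> a <= b ->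
  (forall s, a <= s -> s < b -> K <= f s) -> K * (b - a) <= \int[mu]_(s in `[a, b[) f s.
Proof.
move=> fi a1 ab fK; rewrite -(Rintegral_itv_cst a b K ab); apply: le_Rintegral => //.
- exact: integrable_itv_cst.
- exact: loc_integrable_subo.
- by move=> s /=; rewrite in_itv /= => /andP[? ?]; exact: fK.
Qed.

Lemma integral_reflect g x : continuous g -> 0 <= x -> x <= 1 ->
  \int[mu]_(y in `[x, 1[) g (1 - y) = prim g (1 - x).
Proof.
move=> cg x0 x1.
have crefl : continuous (fun y : R => 1 - y).
  by move=> y; apply: cvgB; [exact: cvg_cst|exact: cvg_id].
have cg' : continuous (fun y => g (1 - y)).
  by move=> y; apply: (continuous_comp (f := fun y : R => 1 - y)); [exact: crefl|exact: cg].
rewrite (integral_itv_prim (f := fun y => g (1 - y))) //; last 2 first.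
- exact: continuous_loc_integrable.
- lra.
have D y : x <= y <= 1 -> is_derive y 1 (fun y => prim (fun y => g (1 - y)) y + prim g (1 - y)) 0.
  move=> /andP[xy y1].
  have d1 : is_derive y 1 (prim (fun y => g (1 - y))) (g (1 - y)).
    apply: prim_is_derive; [exact: continuous_loc_integrable|lra|exact: cg'].
  have dy : is_derive y 1 (fun y : R => 1 - y) (-1) by derive; ring.
  have d2 : is_derive (1 - y) 1 (prim g) (g (1 - y)).
    apply: prim_is_derive; [exact: continuous_loc_integrable|lra|exact: cg].
  have d3 := is_derive_lam_comp (g := fun y : R => 1 - y) d2 dy.
  by derive; ring.
have h1 := is_derive_le0 D (fun _ _ => lexx _) x1.
have h2 := is_derive_ge0 D (fun _ _ => lexx _) x1.
move: h1 h2; cbv beta; rewrite subrr prim0; lra.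
Qed.

Context (c0 : R -> R).
Hypothesis c0_init : initial_data c0.

Let c0t := c0 \_ `[0, 1[.

Let c0t_int : loc_integrable c0t.
Proof.
move=> u; have [ci _ _ _] := c0_init.
have ci' : mu.-integrable setT (EFin \o c0t).
  by move: ci; rewrite integrable_mkcond//= (restrict_EFin c0).
by apply: (integrableS _ _ _ ci').
Qed.

Let c0tE s : 0 <= s -> s < 1 -> c0t s = c0 s.
Proof. by move=> s0 s1; rewrite /c0t patchE mem_set//= in_itv /= s0. Qed.

Let c0t_ge0 s : 0 <= c0t s.
Proof.
have [_ c0_ge0 _ _] := c0_init.
rewrite /c0t patchE; case: ifPn => // /set_mem /= h; exact: c0_ge0.
Qed.

Let P := prim c0t.

Let w_initE x : 0 <= x -> x <= 1 -> w_init c0 x = P 1 - P x.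
Proof.
move=> x0 x1; rewrite /P -integral_itv_prim//; last lra.
apply: eq_Rintegral => y; rewrite inE /= in_itv /= => /andP[xy y1].
by rewrite c0tE// (le_trans x0).
Qed.

Let P_mono x y : 0 <= x -> x <= y -> P x <= P y.
Proof.
move=> x0 xy; rewrite -subr_ge0 /P -integral_itv_prim//; last lra.
by apply: Rintegral_ge0 => *; exact: c0t_ge0.
Qed.

Definition clamp01 v : R := Num.min 1 (Num.max 0 v).

Lemma clamp01_id v : 0 <= v -> v <= 1 -> clamp01 v = v.
Proof. by move=> v0 v1; rewrite /clamp01 max_r// min_r. Qed.

Lemma clamp01_itv v : 0 <= clamp01 v <= 1.
Proof. by rewrite /clamp01 le_min ler01 le_max lexx ge_min lexx. Qed.

(** The extension by 0 on the left and by a constant on the right makes continuity and monotonicity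
    hold on the whole line. *)
Definition W_init v : R := w_init c0 (1 - clamp01 v).
Local Notation W := W_init.
Local Notation H := (prim W).

Let WE v : W v = P 1 - P (1 - clamp01 v).
Proof. by have /andP[? ?] := clamp01_itv v; rewrite /W_init w_initE//; lra. Qed.

Lemma W_init_cont : continuous W.
Proof.
move=> v; have /andP[? ?] := clamp01_itv v.
rewrite (_ : W = fun v => P 1 - P (1 - clamp01 v)); last by apply/funext => y; exact: WE.
apply: cvgB; first exact: cvg_cst.
apply: (continuous_comp (f := fun v => 1 - clamp01 v)); last first.
  by apply: prim_continuous => //; lra.
apply: cvgB; first exact: cvg_cst.
by apply: continuous_min; [exact: cvg_cst|apply: continuous_max; [exact: cvg_cst|exact: cvg_id]].
Qed.

Lemma W_init_mono u v : u <= v -> W u <= W v.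
Proof.
move=> uv; have /andP[? ?] := clamp01_itv v; have /andP[? ?] := clamp01_itv u.
rewrite !WE lerB//; apply: P_mono; first lra.
rewrite lerB// /clamp01 le_min ge_min lexx /= ge_min; apply/orP; right.
by rewrite ge_max !le_max lexx uv orbT.
Qed.

Lemma W_init_le0 v : v <= 0 -> W v = 0.
Proof.
move=> v0; rewrite WE /clamp01 max_l// min_r ?ler01//.
by rewrite subr0 subrr.
Qed.

Lemma W_init_gt0 v : 0 < v -> 0 < W v.
Proof.
move=> v0; have [_ _ w0 _] := c0_init; apply: w0.
have /andP[? c1] := clamp01_itv v.
have : 0 < clamp01 v by rewrite /clamp01 lt_min ltr01 lt_max v0 orbT.
by rewrite in_itv /=; lra.
Qed.

Lemma W_initE x : 0 <= x -> x <= 1 -> w_init c0 x = W (1 - x).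
Proof.
move=> x0 x1; rewrite /W_init clamp01_id; [|lra|lra].
by rewrite subKr.
Qed.

Lemma W_init_diff x y : 0 <= x -> x <= y -> y <= 1 ->
  W y - W x = \int[mu]_(s in `[1 - y, 1 - x[) c0t s.
Proof.
move=> x0 xy y1; rewrite !WE !clamp01_id; try lra.
rewrite integral_itv_prim//; try lra.
by rewrite -/P; ring.
Qed.

Section Slope.
Context (be eps v0 : R).
Hypothesis v0_lt1 : v0 < 1.
Hypothesis eps_gt0 : 0 < eps.
Hypothesis be_gt0 : 0 < be.
Hypothesis beta_near : forall v, 0 < v -> v < v0 ->
  `|c0 (1 - v) * H v / W v ^+ 2 - be| <= eps.

Let Wc := W_init_cont.
Let Wm := W_init_mono.
Let W0 := W_init_le0.
Let Wp := W_init_gt0.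
Let Hp v : 0 < v -> 0 < H v. Proof. exact: H_gt0. Qed.

(** The hypothesis on beta bounds the density [c0] pointwise; integration over [[1 - y, 1 - x[]
    turns this into bounds on increments of [W], with [W^2 / H] frozen at [x] by continuity. *)
Let W_near x eta : 0 < x -> x < v0 -> 0 < eta -> exists2 d, 0 < d &
  forall y, x < y -> y < x + d ->
  ((be - eps) * (W x ^+ 2 / H x) - eta) * (y - x) <= W y - W x <=
  ((be + eps) * (W x ^+ 2 / H x) + eta) * (y - x).
Proof.
move=> x0 xv eta0; have Hx := Hp x x0.
have cPhi k : {for x, continuous (fun v => k * (W v ^+ 2 / H v))}.
  apply: cvgM; first exact: cvg_cst.
  apply: cvgM; first by apply: cvgM; exact: Wc.
  apply: cvgV; first by rewrite gt_eqF.
  by apply: is_derive_continuous (H_is_derive _ Wc x _); lra.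
have /cvg_epsP /(_ eta eta0) [d1 d10 h1] := cPhi (be - eps).
have /cvg_epsP /(_ eta eta0) [d2 d20 h2] := cPhi (be + eps).
pose d := Num.min (v0 - x) (Num.min d1 d2).
have dv : d <= v0 - x by rewrite ge_min lexx.
have dd1 : d <= d1 by rewrite !ge_min lexx orbT.
have dd2 : d <= d2 by rewrite !ge_min lexx !orbT.
exists d; first by rewrite !lt_min d10 d20 subr_gt0 xv.
move=> y xy yd.
have y1 : y < 1 by move: v0_lt1; lra.
have c0b s : 1 - y <= s -> s < 1 - x ->
    (be - eps) * (W x ^+ 2 / H x) - eta <= c0t s <= (be + eps) * (W x ^+ 2 / H x) + eta.
  move=> s1 s2; have v_gt0 : 0 < 1 - s by lra.
  rewrite c0tE; [|lra|lra].
  have := beta_near (1 - s) v_gt0 ltac:(lra); rewrite subKr.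
  have Wv := Wp _ v_gt0; have Hv := Hp _ v_gt0.
  have vx : `|1 - s - x| < d by rewrite gtr0_norm; lra.
  move=> kb; have k1 := h1 _ (lt_le_trans vx dd1); have k2 := h2 _ (lt_le_trans vx dd2).
  exact: density_bounds Hv Wv kb k1 k2.
rewrite W_init_diff; [|lra|lra|lra].
have yx : y - x = (1 - x) - (1 - y) by ring.
rewrite yx; apply/andP; split.
  by apply: Rintegral_itv_ge => // [||s s1 s2]; [lra|lra|case/andP: (c0b s s1 s2)].
by apply: Rintegral_itv_le => // [||s s1 s2]; [lra|lra|case/andP: (c0b s s1 s2)].
Qed.

Let quot_is_derive (k : R) x : 0 < x ->
  is_derive x 1 (fun y => H y / (W x + k * (y - x))) (1 - k * H x / W x ^+ 2).
Proof.
move=> x0; have Wx := Wp x x0.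
have dH : is_derive x 1 H (W x) by apply: H_is_derive => //; lra.
derive; first by rewrite subrr mulr0 addr0 gt_eqF.
by rewrite subrr mulr0 addr0; field; rewrite gt_eqF.
Qed.

(** [W] grows at least at rate [k], so [H / W] lies below the quotient of [H] by an affine function,
    which is differentiable at [x]. The choice of [eta] makes [k H / W^2] equal to [be - 2 * eps] at
    [x]. *)
Let hratio_upper x : 0 < x -> x < v0 ->
  upper_slope (hratio W) x (1 - be + 2 * eps).
Proof.
move=> x0 xv; have Wx := Wp x x0; have Hx := Hp x x0.
pose eta := eps * (W x ^+ 2 / H x).
have eta0 : 0 < eta by rewrite mulr_gt0// divr_gt0// exprn_gt0.
have [d d0 h] := W_near x eta x0 xv eta0.
pose k := (be - eps) * (W x ^+ 2 / H x) - eta.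
exists (fun y => H y / (W x + k * (y - x))); split.
- by rewrite subrr mulr0 addr0.
- apply: is_derive_eq (quot_is_derive k x x0) _.
  by rewrite /k /eta; field; rewrite !gt_eqF.
(* [k] may be negative; this radius keeps the affine denominator positive. *)
pose d' := Num.min d (W x / (`|k| + 1)).
have kk : 0 < `|k| + 1 by rewrite ltr_wpDl.
have dd : d' <= d by rewrite ge_min lexx.
have dk : d' * (`|k| + 1) <= W x by rewrite -ler_pdivlMr// ge_min lexx orbT.
exists d'; first by rewrite lt_min d0 divr_gt0.
move=> y /andP[xy yd]; have yd' : y < x + d by lra.
have /andP[lo _] := h y xy yd'.
have y0 := lt_trans x0 xy.
have kyx : - W x < k * (y - x).
  have : `|k * (y - x)| < W x.
    rewrite normrM (gtr0_norm (_ : 0 < y - x)) ?subr_gt0//.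
    apply: lt_le_trans dk; rewrite mulrC; apply: ltr_pM => //.
    - by rewrite subr_ge0 ltW.
    - by rewrite ltrBlDl.
    - by rewrite ltrDl.
  by rewrite ltr_norml => /andP[].
have Dk : 0 < W x + k * (y - x) by rewrite addrC -ltrBlDr sub0r.
rewrite ler_wpM2l ?(ltW (Hp y y0))// lef_pV2 ?posrE ?Wp//.
by rewrite addrC -lerBrDr.
Qed.

Let hratio_lower x : 0 < x -> x < v0 ->
  upper_slope (fun y => - hratio W y) x (- (1 - be - 2 * eps)).
Proof.
move=> x0 xv; have Wx := Wp x x0; have Hx := Hp x x0.
have q0 : 0 < W x ^+ 2 / H x by rewrite divr_gt0// exprn_gt0.
pose eta := eps * (W x ^+ 2 / H x).
have eta0 : 0 < eta by rewrite mulr_gt0.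
have [d d0 h] := W_near x eta x0 xv eta0.
pose k := (be + eps) * (W x ^+ 2 / H x) + eta.
exists (fun y => - (H y / (W x + k * (y - x)))); split.
- by rewrite subrr mulr0 addr0.
- apply: is_derive_eq (is_derive_lamN (quot_is_derive k x x0)) _.
  by rewrite /k /eta; field; rewrite !gt_eqF.
exists d => // y /andP[xy yd]; have /andP[_ up] := h y xy yd.
have y0 := lt_trans x0 xy.
have k0 : 0 < k by rewrite addr_gt0// mulr_gt0// addr_gt0.
have kyx : 0 < k * (y - x) by rewrite mulr_gt0// subr_gt0.
have Dk : 0 < W x + k * (y - x) by rewrite addr_gt0.
rewrite lerN2 ler_wpM2l ?(ltW (Hp y y0))// lef_pV2 ?posrE ?Wp//.
by rewrite -lerBlDl.
Qed.

Lemma W_init_slope v1 : v1 < v0 -> G_slope W (1 - be) (2 * eps) v1.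
Proof.
move=> v1v u v u0 uv vv.
have cG x : u <= x <= v -> {for x, continuous (hratio W)}.
  by move=> /andP[ux _]; apply: G_cont => //; exact: lt_le_trans ux.
have dl (k x : R) : is_derive x 1 (fun y => k * y) k by derive; ring.
have up : hratio W v + - (1 - be + 2 * eps) * v <= hratio W u + - (1 - be + 2 * eps) * u.
  apply: (upper_slope_nonincr (f := fun x => hratio W x + - (1 - be + 2 * eps) * x)) => // x /andP[ux xv].
    by apply: cvgD; [apply: cG; rewrite ux|exact: is_derive_continuous (dl _ x)].
  exists ((1 - be + 2 * eps) + - (1 - be + 2 * eps)); last by rewrite subrr.
  have xv0 : x < v0 by lra.
  exact: (upper_slopeD _ _ _ _ _ (hratio_upper x (lt_trans u0 ux) xv0) (dl _ x)).
have lo : - hratio W v + (1 - be - 2 * eps) * v <= - hratio W u + (1 - be - 2 * eps) * u.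
  apply: (upper_slope_nonincr (f := fun x => - hratio W x + (1 - be - 2 * eps) * x)) => // x /andP[ux xv].
    by apply: cvgD; [apply: cvgN; apply: cG; rewrite ux|exact: is_derive_continuous (dl _ x)].
  exists (- (1 - be - 2 * eps) + (1 - be - 2 * eps)); last by rewrite addNr.
  have xv0 : x < v0 by lra.
  exact: (upper_slopeD _ _ _ _ _ (hratio_lower x (lt_trans u0 ux) xv0) (dl _ x)).
by move: up lo; rewrite ler_norml => up lo; apply/andP; split; lra.
Qed.

End Slope.

End InitialProfile.

(** * Derivatives relative to a domain *)

Section OneSided.
Context {R : realType}.
Implicit Types (f : R -> R) (D : set R) (x y l : R).

Lemma within_continuous_eps f D x : {within D, continuous f} -> D x ->
  forall e : R, 0 < e -> exists2 d, 0 < d & forall y, D y -> `|y - x| < d -> `|f y - f x| < e.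
Proof.
move=> cf Dx e e0.
move/subspace_continuousP: cf => /(_ x Dx) /cvgrPdist_lt /(_ e e0) h.
have [d /= d0 hd] := (nbhs_ballP _ _).1 h; exists d => // y Dy yd.
by rewrite distrC; apply: (hd y) => //; rewrite /ball /= distrC.
Qed.

Lemma is_deriv_in_epsP D f x l : is_deriv_in D f x l <->
  forall e : R, 0 < e -> exists2 d, 0 < d &
    forall y, D y -> `|y - x| < d -> `|f y - f x - l * (y - x)| <= e * `|y - x|.
Proof.
split=> [h e e0|h].
  move/cvgrPdist_lt: h => /(_ e e0) h.
  have [d /= d0 hd] := (nbhs_ballP _ _).1 h; exists d => // y Dy yd.
  have [->|yx] := eqVneq y x; first by rewrite !subrr mulr0 subr0 normr0 mulr0.
  have yx0 : y - x != 0 by rewrite subr_eq0.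
  have := hd y; rewrite /ball /= distrC => /(_ yd yx Dy) {}h.
  have -> : f y - f x - l * (y - x) = - ((l - (f y - f x) / (y - x)) * (y - x)).
    by field.
  by rewrite normrN normrM ler_wpM2r// ltW.
apply/cvgrPdist_le => e e0; have [d d0 H] := h e e0.
apply: (nbhs_ballP x (fun y => y != x -> D y -> `|l - (f y - f x) / (y - x)| <= e)).2.
exists d => //= y; rewrite /ball /= distrC => yd yx Dy.
have yx0 : y - x != 0 by rewrite subr_eq0.
have -> : l - (f y - f x) / (y - x) = - (f y - f x - l * (y - x)) / (y - x) by field.
by rewrite normrM normrN normfV ler_pdivrMr ?normr_gt0// H.
Qed.

Lemma is_derive_is_deriv_in D f x l : is_derive x 1 f l -> is_deriv_in D f x l.
Proof.
move=> /is_derive_epsP h; apply/is_deriv_in_epsP => e /h [d d0 hd].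
by exists d => // y _; exact: hd.
Qed.

Lemma eq_is_deriv_in D f g x l : (forall y, D y -> f y = g y) -> D x ->
  is_deriv_in D g x l -> is_deriv_in D f x l.
Proof.
move=> fg Dx /is_deriv_in_epsP h; apply/is_deriv_in_epsP => e /h [d d0 hd].
by exists d => // y Dy yd; rewrite !fg//; exact: hd.
Qed.

(** Composition with [clip] turns a function differentiable relative to [[a, b]] into a continuous
    function on the line with the same derivatives in the interior. *)
Definition clip (a b x : R) := Num.min b (Num.max a x).

Lemma clip_itv a b x : a <= b -> a <= clip a b x <= b.
Proof. by move=> ab; rewrite /clip le_min ab le_max lexx ge_min lexx. Qed.

Lemma clip_id a b x : a <= x -> x <= b -> clip a b x = x.
Proof. by move=> ax xb; rewrite /clip max_r// min_r. Qed.

Lemma max_lip a x y : `|Num.max a x - Num.max a y| <= `|x - y|.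
Proof.
have h1 := ler_norm (x - y); have h2 := ler_norm (y - x); rewrite distrC in h2.
by rewrite ler_norml; case: (leP a x) => ?; case: (leP a y) => ?; apply/andP; split; lra.
Qed.

Lemma min_lip a x y : `|Num.min a x - Num.min a y| <= `|x - y|.
Proof.
have h1 := ler_norm (x - y); have h2 := ler_norm (y - x); rewrite distrC in h2.
by rewrite ler_norml; case: (leP a x) => ?; case: (leP a y) => ?; apply/andP; split; lra.
Qed.

Lemma clip_lip a b x y : `|clip a b x - clip a b y| <= `|x - y|.
Proof. exact: le_trans (min_lip _ _ _) (max_lip _ _ _). Qed.

Lemma is_deriv_in_continuous f D : (forall x, D x -> exists l, is_deriv_in D f x l) ->
  forall x, D x -> forall e : R, 0 < e ->
  exists2 d, 0 < d & forall y, D y -> `|y - x| < d -> `|f y - f x| < e.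
Proof.
move=> df x Dx e e0; have [l /is_deriv_in_epsP /(_ 1 ltr01) [d d0 hd]] := df x Dx.
have k0 : 0 < `|l| + 1 by rewrite ltr_wpDl.
exists (Num.min d (e / (`|l| + 1))) => [|y Dy]; first by rewrite lt_min d0 divr_gt0.
rewrite lt_min => /andP[yd]; rewrite ltr_pdivlMr// => ye.
have := hd y Dy yd; rewrite mul1r => h.
have -> : f y - f x = (f y - f x - l * (y - x)) + l * (y - x) by ring.
apply: le_lt_trans (ler_normD _ _) _; rewrite normrM; lra.
Qed.

Lemma clip_deriv_continuous f a b : a <= b ->
  (forall x, x \in `[a, b] -> exists l, is_deriv_in `[a, b] f x l) ->
  continuous (fun x => f (clip a b x)).
Proof.
move=> ab df x; apply/cvg_epsP => e e0.
have cx : `[a, b]%classic (clip a b x) by rewrite /= in_itv /= clip_itv.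
have [d d0 hd] := is_deriv_in_continuous f _ df _ cx e e0.
exists d => // y yd; apply: hd; first by rewrite /= in_itv /= clip_itv.
by apply: le_lt_trans yd; exact: clip_lip.
Qed.

Lemma is_deriv_in_interior f D x l d : 0 < d -> (forall y, `|y - x| < d -> D y) ->
  is_deriv_in D f x l -> is_derive x 1 f l.
Proof.
move=> d0 hD /is_deriv_in_epsP h; apply/is_derive_epsP => e /h [d' d'0 hd].
exists (Num.min d d'); first by rewrite lt_min d0.
by move=> y; rewrite lt_min => /andP[/hD yD yd]; exact: hd.
Qed.

Lemma is_deriv_in_itv f a b x l : a < x -> x < b ->
  is_deriv_in `[a, b] f x l -> is_derive x 1 f l.
Proof.
move=> ax xb; apply: (is_deriv_in_interior _ _ _ _ (Num.min (x - a) (b - x))).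
  by rewrite lt_min !subr_gt0 ax.
move=> y; rewrite lt_min !ltr_norml => /andP[/andP[? ?] /andP[? ?]].
by rewrite /= in_itv /=; apply/andP; split; lra.
Qed.

Lemma clip_is_derive f a b x l : a < x -> x < b -> is_derive x 1 f l ->
  is_derive x 1 (fun y => f (clip a b y)) l.
Proof.
move=> ax xb; apply: (is_derive_near _ _ _ _ (Num.min (x - a) (b - x))).
  by rewrite lt_min !subr_gt0 ax.
move=> y; rewrite lt_min !ltr_norml => /andP[/andP[? ?] /andP[? ?]].
by rewrite clip_id//; lra.
Qed.

End OneSided.

(** * The characteristics as Moebius maps *)

Section Flow.
Context {R : realType} (kappa_t : R -> R) (al b p : R).
Implicit Types s t x z : R.
Hypothesis kappa_cont : {within `[0, +oo[, continuous kappa_t}.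
Hypothesis kappa_gt0 : forall t, 0 <= t -> 0 < kappa_t t.
Hypothesis al_gt0 : 0 < al.
Hypothesis b_gt0 : 0 < b.
Hypothesis p_ge0 : 0 <= p.

(** Freezing the function at negative times gives continuity on the line, so its primitives have
    two-sided derivatives at time 0. *)
Let kap t := kappa_t (Num.max t 0).

Let kap_gt0 t : 0 < kap t.
Proof. by apply: kappa_gt0; rewrite le_max lexx orbT. Qed.

Let kap_cont : continuous kap.
Proof.
move=> x; apply/cvg_epsP => e e0.
have cx : `[0, +oo[%classic (Num.max x 0) by rewrite /= in_itv /= le_max lexx orbT.
have [d d0 hd] := within_continuous_eps _ _ _ kappa_cont cx e e0.
exists d => // y yd; apply: hd; first by rewrite /= in_itv /= le_max lexx orbT.
by apply: le_lt_trans yd; rewrite !(maxC _ 0); exact: max_lip.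
Qed.

(** In the application [al = - phi'(1)], [b = - psi'(1)] and [p = psi''(1) / 2]; then [lam_of] and
    [mu_of] are the coefficients of [z] and [z^2] in the equation for [z = 1 - x]. *)
Definition lam_of t : R := kap t * b - al.
Definition mu_of t : R := al + kap t * p.
Local Notation lam := lam_of.
Local Notation mu := mu_of.

Lemma lam_of_cont : continuous lam.
Proof.
move=> x; apply: cvgB; last exact: cvg_cst.
by apply: cvgM; [exact: kap_cont|exact: cvg_cst].
Qed.

Lemma mu_of_cont : continuous mu.
Proof.
move=> x; apply: cvgD; first exact: cvg_cst.
by apply: cvgM; [exact: kap_cont|exact: cvg_cst].
Qed.

Lemma mu_of_gt0 t : 0 < mu t.
Proof. by rewrite ltr_wpDr// mulr_ge0// ltW. Qed.

Lemma lam_mu_of_gt0 t : 0 < lam t + mu t.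
Proof.
have -> : lam t + mu t = kap t * (b + p) by rewrite /lam_of /mu_of; ring.
by rewrite mulr_gt0// ltr_wpDr.
Qed.

Lemma mu_of_affine t : mu t = al * (1 + p / b) + p / b * lam t.
Proof. by rewrite /mu_of /lam_of; field; rewrite gt_eqF. Qed.

Lemma kappa_lam t : 0 <= t -> kappa_t t = (lam t + al) / b.
Proof. by move=> t0; rewrite /lam_of /kap max_l//; field; rewrite gt_eqF. Qed.

Definition E_of t : R := expR (prim lam t).
Local Notation E := E_of.
Definition B_of t : R := prim (fun s => mu s * E (Num.max s 0)) t.
Local Notation B := B_of.

Lemma E_of_gt0 t : 0 < E t. Proof. exact: expR_gt0. Qed.

Lemma E_of_is_derive t : 0 <= t -> is_derive t 1 E (lam t * E t).
Proof.
move=> t0; have dL : is_derive t 1 (prim lam) (lam t).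
  by apply: prim_is_derive; [exact/continuous_loc_integrable/lam_of_cont|lra|exact: lam_of_cont].
apply: is_derive_eq (is_derive_lam_comp (is_derive_expR (prim lam t)) dL) _.
by rewrite mulrC.
Qed.

Let muE_cont : continuous (fun s => mu s * E (Num.max s 0)).
Proof.
move=> x; apply: cvgM; first exact: mu_of_cont.
apply: (continuous_max0 E) => y y0.
exact: is_derive_continuous (E_of_is_derive y y0).
Qed.

Lemma B_of_is_derive t : 0 <= t -> is_derive t 1 B (mu t * E t).
Proof.
move=> t0; rewrite (_ : mu t * E t = mu t * E (Num.max t 0)); last by rewrite max_l.
apply: (prim_is_derive (f := fun s => mu s * E (Num.max s 0))).
- exact/continuous_loc_integrable/muE_cont.
- lra.
- exact: muE_cont.
Qed.

Lemma E_of0 : E 0 = 1. Proof. by rewrite /E_of prim0 expR0. Qed.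
Lemma B_of0 : B 0 = 0. Proof. exact: prim0. Qed.

Lemma B_of_ge0 t : 0 <= t -> 0 <= B t.
Proof.
move=> t0; rewrite -B_of0; apply: (is_derive_ge0 (f := B) (df := fun t => mu t * E t)) => // x /andP[x0 _].
  exact: B_of_is_derive.
by rewrite mulr_ge0// ltW// ?mu_of_gt0 ?E_of_gt0.
Qed.

(* The Bernoulli equation z' = lam z + mu z^2 makes E / z + B constant. *)
Lemma characteristic_moebius (v : R -> R) (xi : R -> R) t : 0 <= t ->
  (forall s, s \in `[0, t] -> is_deriv_in `[0, t] xi s (v s)) ->
  (forall s, 0 <= s -> s <= t ->
     v s = - (lam s * (1 - xi s) + mu s * (1 - xi s) ^+ 2)) ->
  xi t <= 1 ->
  1 - xi 0 = moebius (E t) (B t) (1 - xi t).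
Proof.
move=> t0 dxi vE xit.
pose x s := xi (clip 0 t s).
have cx : continuous x.
  by apply: clip_deriv_continuous => // s st; exists (v s); exact: dxi.
have dx s : 0 < s -> s < t -> is_derive s 1 x (- (lam s * (1 - x s) + mu s * (1 - x s) ^+ 2)).
  move=> s0 st; rewrite {2 3}/x clip_id ?ltW// -vE ?ltW//.
  apply: clip_is_derive => //; apply: (is_deriv_in_itv _ 0 t) => //.
  by apply: dxi; rewrite in_itv /= !ltW.
pose r s := lam s + mu s * (1 - x s).
have cr : continuous r.
  move=> s; apply: cvgD; first exact: lam_of_cont.
  apply: cvgM; first exact: mu_of_cont.
  by apply: cvgB; [exact: cvg_cst|exact: cx].
pose z0 := 1 - xi 0.
(* The invariant without division by [z]: [z (1 - B z0) - E z0] vanishes at time 0 and solves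
   [Y' = r Y], so the exponential factor makes it constant. *)
pose D s := ((1 - x s) * (1 - B s * z0) - E s * z0) * expR (- prim r s).
have dr s : -1 < s -> is_derive s 1 (prim r) (r s).
  by move=> s1; apply: prim_is_derive => //; [exact: continuous_loc_integrable|exact: cr].
have dexp s : -1 < s -> is_derive s 1 (fun s => expR (- prim r s)) (expR (- prim r s) * (- r s)).
  move=> s1; apply: (is_derive_lam_comp (g := fun s => - prim r s) (is_derive_expR _)).
  exact/is_derive_lamN/dr.
have cD s : 0 <= s <= t -> {for s, continuous D}.
  move=> /andP[s0 st]; apply: cvgM; last by apply: is_derive_continuous (dexp s _); lra.
  apply: cvgB; last first.
    by apply: cvgM; [exact: is_derive_continuous (E_of_is_derive s s0)|exact: cvg_cst].
  apply: cvgM; first by apply: cvgB; [exact: cvg_cst|exact: cx].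
  apply: cvgB; first exact: cvg_cst.
  by apply: cvgM; [exact: is_derive_continuous (B_of_is_derive s s0)|exact: cvg_cst].
have dD s : 0 < s < t -> is_derive s 1 D 0.
  move=> /andP[s0 st]; have d1 := dx s s0 st; have d2 := dexp s ltac:(lra).
  have d3 := E_of_is_derive s (ltW s0); have d4 := B_of_is_derive s (ltW s0).
  by rewrite /D; derive; rewrite /r; ring.
have h1 := is_derive_nonincr cD dD (fun _ _ => lexx _) t0.
have h2 := is_derive_nondecr cD dD (fun _ _ => lexx _) t0.
have D0 : D 0 = 0.
  by rewrite /D /x clip_id// E_of0 B_of0 -/z0; ring.
have : D t = 0 by rewrite -D0; apply: le_anti; rewrite h1 h2.
rewrite /D => /eqP; rewrite mulf_eq0 (gt_eqF (expR_gt0 _)) orbF => /eqP.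
rewrite /x clip_id// => h.
have d0 : 0 < E t + B t * (1 - xi t).
  by rewrite ltr_wpDr ?E_of_gt0// mulr_ge0 ?B_of_ge0// subr_ge0.
have dn : E t + B t * (1 - xi t) != 0 by rewrite gt_eqF.
apply: (mulIf dn); rewrite /moebius divfK//.
apply/eqP; rewrite -/z0 -subr_eq0 -[X in _ == X]oppr0 -h; apply/eqP; ring.
Qed.

End Flow.

(** * The time independent solution *)

Section TimeIndependent.
Context {R : realType}.
Notation mu := (@lebesgue_measure R).
Implicit Types x y z s a : R.

Lemma deriv_inE (f : R -> R) x l : 0 <= x -> x < 1 ->
  is_deriv_in `[0, 1[ f x l -> deriv_in `[0, 1[ f x = l.
Proof.
move=> x0 x1 h.
have PF : ProperFilter (within `[0, 1[%classic x^').
  apply: Build_ProperFilter => h0.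
  have [d /= d0 hd] := (nbhs_ballP _ _).1 h0.
  pose m := Num.min d (1 - x).
  have m0 : 0 < m by rewrite lt_min d0 subr_gt0.
  have md : m <= d by rewrite ge_min lexx.
  have mx : m <= 1 - x by rewrite ge_min lexx orbT.
  apply: (hd (x + m / 2)).
  - by rewrite /ball /= opprD addNKr normrN gtr0_norm ?divr_gt0//; lra.
  - by rewrite -subr_eq0 addrAC subrr add0r gt_eqF// divr_gt0.
  - by rewrite /= in_itv /=; apply/andP; split; lra.
by apply: cvg_lim => //; exact: h.
Qed.

Context (lam m : R) (w u : R -> R).
Hypothesis lam_ge0 : 0 <= lam.
Hypothesis m_gt0 : 0 < m.
Local Notation V z := (lam * z + m * z ^+ 2).
Hypothesis uE : forall x, 0 <= x -> x < 1 -> u x = - V (1 - x).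
Hypothesis w_eq : forall x, x \in `[0, 1[ ->
  exists2 l : R, is_deriv_in `[0, 1[ w x l & u x * l = w x.
Hypothesis w_mass : \int[mu]_(x in `[0, 1[) w x = 1.

Let V_gt0 z : 0 < z -> 0 < V z.
Proof.
move=> z0; have h1 : 0 <= lam * z by rewrite mulr_ge0// ltW.
have h2 : 0 < m * z ^+ 2 by rewrite mulr_gt0// exprn_gt0.
lra.
Qed.

Let w_deriv x : 0 <= x -> x < 1 -> is_deriv_in `[0, 1[ w x (- w x / V (1 - x)).
Proof.
move=> x0 x1; have [|l hl ul] := w_eq x; first by rewrite in_itv /= x0.
suff -> : - w x / V (1 - x) = l by [].
have V0 : 0 < V (1 - x) by apply: V_gt0; lra.
rewrite uE// in ul; rewrite -ul; field; rewrite gt_eqF//.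
Qed.

Let in01 x : `[0, 1[%classic x -> 0 <= x < 1.
Proof. by rewrite /= in_itv. Qed.

Let w_eps x : 0 <= x -> x < 1 -> forall e : R, 0 < e ->
  exists2 d, 0 < d & forall y, `[0, 1[%classic y -> `|y - x| < d -> `|w y - w x| < e.
Proof.
move=> x0 x1; apply: is_deriv_in_continuous => [y /in01 /andP[y0 y1]|].
  by exists (- w y / V (1 - y)); exact: w_deriv.
by rewrite /= in_itv /= x0.
Qed.

Let w_clip_cont a : 0 <= a -> a < 1 -> continuous (fun x => w (clip 0 a x)).
Proof.
move=> a0 a1 x; apply/cvg_epsP => e e0.
have /andP[c0 ca] := clip_itv 0 a x a0.
have [d d0 hd] := w_eps (clip 0 a x) c0 (le_lt_trans ca a1) e e0.
exists d => // y yd; apply: hd; last exact: le_lt_trans (clip_lip _ _ _ _) yd.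
by have /andP[k0 ka] := clip_itv 0 a y a0; rewrite /= in_itv /= k0 (le_lt_trans ka).
Qed.

Let w_is_derive x : 0 < x -> x < 1 -> is_derive x 1 w (- w x / V (1 - x)).
Proof.
move=> x0 x1; apply: (is_deriv_in_interior _ `[0, 1[%classic _ _ (Num.min x (1 - x))).
- by rewrite lt_min x0 subr_gt0.
- move=> y; rewrite lt_min !ltr_norml => /andP[/andP[? ?] /andP[? ?]].
  by rewrite /= in_itv /=; apply/andP; split; lra.
- by apply: w_deriv => //; exact: ltW.
Qed.

(** Integrating factor for [w' = - w / V]. Clipping at [a < 1] keeps [1 / V] away from its
    singularity at [x = 1]. *)
Let w_exp a : 0 <= a -> a < 1 -> exists2 k : R, 0 < k & w a = w 0 * k.
Proof.
move=> a0 a1.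
have dV z : is_derive z 1 (fun z => V z) (lam + 2 * m * z) by derive; ring.
have cV : continuous (fun z => V z) by move=> z; exact: is_derive_continuous (dV z).
pose g s := (V (1 - clip 0 a s))^-1.
have cclip : continuous (clip 0 a).
  move=> x; apply: continuous_min; first exact: cvg_cst.
  by apply: continuous_max; [exact: cvg_cst|exact: cvg_id].
have cg : continuous g.
  move=> s; have /andP[c0 ca] := clip_itv 0 a s a0.
  apply: cvgV; first by rewrite gt_eqF// V_gt0//; lra.
  apply: (continuous_comp (f := fun s => 1 - clip 0 a s) (g := fun z => V z)); last exact: cV.
  by apply: cvgB; [exact: cvg_cst|exact: cclip].
have dg s : -1 < s -> is_derive s 1 (prim g) (g s).
  by move=> s1; apply: prim_is_derive => //; [exact: continuous_loc_integrable|exact: cg].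
have de s : -1 < s -> is_derive s 1 (fun s => expR (prim g s)) (expR (prim g s) * g s).
  by move=> s1; apply: is_derive_lam_comp (is_derive_expR _) (dg s s1).
pose f s := w (clip 0 a s) * expR (prim g s).
have cf s : 0 <= s <= a -> {for s, continuous f}.
  move=> /andP[s0 sa]; apply: cvgM; first exact: w_clip_cont.
  by apply: is_derive_continuous (de s _); lra.
have df s : 0 < s < a -> is_derive s 1 f 0.
  move=> /andP[s0 sa]; have d1 := de s ltac:(lra).
  have d2 := clip_is_derive _ 0 a s _ s0 sa (w_is_derive s s0 (lt_trans sa a1)).
  have V0 : 0 < V (1 - s) by apply: V_gt0; lra.
  rewrite /f; derive; rewrite /g clip_id ?ltW//.
  by field; rewrite gt_eqF.
have h1 := is_derive_nonincr cf df (fun _ _ => lexx _) a0.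
have h2 := is_derive_nondecr cf df (fun _ _ => lexx _) a0.
have E0 : f 0 = w 0 by rewrite /f clip_id// prim0 expR0 mulr1.
have Ea : f a = w a * expR (prim g a) by rewrite /f clip_id.
have eg := expR_gt0 (prim g a).
exists (expR (prim g a))^-1; first by rewrite invr_gt0.
have fE : f a = f 0 by apply: le_anti; rewrite h1 h2.
have <- : w a * expR (prim g a) = w 0 by exact: etrans (esym Ea) (etrans fE E0).
by rewrite mulfK// gt_eqF.
Qed.

(** Integrability is read off from the mass: [fine] sends an infinite integral to 0, which is not 1.
    Since [w] is continuous on [[0, 1[], it is measurable. *)
Let w_int : mu.-integrable `[0, 1[ (EFin \o w).
Proof.
have mw : measurable_fun (`[0, 1[%classic : set R) w.
  apply: measurable_realfun.subspace_continuous_measurable_fun => //.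
  apply/subspace_continuousP => x /in01 /andP[x0 x1].
  apply/cvgrPdist_lt => e e0; have [d d0 hd] := w_eps x x0 x1 e e0.
  apply: (nbhs_ballP x (fun y => `[0, 1[%classic y -> `|w x - w y| < e)).2.
  exists d => //= y; rewrite /ball /= distrC => yd Dy.
  by rewrite distrC; exact: hd.
apply/integrableP; split; first exact/measurable_realfun.measurable_EFinP.
rewrite /= integral_fin_num_abs//.
have : \int[mu]_(x in `[0, 1[) w x != 0 by rewrite w_mass oner_neq0.
by rewrite /Rintegral; case: (integral _ _ _) => //=; rewrite eqxx.
Qed.

Let wt := w \_ `[0, 1[.

Let wt_int : loc_integrable wt.
Proof.
move=> v; have ci' : mu.-integrable setT (EFin \o wt).
  by move: w_int; rewrite integrable_mkcond//= (restrict_EFin w).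
by apply: (integrableS _ _ _ ci').
Qed.

Let wtE s : 0 <= s -> s < 1 -> wt s = w s.
Proof. by move=> s0 s1; rewrite /wt patchE mem_set//= in_itv /= s0. Qed.

Let tailE x : 0 <= x -> \int[mu]_(y in `[x, 1[) w y = \int[mu]_(y in `[x, 1[) wt y.
Proof.
move=> x0; apply: eq_Rintegral => y; rewrite inE /= in_itv /= => /andP[xy y1].
by rewrite wtE// (le_trans x0).
Qed.

(** By [w_exp] the function has the sign of [w 0] everywhere, and a nonpositive one cannot have mass
    1. *)
Let w0_gt0 : 0 < w 0.
Proof.
rewrite ltNge; apply/negP => w0.
have : \int[mu]_(y in `[0, 1[) wt y <= 0 * (1 - 0).
  have n1 : -1 <= 0 :> R by lra.
  apply: (Rintegral_itv_le _ _ _ _ wt_int n1 ler01) => s s0 s1.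
  by rewrite wtE//; have [k k0 ->] := w_exp s s0 s1; rewrite mulr_le0_ge0// ltW.
by rewrite -tailE// w_mass mul0r ler10.
Qed.

Let w_gt0 x : 0 <= x -> x < 1 -> 0 < w x.
Proof. by move=> x0 x1; have [k k0 ->] := w_exp x x0 x1; rewrite mulr_gt0. Qed.

Let w_anti x y : 0 <= x -> x <= y -> y < 1 -> w y <= w x.
Proof.
move=> x0 xy y1; have y0 := le_trans x0 xy.
have : w (clip 0 y y) <= w (clip 0 y x).
  apply: (is_derive_nonincr (f := fun s => w (clip 0 y s)) (df := fun s => - w s / V (1 - s))) => // [s _|s /andP[xs sy]|s /andP[xs sy]].
  - exact: w_clip_cont.
  - have s0 := le_lt_trans x0 xs; apply: clip_is_derive => //; apply: w_is_derive => //; lra.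
  - have s0 := le_lt_trans x0 xs.
    rewrite mulNr oppr_le0 divr_ge0// ltW ?w_gt0 ?V_gt0//; lra.
by rewrite !clip_id.
Qed.

Let P := prim wt.

(** Stationary counterpart of [mass_ratio]. The [Num.max] keeps the argument of [w] in its domain
    for [z > 1], so that two-sided continuity at [z = 1] holds. *)
Definition tail_ratio z : R :=
  (prim (w \_ `[0, 1[) 1 - prim (w \_ `[0, 1[) (1 - z)) / w (Num.max 0 (1 - z)).

Let tail_ratioE z : 0 < z -> z <= 1 ->
  tail_ratio z = \int[mu]_(y in `[1 - z, 1[) w y / w (1 - z).
Proof.
move=> z0 z1; rewrite tailE; last lra.
rewrite (integral_itv_prim wt_int); [|lra|lra].
by rewrite /tail_ratio max_r//; lra.
Qed.

Lemma tail_ratio_ge0 z : 0 < z -> z <= 1 -> 0 <= tail_ratio z.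
Proof.
move=> z0 z1; rewrite tail_ratioE// divr_ge0//.
  apply: Rintegral_ge0 => y /=; rewrite in_itv /= => /andP[zy y1].
  by rewrite ltW// w_gt0//; lra.
by rewrite ltW// w_gt0//; lra.
Qed.

Lemma tail_ratio_le z : 0 < z -> z <= 1 -> tail_ratio z <= z.
Proof.
move=> z0 z1; have w0 : 0 < w (1 - z) by apply: w_gt0; lra.
rewrite tail_ratioE// ler_pdivrMr// tailE; last lra.
have -> : z * w (1 - z) = w (1 - z) * (1 - (1 - z)) by ring.
have n1 : -1 <= 1 - z by lra.
have n2 : 1 - z <= 1 by lra.
apply: (Rintegral_itv_le _ _ _ _ wt_int n1 n2) => s s0 s1.
by rewrite wtE; [apply: w_anti|..]; lra.
Qed.

Lemma tail_ratio_cont z : 0 < z -> z <= 1 -> {for z, continuous tail_ratio}.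
Proof.
move=> z0 z1; have cz : continuous (fun z : R => 1 - z).
  by move=> y; apply: cvgB; [exact: cvg_cst|exact: cvg_id].
apply: cvgM.
  apply: cvgB; first exact: cvg_cst.
  apply: (continuous_comp (f := fun z : R => 1 - z)); first exact: cz.
  by apply: prim_continuous => //; lra.
apply: cvgV; first by rewrite max_r ?gt_eqF ?w_gt0//; lra.
(* For [y >= z / 2] the upper clipping at [a] is inactive, so near [z] the clipped function is the
   denominator of [tail_ratio]. *)
pose a := 1 - z / 2.
have h : {for z, continuous (fun y => w (clip 0 a (1 - y)))}.
  have cw : continuous (fun x => w (clip 0 a x)) by apply: w_clip_cont; rewrite /a; lra.
  apply: (continuous_comp (f := fun z : R => 1 - z) (g := fun x => w (clip 0 a x))).
    exact: cz.
  exact: cw.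
apply/cvg_epsP => e e0; have /cvg_epsP /(_ e e0) [d d0 hd] := h.
exists (Num.min d (z / 2)); first by rewrite lt_min d0 divr_gt0.
move=> y; rewrite lt_min => /andP[yd]; rewrite ltr_norml => /andP[y1 y2].
have := hd y yd.
have E x : z / 2 <= x -> clip 0 a (1 - x) = Num.max 0 (1 - x).
  by move=> zx; rewrite /clip min_r// ge_max /a; apply/andP; split; lra.
by rewrite !E//; lra.
Qed.

Lemma tail_ratio_is_derive z : 0 < z -> z < 1 ->
  is_derive z 1 tail_ratio (1 - tail_ratio z / V z).
Proof.
move=> z0 z1; have wz : 0 < w (1 - z) by apply: w_gt0; lra.
have Vz : 0 < V z by exact: V_gt0.
have dz : is_derive z 1 (fun z : R => 1 - z) (-1) by derive; ring.
have dw : is_derive (1 - z) 1 w (- w (1 - z) / V z).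
  have -> : V z = V (1 - (1 - z)) by rewrite subKr.
  by apply: w_is_derive; lra.
have dwz := is_derive_lam_comp (g := fun z : R => 1 - z) dw dz.
have cwt : {for 1 - z, continuous wt}.
  apply/cvg_epsP => e e0.
  have /cvg_epsP /(_ e e0) [d d0 hd] := is_derive_continuous dw.
  exists (Num.min d (Num.min z (1 - z))); first by rewrite !lt_min d0 z0 subr_gt0.
  move=> y; rewrite !lt_min => /and3P[yd k1 k2].
  rewrite ltr_norml in k1; rewrite ltr_norml in k2.
  case/andP: k1 => ? ?; case/andP: k2 => ? ?.
  have Ey : wt y = w y by apply: wtE; lra.
  have Ez : wt (1 - z) = w (1 - z) by apply: wtE; lra.
  change (`|wt y - wt (1 - z)| < e); rewrite Ey Ez.
  exact: hd.
have dP : is_derive (1 - z) 1 (prim wt) (w (1 - z)).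
  have wz' : wt (1 - z) = w (1 - z) by apply: wtE; lra.
  rewrite -wz'; apply: prim_is_derive => //; lra.
have dPz := is_derive_lam_comp (g := fun z : R => 1 - z) dP dz.
apply: (is_derive_near (fun z => (P 1 - P (1 - z)) / w (1 - z)) _ _ _ (1 - z)).
- by rewrite subr_gt0.
- by move=> y; rewrite ltr_norml => /andP[_ yz]; rewrite /tail_ratio max_r//; lra.
rewrite /P; derive; first by rewrite gt_eqF.
rewrite /tail_ratio max_r; last lra.
by rewrite -/wt; field; rewrite !gt_eqF.
Qed.

Lemma beta_ti_tail_ratio z : 0 < z -> z <= 1 -> beta_ti w (1 - z) = tail_ratio z / V z.
Proof.
move=> z0 z1; have wz : 0 < w (1 - z) by apply: w_gt0; lra.
have Vz : 0 < V z by exact: V_gt0.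
rewrite tail_ratioE// /beta_ti (deriv_inE w (1 - z) (- w (1 - z) / V z)); [|lra|lra|].
  by field; rewrite !gt_eqF.
have -> : V z = V (1 - (1 - z)) by rewrite subKr.
by apply: w_deriv; lra.
Qed.

End TimeIndependent.

(** * Quadratic polynomials *)

Section Quadratics.
Context {R : realType}.
Implicit Types (p : {poly R}) (x : R).

Lemma horner_quadratic p x : (size p <= 3)%N -> p.[x] = p`_0 + p`_1 * x + p`_2 * x ^+ 2.
Proof.
move=> sp; rewrite (horner_coef_wide _ sp) !big_ord_recr big_ord0 /=.
by rewrite expr0 expr1; ring.
Qed.

Lemma deriv_quadratic p : (size p <= 3)%N -> p^`().[1] = p`_1 + 2 * p`_2.
Proof.
move=> sp; have sd : (size p^`() <= 2)%N.
  apply: leq_trans (size_poly _ _) _; by case: (size p) sp => [|[|[|[]]]].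
rewrite (horner_coef_wide _ sd) !big_ord_recr big_ord0 /= !coef_deriv.
by rewrite expr0 expr1; ring.
Qed.

(** Midpoint convexity between 0 and 1 suffices: the gap there is a quarter of the leading
    coefficient. *)
Lemma convex_quadratic_ge0 p : (size p <= 3)%N ->
  convex_function (`[0, 1] : set R) (fun x : R => p.[x]) -> 0 <= p`_2.
Proof.
move=> sp cp.
have h0 : (0 : R) <= 2^-1 by lra.
have h1 : (2^-1 : R) <= 1 by lra.
have m0 : (0 : R) \in `[0, 1]%classic by rewrite inE /= in_itv /= lexx ler01.
have m1 : (1 : R) \in `[0, 1]%classic by rewrite inE /= in_itv /= lexx ler01.
have := cp (Itv01 h0 h1) 0 1 m0 m1.
rewrite !convRE /= !horner_quadratic// /unstable.onem.
set c := conv _ _ _; have -> : c = 2^-1; last lra.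
by transitivity (2^-1 * 0 + (1 - 2^-1) * 1 : R); [|lra].
Qed.

End Quadratics.

(** * Convergence of extended suprema *)

Section SupDist.
Context {R : realType}.
Implicit Types (A : set R) (f : R -> R -> R) (g : R -> R).

Lemma cvg_pinfty_le (f : R -> R) (l : R) :
  (forall e, 0 < e -> exists T, forall t, T <= t -> `|f t - l| <= e) ->
  f t @[t --> +oo] --> l.
Proof.
move=> h; apply/cvgrPdist_le => e e0; have [T hT] := h e e0.
exists T; split; first exact: num_real.
by move=> t /ltW Tt; rewrite distrC; exact: hT.
Qed.

(** A point of [A] keeps the supremum nonnegative: over the empty set it would be minus infinity. *)
Lemma sup_dist_cvg0 A f g a : A a ->
  (forall e, 0 < e -> exists T, forall t, T <= t -> forall x, A x -> `|f t x - g x| <= e) ->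
  sup_dist A (f t) g @[t --> +oo] --> 0%E.
Proof.
move=> Aa h.
have bnd e : 0 < e -> exists T, forall t, T <= t -> (0%:E <= sup_dist A (f t) g <= e%:E)%E.
  move=> /h [T hT]; exists T => t /hT {}hT; apply/andP; split.
    apply: (@le_trans _ _ (`|f t a - g a|%:E)); first by rewrite lee_fin.
    by apply: ereal_sup_ubound; exists a.
  by apply: ge_ereal_sup => _ [x Ax <-]; rewrite lee_fin hT.
have fin t (e : R) : (0%:E <= sup_dist A (f t) g <= e%:E)%E ->
    sup_dist A (f t) g \is a fin_num /\ `|fine (sup_dist A (f t) g)| <= e.
  case: sup_dist => [r| |] /andP[] //; rewrite !lee_fin => r0 re.
  by split => //=; rewrite ger0_norm.
apply/fine_cvgP; split.
  have [T hT] := bnd 1 ltr01; exists T; split; first exact: num_real.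
  by move=> t /ltW /hT /fin [].
apply: cvg_pinfty_le => e /bnd [T hT]; exists T => t /hT /fin [_ h'].
by rewrite subr0.
Qed.

End SupDist.

(** * Application to the solution of the evolution equation *)

Section Main.
Context {R : realType} (phi psi : {poly R}).
Implicit Types s t u v x y z e : R.
Hypothesis phi_quadratic : (size phi <= 3)%N.
Hypothesis phi0 : phi.[0] = 0.
Hypothesis phi1 : phi.[1] = 0.
Hypothesis dphi1 : phi^`().[1] < 0.
Hypothesis psi_quadratic : (size psi <= 3)%N.
Hypothesis psi_convex : convex_function (`[0, 1] : set R) (fun x : R => psi.[x]).
Hypothesis psi1 : psi.[1] = 0.
Hypothesis dpsi1 : psi^`().[1] < 0.
Context (c0 : R -> R).
Hypothesis c0_init : initial_data c0.
Context (kappa_t : R -> R) (F : R -> R -> R).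
Hypothesis sol : solution phi psi c0 kappa_t F.
Context (beta0 : R).
Hypothesis beta0_gt0 : 0 < beta0.
Hypothesis beta0_lim : beta c0 F x 0 @[x --> (1 : R)^'-] --> beta0.

Let al := - phi^`().[1].
Let b := - psi^`().[1].
Let p := psi`_2.

Let al_gt0 : 0 < al. Proof. by rewrite oppr_gt0. Qed.
Let b_gt0 : 0 < b. Proof. by rewrite oppr_gt0. Qed.
Let p_ge0 : 0 <= p. Proof. exact: convex_quadratic_ge0. Qed.

Let velocityE (k : R) x :
  phi.[x] - k * psi.[x] = - ((k * b - al) * (1 - x) + (al + k * p) * (1 - x) ^+ 2).
Proof.
move: phi0 phi1 psi1; rewrite /al /b /p !deriv_quadratic// !horner_quadratic// => h1 h2 h3.
have e0 : phi`_0 = 0 by lra.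
have e1 : phi`_1 = - phi`_2 by lra.
have e2 : psi`_0 = - psi`_1 - psi`_2 by lra.
by rewrite e0 e1 e2; ring.
Qed.

Let kappa_cont : {within `[0, +oo[, continuous kappa_t}. Proof. by case: sol. Qed.
Let kappa_gt0 t : 0 <= t -> 0 < kappa_t t. Proof. by case: sol => _ h _ _; exact: h. Qed.

Local Notation lam := (lam_of kappa_t al b).
Local Notation mu := (mu_of kappa_t al p).
Local Notation E := (E_of kappa_t al b).
Local Notation B := (B_of kappa_t al b p).
Local Notation W := (W_init c0).
Local Notation H := (prim W).

Local Opaque prim E_of B_of W_init.

Let Wc : continuous W. Proof. exact: W_init_cont. Qed.
Let Wm u v : u <= v -> W u <= W v. Proof. exact: W_init_mono. Qed.
Let W0 v : v <= 0 -> W v = 0. Proof. exact: W_init_le0. Qed.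
Let Wp v : 0 < v -> 0 < W v. Proof. exact: W_init_gt0. Qed.

Let Ep t : 0 < E t. Proof. exact: E_of_gt0. Qed.
Let Bp t : 0 <= t -> 0 <= B t. Proof. exact: B_of_ge0. Qed.
Let dE t : 0 <= t -> is_derive t 1 E (lam t * E t). Proof. exact: E_of_is_derive. Qed.
Let dB t : 0 <= t -> is_derive t 1 B (mu t * E t). Proof. exact: B_of_is_derive. Qed.
Let mup t : 0 <= t -> 0 < mu t. Proof. by move=> _; exact: mu_of_gt0. Qed.
Let Yp t : 0 <= t -> 0 < lam t + mu t. Proof. by move=> _; exact: lam_mu_of_gt0. Qed.

Let flowE x t : 0 <= x -> x < 1 -> 0 <= t ->
  0 <= F x t <= 1 /\ F x t = 1 - moebius (E t) (B t) (1 - x).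
Proof.
move=> x0 x1 t0; have [_ _ fl _] := sol.
have [||xi [xi01 dxi xit] ->] := fl x t; [by rewrite in_itv /= x0|exact: t0|].
have m0 : 0 \in `[0, t] by rewrite in_itv /= lexx.
split; first by have := xi01 0 m0; rewrite in_itv.
rewrite -xit -(characteristic_moebius kappa_t al b p kappa_cont kappa_gt0 al_gt0 p_ge0
  (fun s => phi.[xi s] - kappa_t s * psi.[xi s]) xi t t0) ?subKr//.
- by move=> s s0 st; rewrite velocityE /lam_of /mu_of max_l.
- by rewrite xit ltW.
Qed.

Let w_solE x t : 0 <= x -> x < 1 -> 0 <= t ->
  w_sol c0 F x t = slice W (expR t) (E t) (B t) (1 - x).
Proof.
move=> x0 x1 t0; have [/andP[F0 F1] FE] := flowE x t x0 x1 t0.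
rewrite /w_sol W_initE// sliceE; last by rewrite subr_ge0 ltW.
by rewrite FE subKr.
Qed.

Let slice_cont' t : 0 <= t -> continuous (slice W (expR t) (E t) (B t)).
Proof. by move=> t0; apply: slice_cont => //; exact: Bp. Qed.

Let h_solE x t : 0 <= x -> x < 1 -> 0 <= t ->
  h_sol c0 F x t = mass W (expR t) (E t) (B t) (1 - x).
Proof.
move=> x0 x1 t0; rewrite /mass -(integral_reflect (slice W (expR t) (E t) (B t)) x (slice_cont' t t0) x0 (ltW x1)).
apply: eq_Rintegral => y; rewrite inE /= in_itv /= => /andP[xy y1].
by rewrite w_solE// (le_trans x0).
Qed.

Let mass1 t : 0 <= t -> mass W (expR t) (E t) (B t) 1 = 1.
Proof.
move=> t0; have [_ _ _ h] := sol.
by transitivity (h_sol c0 F 0 t); [rewrite h_solE// subr0|exact: h].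
Qed.

(** The initial beta function at [x = 1 - v]. *)
Let b0 v := c0 (1 - v) * H v / W v ^+ 2.

Let betaE z t : 0 < z -> z <= 1 -> 0 <= t ->
  beta c0 F (1 - z) t = b0 (moebius (E t) (B t) z) *
    mass_ratio W (expR t) (E t) (B t) z / stretch W (E t) (B t) z.
Proof.
move=> z0 z1 t0; have x0 : 0 <= 1 - z by lra.
have x1 : 1 - z < 1 by lra.
have [_ FE] := flowE (1 - z) t x0 x1 t0; rewrite subKr in FE.
have Et := Ep t; have Bt := Bp t t0; have et := expR_gt0 t.
have dz := den_gt0 (E t) (B t) Et Bt z (ltW z0).
have vz : 0 < moebius (E t) (B t) z by exact: moebius_gt0.
have dF : deriv_in `[0, 1[ (fun y => F y t) (1 - z) = E t / (E t + B t * z) ^+ 2.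
  apply: deriv_inE => //.
  have dm : is_derive (1 - z) 1 (fun y => 1 - moebius (E t) (B t) (1 - y))
      (E t / (E t + B t * z) ^+ 2).
    have d1 : is_derive (1 - (1 - z)) 1 (moebius (E t) (B t)) (E t / (E t + B t * z) ^+ 2).
      by rewrite subKr; apply: moebius_is_derive => //; exact: ltW.
    have d2 : is_derive (1 - z) 1 (fun y : R => 1 - y) (-1) by derive; ring.
    have d3 := is_derive_lam_comp (g := fun y : R => 1 - y) d1 d2.
    by derive; ring.
  apply: (eq_is_deriv_in _ _ (fun y => 1 - moebius (E t) (B t) (1 - y))).
  - by move=> y; rewrite /= in_itv /= => /andP[y0 y1]; have [_ ->] := flowE y t y0 y1 t0.
  - by rewrite /= in_itv /= x0.
  - exact: is_derive_is_deriv_in.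
rewrite /beta /c_sol w_solE// h_solE// !subKr dF FE.
have Wv := Wp _ vz.
have Hv : 0 < H (moebius (E t) (B t) z) by exact: H_gt0.
rewrite /b0 /mass_ratio /stretch /hratio sliceE ?(ltW z0)//.
by field; rewrite !gt_eqF.
Qed.

Let slice_at0 : slice W (expR 0) (E 0) (B 0) = W.
Proof.
apply/funext => y; rewrite /slice expR0 E_of0 B_of0 mul1r /moebius mul0r addr0 divr1.
by have [y0|//] := leP y 0; rewrite [RHS]W0// W0.
Qed.

(** At time 0 the flow is the identity and both [mass_ratio] and [stretch] reduce to [H / W], so the
    formula for beta at a general time gives [b0] itself. *)
Let beta_near e : 0 < e -> exists v0 : R, [/\ 0 < v0, v0 < 1 &
  forall v, 0 < v -> v < v0 -> `|b0 v - beta0| <= e].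
Proof.
move=> e0; move/cvgrPdist_lt: beta0_lim => /(_ e e0) h.
have [d /= d0 hd] := (nbhs_ballP _ _).1 h.
exists (Num.min d 2^-1); split.
- by rewrite lt_min d0 /= invr_gt0 ltr0n.
- by rewrite gt_min; apply/orP; right; lra.
move=> v v0; rewrite lt_min => /andP[vd v2].
have := hd (1 - v); rewrite /ball /= opprB addrC subrK gtr0_norm// => /(_ vd ltac:(lra)).
rewrite betaE//; last lra.
have Wv := Wp _ v0.
have Hv : 0 < H v by exact: H_gt0.
have -> : moebius (E 0) (B 0) v = v by rewrite E_of0 B_of0 /moebius mul0r addr0 divr1.
have -> : mass_ratio W (expR 0) (E 0) (B 0) v = H v / W v.
  by rewrite /mass_ratio /mass slice_at0.
have -> : stretch W (E 0) (B 0) v = H v / W v.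
  rewrite /stretch E_of0 B_of0 /moebius mul0r addr0 divr1 expr1n mulr1 divr1 //.
rewrite mulfK; last by rewrite gt_eqF// divr_gt0.
by rewrite distrC => /ltW.
Qed.

Let slope e : 0 < e -> exists2 v1 : R, 0 < v1 & G_slope W (1 - beta0) e v1.
Proof.
move=> e0; have e2 : 0 < e / 2 by rewrite divr_gt0.
have [v0 [v00 v01 h]] := beta_near (e / 2) e2.
exists (v0 / 2); first by rewrite divr_gt0.
have -> : e = 2 * (e / 2) by field.
by apply: (W_init_slope c0 c0_init beta0 (e / 2) v0) => //; lra.
Qed.

Lemma beta0_le1 : beta0 <= 1.
Proof.
rewrite -subr_ge0; exact: (G_slope_ge0 W Wc Wm W0 Wp (1 - beta0) slope).
Qed.

Let ga_lt1 : 1 - beta0 < 1. Proof. by rewrite ltrBlDr ltrDl. Qed.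
Let ga_ge0 : 0 <= 1 - beta0. Proof. by rewrite subr_ge0 beta0_le1. Qed.
Let m0 := al * (1 + p / b).
Let mu1 := p / b.
Let mu1_ge0 : 0 <= mu1. Proof. by rewrite divr_ge0// ltW. Qed.
Let m0_gt0 : 0 < m0. Proof. by rewrite mulr_gt0// ltr_wpDr. Qed.
Let muA t : mu t = m0 + mu1 * lam t. Proof. exact: mu_of_affine. Qed.

Let kap_lim := (beta0^-1 - phi^`().[1] - 1) / `|psi^`().[1]|.

(** Solves [lam = kappa * b - al] for [kappa] at the limit [lam = 1 / beta0 - 1]. *)
Let kap_limE : kap_lim = ((1 - beta0) / (1 - (1 - beta0)) + al) / b.
Proof.
rewrite /kap_lim ltr0_norm// -/b -/al; congr (_ / _).
by rewrite subKr; field; rewrite gt_eqF.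
Qed.

Lemma kappa_cvg : kappa_t t @[t --> +oo] --> kap_lim.
Proof.
apply: cvg_pinfty_le => e e0.
have eb : 0 < e * b by rewrite mulr_gt0.
have [T T0 hT] := lam_cvg W Wc Wm W0 Wp E B lam mu Ep Bp dE dB mup Yp mass1
  (1 - beta0) m0 mu1 m0_gt0 mu1_ge0 muA ga_ge0 ga_lt1 slope (e * b) eb.
exists T => t Tt; have := hT t Tt.
rewrite (kappa_lam kappa_t al b b_gt0 t (le_trans T0 Tt)) kap_limE -mulrBl.
rewrite (_ : lam t + al - _ = lam t - (1 - beta0) / (1 - (1 - beta0))); last ring.
rewrite normrM normfV (gtr0_norm b_gt0).
by rewrite ler_pdivrMr.
Qed.

Section Limit.
Context (w : R -> R).
Hypothesis w_ti : time_independent phi psi kap_lim w.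

Local Notation lamL := ((1 - beta0) / (1 - (1 - beta0))).
Local Notation muL := (m0 + mu1 * lamL).
Local Notation V z := (lamL * z + muL * z ^+ 2).

Let lamL_ge0 : 0 <= lamL. Proof. by rewrite divr_ge0// subKr ltW. Qed.
Let muL_gt0 : 0 < muL.
Proof. by have := mulr_ge0 mu1_ge0 lamL_ge0; move: m0_gt0; lra. Qed.

Let uE x : 0 <= x -> x < 1 -> phi.[x] - kap_lim * psi.[x] = - V (1 - x).
Proof.
move=> _ _; rewrite velocityE kap_limE.
set L := lamL.
have -> : (L + al) / b * b - al = L by field; rewrite gt_eqF.
suff -> : al + (L + al) / b * p = m0 + mu1 * L by [].
by rewrite /m0 /mu1; field; rewrite gt_eqF.
Qed.

Let w_mass : \int[@lebesgue_measure R]_(x in `[0, 1[) w x = 1. Proof. by case: w_ti. Qed.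
Let w_eq x : x \in `[0, 1[ -> exists2 l : R, is_deriv_in `[0, 1[ w x l &
  (phi.[x] - kap_lim * psi.[x]) * l = w x.
Proof. by case: w_ti => h _; exact: h. Qed.

Let beta_diff t z : 0 < z -> z <= 1 -> 0 <= t ->
  beta c0 F (1 - z) t - beta_ti w (1 - z) =
  b0 (moebius (E t) (B t) z) * mass_ratio W (expR t) (E t) (B t) z / stretch W (E t) (B t) z
   - tail_ratio w z / V z.
Proof.
move=> z0 z1 t0; rewrite betaE//; congr (_ - _).
exact: (beta_ti_tail_ratio lamL muL w (fun x => phi.[x] - kap_lim * psi.[x])
  lamL_ge0 muL_gt0 uE w_eq w_mass z z0 z1).
Qed.

Let tr_ge0 z (z0 : 0 < z) (z1 : z <= 1) :=
  tail_ratio_ge0 lamL muL w _ lamL_ge0 muL_gt0 uE w_eq w_mass z z0 z1.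
Let tr_le z (z0 : 0 < z) (z1 : z <= 1) :=
  tail_ratio_le lamL muL w _ lamL_ge0 muL_gt0 uE w_eq w_mass z z0 z1.
Let tr_cont z (z0 : 0 < z) (z1 : z <= 1) :=
  tail_ratio_cont lamL muL w _ lamL_ge0 muL_gt0 uE w_eq w_mass z z0 z1.
Let tr_is_derive z (z0 : 0 < z) (z1 : z < 1) :=
  tail_ratio_is_derive lamL muL w _ lamL_ge0 muL_gt0 uE w_eq w_mass z z0 z1.

(** All arguments [moebius (E t) (B t) z] are at most [delta t], which tends to 0; hence uniformity
    in [z]. *)
Let b0_near e : 0 < e -> exists2 T, 0 <= T & forall t z, T <= t -> 0 < z -> z <= 1 ->
  `|b0 (moebius (E t) (B t) z) - (1 - (1 - beta0))| <= e.
Proof.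
move=> e0; have [v0 [v00 v01 h]] := beta_near e e0.
have v02 : 0 < v0 / 2 by rewrite divr_gt0.
have [T T0 hT] := delta_small W Wc Wm W0 Wp E B Ep Bp mass1 (v0 / 2) v02.
exists T => // t z Tt z0 z1; have t0 := le_trans T0 Tt.
have Et := Ep t; have Bt := Bp t t0.
rewrite subKr; apply: h; first exact: moebius_gt0.
have : moebius (E t) (B t) z <= delta E B t by apply: moebius_mono => //; exact: ltW.
by have := hT t Tt; lra.
Qed.

(** Common form of the two regimes: either [z] stays away from 0, or the stationary velocity has a
    positive linear part. *)
Let beta_cvg_on z1 : 0 <= z1 -> 0 < z1 \/ 0 < 1 - beta0 ->
  forall e, 0 < e -> exists T, forall t, T <= t -> forall z, 0 < z -> z1 <= z -> z <= 1 ->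
    `|beta c0 F (1 - z) t - beta_ti w (1 - z)| <= e.
Proof.
move=> _ cases e e0.
have [eps eps0 [T T0 hT]] : exists2 eps : R, 0 < eps & exists2 T, 0 <= T &
    forall t z v, T <= t -> 0 < z -> z1 <= z -> z <= 1 -> `|v - (1 - (1 - beta0))| <= eps ->
    `|v * mass_ratio W (expR t) (E t) (B t) z / stretch W (E t) (B t) z - tail_ratio w z / V z| <= e.
  case: cases => [z10|ga0].
    have [eps eps0 [T T0 hT]] := ratio_cvg_away W Wc Wm W0 Wp E B lam mu Ep Bp dE dB mup Yp mass1
      (1 - beta0) m0 mu1 m0_gt0 mu1_ge0 muA ga_ge0 ga_lt1 slope
      (tail_ratio w) tr_ge0 tr_le tr_cont tr_is_derive z1 e z10 e0.
    by exists eps => //; exists T => // t z v Tt _; exact: hT.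
  have [eps eps0 [T T0 hT]] := ratio_cvg W Wc Wm W0 Wp E B lam mu Ep Bp dE dB mup Yp mass1
      (1 - beta0) m0 mu1 m0_gt0 mu1_ge0 muA ga_ge0 ga_lt1 slope
      (tail_ratio w) tr_ge0 tr_le tr_cont tr_is_derive e ga0 e0.
  by exists eps => //; exists T => // t z v Tt z0 _; exact: hT.
have [T' T'0 hT'] := b0_near eps eps0.
exists (Num.max T T') => t; rewrite ge_max => /andP[Tt Tt'] z z0 zz z1'.
rewrite beta_diff//; last exact: le_trans Tt.
by apply: hT => //; exact: hT'.
Qed.

Lemma beta_cvg : 0 < 1 - beta0 ->
  sup_dist `[0, 1[ (fun x => beta c0 F x t) (beta_ti w) @[t --> +oo] --> 0%E.
Proof.
move=> ga0; apply: (sup_dist_cvg0 _ (fun t x => beta c0 F x t) _ 0).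
  by rewrite /= in_itv /= lexx ltr01.
move=> e e0; have [T hT] := beta_cvg_on 0 (lexx _) (or_intror ga0) e e0.
exists T => t Tt x; rewrite /= in_itv /= => /andP[x0 x1].
by have := hT t Tt (1 - x); rewrite subKr; apply; lra.
Qed.

Lemma beta_cvg_away (eps : R) : 0 < eps -> eps < 1 ->
  sup_dist `[0, 1 - eps] (fun x => beta c0 F x t) (beta_ti w) @[t --> +oo] --> 0%E.
Proof.
move=> eps0 eps1; apply: (sup_dist_cvg0 _ (fun t x => beta c0 F x t) _ 0).
  by rewrite /= in_itv /= lexx subr_ge0 ltW.
move=> e e0; have [T hT] := beta_cvg_on eps (ltW eps0) (or_introl eps0) e e0.
exists T => t Tt x; rewrite /= in_itv /= => /andP[x0 x1].
by have := hT t Tt (1 - x); rewrite subKr; apply; lra.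
Qed.

End Limit.

End Main.

Theorem theorem1p2 (R : realType) (phi psi : {poly R})
    (phi_quadratic : (size phi <= 3)%N)
    (phi_concave : convex_function (`[0, 1] : set R) (fun x : R => - phi.[x]))
    (phi0 : phi.[0] = 0) (phi1 : phi.[1] = 0)
    (dphi1 : -1 < phi^`().[1] < 0)
    (psi_quadratic : (size psi <= 3)%N)
    (psi_convex : convex_function (`[0, 1] : set R) (fun x : R => psi.[x]))
    (psi1 : psi.[1] = 0) (dpsi1 : psi^`().[1] < 0)
    (d2psi_phi : 0 < psi^`(2).[1] - phi^`(2).[1])
    (c0 : R -> R) (c0_init : initial_data c0)
    (kappa_t : R -> R) (F : R -> R -> R)
    (sol : solution phi psi c0 kappa_t F)
    (beta0 : R) (beta0_gt0 : 0 < beta0)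
    (beta0_lim : beta c0 F x 0 @[x --> (1 : R)^'-] --> beta0) :
  let kappa := (beta0^-1 - phi^`().[1] - 1) / `|psi^`().[1]| in
  let kappa0 := phi^`().[1] / psi^`().[1] in
  [/\ beta0 <= 1,
      beta0 < 1 ->
        (kappa_t t @[t --> +oo] --> kappa) /\
        (forall w_kappa : R -> R, time_independent phi psi kappa w_kappa ->
           sup_dist `[0, 1[ (fun x => beta c0 F x t) (beta_ti w_kappa)
             @[t --> +oo] --> 0%E) &
      beta0 = 1 ->
        forall eps : R, 0 < eps < 1 ->
        (kappa_t t @[t --> +oo] --> kappa0) /\
        (forall w_kappa0 : R -> R, time_independent phi psi kappa0 w_kappa0 ->
           sup_dist `[0, 1 - eps] (fun x => beta c0 F x t) (beta_ti w_kappa0)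
             @[t --> +oo] --> 0%E)].
Proof.
have /andP[_ dphi1'] := dphi1.
move=> kappa kappa0.
have le1 := beta0_le1 phi psi phi_quadratic phi0 phi1 dphi1' psi_quadratic
  psi_convex psi1 c0 c0_init kappa_t F sol beta0 beta0_gt0 beta0_lim.
have cvg := kappa_cvg phi psi phi_quadratic phi0 phi1 dphi1' psi_quadratic
  psi_convex psi1 dpsi1 c0 c0_init kappa_t F sol beta0 beta0_gt0 beta0_lim.
split=> // [lt1|beta0_1 eps /andP[eps0 eps1]].
  split=> // w wti.
  apply: (beta_cvg phi psi phi_quadratic phi0 phi1 dphi1' psi_quadratic
    psi_convex psi1 dpsi1 c0 c0_init kappa_t F sol beta0 beta0_gt0 beta0_lim w wti).
  by rewrite subr_gt0.
(* At [beta0 = 1] the terms [beta0^-1] and [- 1] cancel, leaving a quotient of two negative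
   derivatives. *)
have kappa0E : kappa0 = kappa.
  rewrite /kappa0 /kappa beta0_1 invr1 ltr0_norm// addrAC subrr add0r.
  by rewrite invrN mulrNN.
rewrite kappa0E; split=> // w wti.
exact: (beta_cvg_away phi psi phi_quadratic phi0 phi1 dphi1' psi_quadratic
  psi_convex psi1 dpsi1 c0 c0_init kappa_t F sol beta0 beta0_gt0 beta0_lim w wti).
Qed.
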